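(* Fix an integer $p\ge 2$, $\boldsymbol\theta_0\in\mathcal{S}^{p-1}$ and $f\in\mathcal{F}$. Let $(\kappa_n)$ be a positive real sequence that diverges to infinity. Let $(\boldsymbol\tau_n)$ be a sequence in $\mathbb{R}^p$ converging to $\boldsymbol\tau$ and such that $\boldsymbol\theta_n=\boldsymbol\theta_0+\nu_n\boldsymbol\tau_n\in\mathcal{S}^{p-1}$ for all $n$, with $\nu_n:=1/\sqrt{n\kappa_n\varphi_f(\kappa_n)}$. Then: (i) under ${\rm P}^{(n)}_{\boldsymbol\theta_0,\kappa_n,f}$, $$W_n=S_n+o_{\rm P}(1)\stackrel{\mathcal{D}}{\to}\chi^2_{p-1}$$ as $n\to\infty$; (ii) under ${\rm P}^{(n)}_{\boldsymbol\theta_n,\kappa_n,f}$, $$W_n=S_n+o_{\rm P}(1)\stackrel{\mathcal{D}}{\to}\chi^2_{p-1}\big(\|\boldsymbol\tau\|^2\big)$$ as $n\to\infty$, where $\chi^2_{p-1}(c)$ denotes the non-central chi-square distribution with $p-1$ degrees of freedom and non-centrality parameter $c$.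
   Context: $\mathcal{S}^{p-1}$ is the unit sphere of $\mathbb{R}^p$, a prime denotes transposition, and $\stackrel{\mathcal{D}}{\to}$ denotes convergence in distribution. For a function $f$, $\varphi_f:=f'/f$ wherever $f$ is differentiable. The class $\mathcal{F}$ is the collection of functions $f:\mathbb{R}\to\mathbb{R}^+$ that (i) are monotone non-decreasing on $(-\infty,0]$ and monotone increasing on $[0,\infty)$; (ii) are differentiable in a neighborhood of $\infty$ (i.e., over $(M,\infty)$ for some $M$); (iii) are such that $\kappa\varphi_f(\kappa)$ diverges to infinity as $\kappa\to\infty$ and $\kappa\mapsto\kappa\varphi_f(\kappa)$ is monotone non-decreasing over $(M,\infty)$ for some $M$; and (iv) satisfy, for any $\xi,\zeta>-1$, $$\int_{-1}^1(1-s)^\xi(1+s)^\zeta\,\big|e^{\log f(\kappa s)-\log f(\kappa)}-e^{(s-1)\kappa\varphi_f(\kappa)}\big|\,ds=o\bigg(\frac{1}{(\kappa\varphi_f(\kappa))^{\xi+1}}\bigg)\quad\text{as }\kappa\to\infty.$$ For $\boldsymbol\vartheta_n\in\mathcal{S}^{p-1}$, ${\rm P}^{(n)}_{\boldsymbol\vartheta_n,\kappa_n,f}$ is the hypothesis under which $\mathbf{X}_{n1},\ldots,\mathbf{X}_{nn}$ are mutually independent random vectors on $\mathcal{S}^{p-1}$ with common density, with respect to the surface area measure, $\mathbf{x}\mapsto\frac{c_{p,\kappa_n,f}\Gamma((p-1)/2)}{2\pi^{(p-1)/2}}f(\kappa_n\mathbf{x}'\boldsymbol\vartheta_n)$, where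 $c_{p,\kappa,f}:=1\big/\int_{-1}^1(1-s^2)^{(p-3)/2}f(\kappa s)\,ds$. Let $\bar{\mathbf{X}}_n:=\frac1n\sum_{i=1}^n\mathbf{X}_{ni}$ and $\hat{\boldsymbol\theta}_n:=\bar{\mathbf{X}}_n/\|\bar{\mathbf{X}}_n\|$ (well defined almost surely). The Watson and Wald test statistics (for $\mathcal{H}_0:\boldsymbol\theta=\boldsymbol\theta_0$) are $$W_n:=\frac{n(p-1)\bar{\mathbf{X}}_n'(\mathbf{I}_p-\boldsymbol\theta_0\boldsymbol\theta_0')\bar{\mathbf{X}}_n}{1-\frac1n\sum_{i=1}^n(\mathbf{X}_{ni}'\boldsymbol\theta_0)^2},\qquad S_n:=\frac{n(p-1)(\bar{\mathbf{X}}_n'\boldsymbol\theta_0)^2\,\hat{\boldsymbol\theta}_n'(\mathbf{I}_p-\boldsymbol\theta_0\boldsymbol\theta_0')\hat{\boldsymbol\theta}_n}{1-\frac1n\sum_{i=1}^n(\mathbf{X}_{ni}'\boldsymbol\theta_0)^2}.$$ The quantity $\nu_n$ is well defined for all $n$ large enough. *)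

(* Defs.v *)
From HB Require Import structures.
From mathcomp Require Import all_boot all_order all_algebra.
From mathcomp Require Import all_classical all_reals all_analysis.
From mathcomp Require Import measurable_realfun.

Set Implicit Arguments.
Unset Strict Implicit.
Unset Printing Implicit Defensive.

Import Order.TTheory GRing.Theory Num.Theory.
Import numFieldNormedType.Exports.

Local Open Scope classical_set_scope.
Local Open Scope ring_scope.

(* R^p is 'cV[R]_p with the sigma-algebra generated by the coordinates, which
   is the Borel one. *)
Section measurable_cV.
Context (R : realType) (n : nat).

Let coord (i : 'I_n) (x : 'cV[R]_n) : measurableTypeR R := x i 0.

Let cV_set0 : g_sigma_preimage coord set0.
Proof. exact: sigma_algebra0. Qed.

Let cV_setC A : g_sigma_preimage coord A -> g_sigma_preimage coord (~` A).
Proof. exact: sigma_algebraC. Qed.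

Let cV_bigcup (F : _^nat) : (forall i, g_sigma_preimage coord (F i)) ->
  g_sigma_preimage coord (\bigcup_i (F i)).
Proof. exact: sigma_algebra_bigcup. Qed.

HB.instance Definition _ := @isMeasurable.Build
  (measure_tuple_display (R.-ocitv.-measurable).-sigma)
  'cV[R]_n (g_sigma_preimage coord) cV_set0 cV_setC cV_bigcup.

End measurable_cV.

Section euclidean.
Context (R : realType) (n : nat).
Implicit Types x y : 'cV[R]_n.

Definition dot x y : R := (x^T *m y) 0 0.

(* the library's `|x| on matrices is the sup norm *)
Definition enorm x : R := Num.sqrt (dot x x).

Definition sphere : set 'cV[R]_n := [set x | enorm x = 1].

End euclidean.

Section measurability.
Context (R : realType).

Lemma measurable_coord n (i : 'I_n) :
  measurable_fun [set: 'cV[R]_n] (fun x : 'cV[R]_n => x i 0).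
Proof.
move=> _ Y mY; rewrite setTI; apply: sub_sigma_algebra => /=.
rewrite -bigcup_seq/=; exists i => /=; first by rewrite mem_index_enum.
by exists Y => //; rewrite setTI.
Qed.

Lemma measurable_cVP d (T : measurableType d) n (f : T -> 'cV[R]_n) :
  (forall i, measurable_fun [set: T] (fun t => f t i 0)) ->
  measurable_fun [set: T] f.
Proof.
move=> mf _ A mA; rewrite setTI.
pose G := [set B : set 'cV[R]_n | measurable (f @^-1` B)].
suff : G A by [].
apply: mA; split; last first.
  move=> B; rewrite -bigcup_seq => -[i _ [Y mY <-]].
  rewrite /G /= setTI; have := mf i measurableT Y mY.
  by rewrite setTI.
split=> [|B mB|F mF].
- by rewrite /G/= preimage_set0.
- by rewrite /G/= setTD preimage_setC; exact: measurableC.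
- by rewrite /G/= preimage_bigcup; apply: bigcup_measurable => k _; exact: mF.
Qed.

Lemma dotE n (x y : 'cV[R]_n) : dot x y = \sum_(i < n) x i 0 * y i 0.
Proof. by rewrite /dot !mxE; apply: eq_bigr => i _; rewrite mxE. Qed.

Lemma measurable_dotxx n :
  measurable_fun [set: 'cV[R]_n] (fun x : 'cV[R]_n => dot x x).
Proof.
under eq_fun do rewrite dotE.
apply: measurable_sum => i.
by apply: measurable_funM; exact: measurable_coord.
Qed.

Lemma measurable_enorm n : measurable_fun [set: 'cV[R]_n] (@enorm R n).
Proof.
apply: (measurableT_comp (f := @Num.sqrt R)); last exact: measurable_dotxx.
exact: continuous_measurable_fun (@sqrt_continuous R).
Qed.

Lemma measurable_normalize n :
  measurable_fun [set: 'cV[R]_n] (fun x : 'cV[R]_n => (enorm x)^-1 *: x).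
Proof.
apply: measurable_cVP => i; under eq_fun do rewrite mxE.
apply: measurable_funM; last exact: measurable_coord.
under eq_fun do rewrite -powR_inv1 ?sqrtr_ge0//.
by apply: (measurableT_comp (measurable_powR _)); exact: measurable_enorm.
Qed.

Lemma measurable_cons n : measurable_fun [set: R * 'cV[R]_n]
  (fun xv : R * 'cV[R]_n => col_mx xv.1%:M xv.2 : 'cV[R]_n.+1).
Proof.
apply: (@measurable_cVP _ _ n.+1) => i; rewrite -[n.+1]/(1 + n)%N in i *.
case: (splitP i) => j ij.
- rewrite (_ : (fun _ => _) = fst); first exact: measurable_fst.
  apply/funext => xv /=; rewrite (_ : i = lshift n j); last exact/val_inj.
  by rewrite col_mxEu ord1 !mxE eqxx mulr1n.
- rewrite (_ : (fun _ => _) = (fun v : 'cV[R]_n => v j 0) \o snd).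
    exact: measurableT_comp (measurable_coord j) measurable_snd.
  apply/funext => xv /=; rewrite (_ : i = rshift 1 j); last exact/val_inj.
  by rewrite col_mxEd.
Qed.

End measurability.


(* m 0 \x ... \x m n.-1 on R^n *)
Section product.
Context (R : realType).
Local Open Scope ereal_scope.

Definition stack n (xv : measurableTypeR R * 'cV[R]_n) : 'cV[R]_n.+1 :=
  col_mx xv.1%:M xv.2.

Fixpoint prod_measure n (m : nat -> set (measurableTypeR R) -> \bar R) :
    set 'cV[R]_n -> \bar R :=
  match n with
  | 0%N => \d_(0%R : 'cV[R]_0)
  | n'.+1 => pushforward (m 0%N \x^ @prod_measure n' (fun i => m i.+1))
               (@stack n')
  end.
Arguments prod_measure n m : simpl never, clear implicits.

Section instance.
Variables (n : nat)
  (m : nat -> {sigma_finite_measure set (measurableTypeR R) -> \bar R}).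

Let prod_measure_subproof : [/\ prod_measure n m set0 = 0,
  forall A, 0 <= prod_measure n m A & semi_sigma_additive (prod_measure n m)].
Proof.
elim: n m => [|k IH] mu; rewrite /prod_measure -/prod_measure; first by split => //; exact: measure_semi_sigma_additive.
have [H0 H1 H2] := IH (fun i => mu i.+1).
pose nu : {measure set 'cV[R]_k -> \bar R} :=
  HB.pack (prod_measure k (fun i => mu i.+1)) (isMeasure.Build _ _ _ _ H0 H1 H2).
have mh : measurable_fun setT (@stack k) by exact: measurable_cons.
rewrite -[prod_measure k _]/(nu : set _ -> \bar R).
split=> [|A|]; first exact: measure0.
- exact: measure_ge0.
- exact: measure_semi_sigma_additive.
Qed.

Let prod_measure0 : prod_measure n m set0 = 0.
Proof. by case: prod_measure_subproof. Qed.

Let prod_measure_ge0 A : 0 <= prod_measure n m A.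
Proof. by case: prod_measure_subproof => _ + _; exact. Qed.

Let prod_measure_sigma_additive : semi_sigma_additive (prod_measure n m).
Proof. by case: prod_measure_subproof. Qed.

HB.instance Definition _ := isMeasure.Build _ _ _ (prod_measure n m)
  prod_measure0 prod_measure_ge0 prod_measure_sigma_additive.

End instance.
End product.
Arguments prod_measure {R} n m : simpl never.

Lemma scale_pushforward_measure d d' (T : measurableType d)
    (T' : measurableType d') (R : realType) (m : {measure set T -> \bar R})
    (h : T -> T') (c : R) (mu : set T' -> \bar R) :
  measurable_fun setT h -> 0 <= c ->
  (forall A, mu A = c%:E * m (h @^-1` A))%E ->
  [/\ mu set0 = 0%E, forall A, (0 <= mu A)%E & semi_sigma_additive mu].
Proof.
move=> mh c0 muE.
pose rho : {measure set T' -> \bar R} := HB.pack (pushforward m h).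
have -> : mu = mscale (NngNum c0) (rho mh) by exact/funext.
split=> [|A|]; first exact: measure0.
- exact: measure_ge0.
- exact: measure_semi_sigma_additive.
Qed.

Section surface.
Context (R : realType) (p : nat).
Local Open Scope ereal_scope.

(* Surface area on the unit sphere, as the cone measure
     A |-> p * Leb_p {r u : 0 < r <= 1, u in A, |u| = 1};
   it is a measure on R^p carried by the sphere. *)
Definition surface_measure (A : set 'cV[R]_p) : \bar R :=
  p%:R%:E * prod_measure p (fun=> @lebesgue_measure R)
    [set x | (0 < enorm x <= 1)%R /\ A ((enorm x)^-1 *: x)%R].

Let surface_measure_subproof : [/\ surface_measure set0 = 0,
  forall A, 0 <= surface_measure A & semi_sigma_additive surface_measure].
Proof.
have mB : measurable [set x : 'cV[R]_p | (0 < enorm x <= 1)%R].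
  rewrite (_ : [set x | _] = [set: _] `&` @enorm R p @^-1` `]0%R, 1%R]).
    exact: measurable_enorm measurableT _ (measurable_itv _).
  by apply/seteqP; split=> x; rewrite /= in_itv/=; [split|case].
apply: (@scale_pushforward_measure _ _ _ _ _
  (mrestr (prod_measure p (fun=> @lebesgue_measure R)) mB)
  (fun x => ((enorm x)^-1 *: x)%R) p%:R) => // [|A].
  exact: measurable_normalize.
by congr (_ * prod_measure _ _ _); apply/seteqP; split=> x /= [].
Qed.

Let surface_measure0 : surface_measure set0 = 0.
Proof. by case: surface_measure_subproof. Qed.

Let surface_measure_ge0 A : 0 <= surface_measure A.
Proof. by case: surface_measure_subproof => _ + _; exact. Qed.

Let surface_measure_sigma_additive : semi_sigma_additive surface_measure.
Proof. by case: surface_measure_subproof. Qed.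

HB.instance Definition _ := isMeasure.Build _ _ _ surface_measure
  surface_measure0 surface_measure_ge0 surface_measure_sigma_additive.

End surface.

Section chi_square.
Context (R : realType) (k : nat) (c : R).
Local Open Scope ereal_scope.

(* Law of |Z|^2 for Z ~ N(mu, I_k), where mu := (sqrt c, 0, ..., 0) so that
   |mu|^2 = c; meant for k > 0 and c >= 0. *)
Definition noncentral_chisq : set (measurableTypeR R) -> \bar R :=
  pushforward
    (prod_measure k
      (fun i => normal_prob (if i == 0%N then Num.sqrt c else 0%R) 1%R))
    (fun z : 'cV[R]_k => dot z z).

Let noncentral_chisq_subproof : [/\ noncentral_chisq set0 = 0,
  forall A, 0 <= noncentral_chisq A & semi_sigma_additive noncentral_chisq].
Proof.
apply: (@scale_pushforward_measure _ _ _ _ _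
  (prod_measure k
    (fun i => normal_prob (if i == 0%N then Num.sqrt c else 0%R) 1%R))
  (fun z : 'cV[R]_k => dot z z) 1) => // [|A].
  exact: measurable_dotxx.
by rewrite mul1e.
Qed.

Let noncentral_chisq0 : noncentral_chisq set0 = 0.
Proof. by case: noncentral_chisq_subproof. Qed.

Let noncentral_chisq_ge0 A : 0 <= noncentral_chisq A.
Proof. by case: noncentral_chisq_subproof => _ + _; exact. Qed.

Let noncentral_chisq_sigma_additive : semi_sigma_additive noncentral_chisq.
Proof. by case: noncentral_chisq_subproof. Qed.

HB.instance Definition _ := isMeasure.Build _ _ _ noncentral_chisq
  noncentral_chisq0 noncentral_chisq_ge0 noncentral_chisq_sigma_additive.

End chi_square.

Notation chisq R k := (@noncentral_chisq R k 0).

Section angular_functions.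
Context (R : realType).
Implicit Types f : R -> R.

Definition varphi f (x : R) : R := derive1 f x / f x.

(* exp(log f(kappa s) - log f(kappa)) is computed in \bar R, because f may
   vanish, where log f = -oo, whereas ln 0 = 0 *)
Definition approx_error f (xi zeta kappa : R) : \bar R :=
  (\int[lebesgue_measure]_(s in `[(-1)%R, 1%R])
    (((1 - s) `^ xi * (1 + s) `^ zeta)%:E *
     `| expeR (lne (f (kappa * s))%:E - lne (f kappa)%:E)
        - (expR ((s - 1) * (kappa * varphi f kappa)))%:E |))%E.

Definition nu_ f (kappa : nat -> R) (n : nat) : R :=
  1 / Num.sqrt (n%:R * (kappa n * varphi f (kappa n))).

Record classF f : Prop := {
  classF_ge0 : forall x, 0 <= f x ;
  classF_nondecreasing : {in `]-oo, 0] &, {homo f : x y / x <= y}} ;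
  classF_increasing : {in `[0, +oo[ &, {homo f : x y / x < y}} ;
  classF_derivable : exists M, forall x, M < x -> derivable f x 1 ;
  classF_diverges : kappa * varphi f kappa @[kappa --> +oo] --> +oo ;
  classF_monotone : exists M,
    {in `]M, +oo[ &, {homo (fun kappa => kappa * varphi f kappa) :
                       x y / x <= y}} ;
  classF_approx : forall xi zeta, -1 < xi -> -1 < zeta ->
    forall eps, 0 < eps -> \forall kappa \near +oo,
      (approx_error f xi zeta kappa <=
       (eps * (1 / (kappa * varphi f kappa) `^ (xi + 1)))%:E)%E
}.

End angular_functions.

Section model.
Context (R : realType) (p : nat).
Implicit Types (theta : 'cV[R]_p) (f : R -> R).

Definition Gamma (a : R) : R :=
  \int[lebesgue_measure]_(t in `]0, +oo[) (t `^ (a - 1) * expR (- t)).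

Definition cst_c (kappa : R) f : R :=
  1 / \int[lebesgue_measure]_(s in `[-1, 1])
        ((1 - s ^+ 2) `^ ((p%:R - 3) / 2) * f (kappa * s)).

Definition density theta (kappa : R) f (x : 'cV[R]_p) : R :=
  cst_c kappa f * Gamma ((p%:R - 1) / 2) / (2 * pi `^ ((p%:R - 1) / 2))
  * f (kappa * dot x theta).

Context d (Omega : measurableType d) (P : probability Omega R) (n : nat).
Implicit Type X : 'I_n -> {RV P >-> 'cV[R]_p}.

Definition mutually_independent X : Prop :=
  forall A : 'I_n -> set 'cV[R]_p, (forall i, measurable (A i)) ->
  (P (\bigcap_(i in [set: 'I_n]) X i @^-1` A i) =
   \prod_(i < n) P (X i @^-1` A i))%E.

(* the hypothesis P^(n)_{theta, kappa, f} on the sample X *)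
Definition model X theta (kappa : R) f : Prop :=
  mutually_independent X /\
  forall i A, measurable A ->
  (distribution P (X i) A =
   \int[@surface_measure R p]_(x in A) (density theta kappa f x)%:E)%E.

End model.

Section statistics.
Context (R : realType) (p n : nat).
Implicit Types (x : 'I_n -> 'cV[R]_p).

Definition sample_mean x : 'cV[R]_p := n%:R^-1 *: \sum_(i < n) x i.

Definition theta_hat x : 'cV[R]_p := (enorm (sample_mean x))^-1 *: sample_mean x.

Definition quad (theta0 : 'cV[R]_p) (v : 'cV[R]_p) : R :=
  (v^T *m (1%:M - theta0 *m theta0^T) *m v) 0 0.

Definition watson (theta0 : 'cV[R]_p) x : R :=
  n%:R * (p%:R - 1) * quad theta0 (sample_mean x) /
  (1 - n%:R^-1 * \sum_(i < n) dot (x i) theta0 ^+ 2).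

Definition wald (theta0 : 'cV[R]_p) x : R :=
  n%:R * (p%:R - 1) * dot (sample_mean x) theta0 ^+ 2
    * quad theta0 (theta_hat x) /
  (1 - n%:R^-1 * \sum_(i < n) dot (x i) theta0 ^+ 2).

End statistics.

Section convergence.
Context (R : realType) (d : nat -> measure_display)
  (Omega : forall n, measurableType (d n))
  (P : forall n, probability (Omega n) R).
Implicit Types Y : forall n, Omega n -> R.

Definition oP1 Y : Prop := forall e, 0 < e ->
  P n [set w | e < `|Y n w| ] @[n --> \oo] --> 0%E.

Definition cvg_in_law Y (nu : {measure set (measurableTypeR R) -> \bar R}) : Prop :=
  forall g : R -> R, continuous g -> bounded_fun g ->
  ('E_(P n)[g \o Y n] @[n --> \oo] --> \int[nu]_x (g x)%:E)%E.

End convergence.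

(* Main.v *)
(* Let T be the projection onto the orthogonal complement of theta_n, put
   r := kappa_n phi_f(kappa_n), and consider
     S_n := T tau_n + sqrt(r / n) * sum_i T X_i,
   a sum of independent centered vectors started at T tau_n.  Since the law of one
   observation is invariant under the reflections fixing theta_n, the covariance of T X_i is
   E|T X_i|^2 / (p-1) times the projection T.  Condition (iv) replaces f by an exponential
   in the integrals of (1 - s^2)^j, whence r E|T X_i|^2 -> p-1 and r^2 E|T X_i|^4 = O(1).

   The function (u, x) |-> (1 + 2u)^(-(p-1)/2) exp(-k|x|^2 / (1 + 2u)) solves a heat equation,
   so replacing the summands of S_n one at a time by an increment of the time u costs only a
   third order error; hence E exp(-k|S_n|^2) converges to
   (1 + 2k)^(-(p-1)/2) exp(-k|tau|^2 / (1 + 2k)), the Laplace transform at k of the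
   noncentral chi-square law.  Convergence at the integers k suffices, because Bernstein
   polynomials in exp(-x) approximate the continuous functions of exp(-x).

   Finally W_n - |S_n|^2 and W_n - S_n^Wald are bounded by deterministic inequalities in
   terms of |S_n|^2, which is tight, and of the deviations of the sample averages of
   X_i . theta_n and r |T X_i|^2 from 1 and r E|T X_i|^2, which tend to 0 in mean.  Part (i)
   is part (ii) with tau_n = 0. *)

Require Import Defs.
From HB Require Import structures.
From mathcomp Require Import all_boot all_order all_algebra.
From mathcomp Require Import all_classical all_reals all_analysis.
From mathcomp Require Import measurable_realfun ring lra.

Set Implicit Arguments.
Unset Strict Implicit.
Unset Printing Implicit Defensive.

Import Order.TTheory GRing.Theory Num.Theory.
Import numFieldNormedType.Exports.

Local Open Scope classical_set_scope.
Local Open Scope ring_scope.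

(** * Integration on R^n *)

(** Two obstacles shape the development. First, the surface measure is a cone measure and the
    density carries Gamma factors; none of these constants is ever evaluated. Functions of
    [x . theta] integrate to an unknown constant times an integral against [(1 - s^2)^((p-3)/2)],
    and since the law has total mass 1 the constant cancels in ratios of angular moments. The same
    total mass yields the positivity of the constants and, with the finite area, the integrability
    of the weight. Second, the law of an observation varies with [n] through [kappa_n], so a limit
    theorem for one fixed law is not enough, and errors are kept explicit. Exponential moments are
    compared by integration by parts, and a lower bound [b_0 >= c r^-(a+1)] turns the [o] of
    condition (iv) into an error relative to [b_0]. The walk starts at [T tau_n] because
    [theta_0 = theta_n - nu_n tau_n]: seen from [theta_n], the null direction is displaced by
    [- nu_n tau_n]. As both are unit vectors, [tau_n . theta_n = nu_n |tau_n|^2 / 2], so that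
    [|T tau_n|] and [|tau_n|] have the same limit. *)

Section prod_measure_theory.
Context {R : realType}.
Implicit Types m : nat -> {sigma_finite_measure set (measurableTypeR R) -> \bar R}.
Local Open Scope ereal_scope.

Definition unstack n (x : 'cV[R]_n.+1) : measurableTypeR R * 'cV[R]_n :=
  (x ord0 0%R, \col_i x (lift ord0 i) 0%R).

Lemma stack_head n (xv : measurableTypeR R * 'cV[R]_n) : stack xv ord0 0%R = xv.1.
Proof.
transitivity ((stack xv : 'cV[R]_(1 + n)) (lshift n ord0) 0%R).
  by congr (stack xv _ _); exact/val_inj.
by rewrite /stack col_mxEu !mxE eqxx mulr1n.
Qed.

Lemma stack_tail n (xv : measurableTypeR R * 'cV[R]_n) i :
  stack xv (lift ord0 i) 0%R = xv.2 i 0%R.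
Proof.
transitivity ((stack xv : 'cV[R]_(1 + n)) (rshift 1 i) 0%R).
  by congr (stack xv _ _); exact/val_inj.
by rewrite /stack col_mxEd.
Qed.

Lemma stackK n : cancel (@stack R n) (@unstack n).
Proof.
move=> -[x v]; rewrite /unstack stack_head; congr pair.
by apply/colP => i; rewrite mxE stack_tail.
Qed.

Lemma unstackK n : cancel (@unstack n) (@stack R n).
Proof.
move=> x; apply/colP => i; have [j ->|->] := unliftP ord0 i.
- by rewrite stack_tail mxE.
- by rewrite stack_head.
Qed.

Lemma measurable_stack n : measurable_fun setT (@stack R n).
Proof. exact: Defs.measurable_cons. Qed.

Lemma measurable_unstack n : measurable_fun setT (@unstack n).
Proof.
apply/measurable_fun_pairP; split; first exact: measurable_coord.
apply: measurable_cVP => i /=.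
by under eq_fun do rewrite mxE; exact: measurable_coord.
Qed.

(** Tonelli needs the inner product to be sigma-finite. Both exhausting sequences are taken
    increasing, so that a single index, the maximum of the two, serves for their rectangles. *)
Lemma prod_measure_sigma_finite n m : sigma_finite setT (prod_measure n m).
Proof.
elim: n m => [|n IH] m.
  exists (fun=> setT); first by rewrite bigcup_const.
  by move=> i; split=> //; rewrite /prod_measure diracT ltry.
have /sigma_finiteP[F [TF ndF Foo]] := sigma_finiteT (m 0%N).
have /sigma_finiteP[G [TG ndG Goo]] := IH (fun i => m i.+1).
exists (fun i => @unstack n @^-1` (F i `*` G i)).
  rewrite -preimage_bigcup; apply/seteqP; split=> // x _.
  have [i _ Fi] : (\bigcup_i F i) (unstack x).1 by rewrite -TF.
  have [j _ Gj] : (\bigcup_i G i) (unstack x).2 by rewrite -TG.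
  exists (maxn i j) => //; split=> /=.
  - by move: Fi; exact/subsetPset/ndF/leq_maxl.
  - by move: Gj; exact/subsetPset/ndG/leq_maxr.
move=> i; have [mF Fi] := Foo i; have [mG Gi] := Goo i; split.
  rewrite -[_ @^-1` _]setTI; apply: measurable_unstack => //.
  exact: measurableX.
rewrite /prod_measure -/prod_measure /pushforward -comp_preimage.
rewrite (_ : _ \o _ = id); last by apply/funext => x /=; rewrite stackK.
rewrite preimage_id product_measure2E//.
by rewrite lte_mul_pinfty// ge0_fin_numE.
Qed.

HB.instance Definition _ n m := Measure_isSigmaFinite.Build _ _ _
  (prod_measure n m) (@prod_measure_sigma_finite n m).

Lemma ge0_integral_prod_measureS n m (f : 'cV[R]_n.+1 -> \bar R) :
  measurable_fun setT f -> (forall x, 0 <= f x) ->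
  \int[prod_measure n.+1 m]_x f x =
  \int[prod_measure n (fun i => m i.+1)]_y \int[m 0%N]_x f (stack (x, y)).
Proof.
move=> mf f0.
transitivity (\int[m 0%N \x^ prod_measure n (fun i => m i.+1)]_xv f (stack xv)).
  rewrite -(preimage_setT (@stack R n)) -ge0_integral_pushforward//.
  exact: measurable_stack.
(* [prod_measure] is built on [\x^], whereas Tonelli is used for [\x]; the two products agree on
   rectangles, hence everywhere. *)
rewrite -[RHS](@fubini_tonelli2 _ _ _ _ _ _ _ (fun xv => f (stack xv)))//.
  apply: eq_measure_integral => A mA _; apply/esym.
  by apply: product_measure_unique => // B C mB mC; exact: product_measure2E.
by apply: measurableT_comp => //; exact: measurable_stack.
Qed.

Lemma measurable_integral_stack n m (f : 'cV[R]_n.+1 -> \bar R) :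
  measurable_fun setT f -> (forall x, 0 <= f x) ->
  measurable_fun setT (fun y => \int[m 0%N]_x f (stack (x, y))).
Proof.
move=> mf f0; apply: (@measurable_fun_fubini_tonelli_G _ _ _ _ _ (m 0%N)
  (fun xv => f (stack xv))) => //.
by apply: measurableT_comp => //; exact: measurable_stack.
Qed.

Lemma ge0_integral_prod_measure0 m (f : 'cV[R]_0 -> \bar R) :
  (forall x, 0 <= f x) -> measurable_fun setT f ->
  \int[prod_measure 0 m]_x f x = f 0%R.
Proof.
by move=> f0 mf; rewrite integral_dirac// diracT mul1e.
Qed.

End prod_measure_theory.

Section lebesgue_affine.
Context {R : realType}.
Local Open Scope ereal_scope.
Local Notation mu := (@lebesgue_measure R).

(** Lebesgue measure is determined by half-open intervals, and [a] times its image under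
    [x |-> a x + b] gives them the same length. *)
Lemma ge0_integral_lebesgue_affine (a b : R) (f : R -> \bar R) : (0 < a)%R ->
  measurable_fun setT f -> (forall x, 0 <= f x) ->
  \int[mu]_x f (a * x + b)%R = (a^-1)%:E * \int[mu]_x f x.
Proof.
move=> a0 mf f0; pose h (x : R) : measurableTypeR R := (a * x + b)%R.
have mh : measurable_fun setT h.
  by apply: measurable_funD => //; exact: measurable_funM.
pose rho : {measure set (measurableTypeR R) -> \bar R} := HB.pack (pushforward mu h).
pose nu : {measure set (measurableTypeR R) -> \bar R} :=
  mscale (NngNum (ltW a0)) (rho mh).
have nuE A : measurable A -> mu A = nu A.
  move=> mA; apply: lebesgue_measure_unique => // _ [[u v] _ <-].
  transitivity (a%:E * mu `]((u - b) / a)%R, ((v - b) / a)%R]%classic); last first.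
    congr (_ * mu _).
    apply/seteqP; split=> x; rewrite /= /h !in_itv/= ltr_pdivrMr// ler_pdivlMr//
      ltrBlDr lerBrDr [(x * a)%R]mulrC//.
  rewrite !lebesgue_measure_itv/= !lte_fin ltr_pM2r ?invr_gt0// ltrD2r.
  case: ifPn => _; last by rewrite mule0.
  rewrite -!EFinB -EFinM; congr EFin.
  by field; exact: lt0r_neq0.
transitivity (\int[pushforward mu h]_x f x).
  rewrite -[in LHS](preimage_setT h) ge0_integral_pushforward//.
rewrite [in RHS](eq_measure_integral nu); last by move=> A mA _; exact: nuE.
rewrite ge0_integral_mscale//= muleA -EFinM mulVf ?mul1e//; exact: lt0r_neq0.
Qed.

Local Notation leb n := (prod_measure n (fun=> mu)).

Lemma measurable_scale_add n (a : R) (c : 'cV[R]_n) :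
  measurable_fun setT (fun x : 'cV[R]_n => a *: x + c)%R.
Proof.
apply: measurable_cVP => i; under eq_fun do rewrite !mxE.
apply: measurable_funD => //; apply: measurable_funM => //.
exact: measurable_coord.
Qed.

Lemma measurable_stackl n (y : 'cV[R]_n) :
  measurable_fun setT (fun x : measurableTypeR R => stack (x, y)).
Proof.
exact: (measurableT_comp (@measurable_stack R n) (measurable_fun_pair _ _)).
Qed.

Lemma stack_affine n a b x (c y : 'cV[R]_n) :
  (a *: stack (x, y) + stack (b, c) = stack (a * x + b, a *: y + c))%R.
Proof.
apply/colP => i; rewrite mxE [in LHS]mxE.
by have [j ->|->] := unliftP ord0 i; rewrite ?stack_tail ?stack_head//= !mxE.
Qed.

Lemma ge0_integral_leb_affine n (a : R) (c : 'cV[R]_n) (f : 'cV[R]_n -> \bar R) :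
  (0 < a)%R -> measurable_fun setT f -> (forall x, 0 <= f x) ->
  \int[leb n]_x f (a *: x + c)%R = (a ^- n)%:E * \int[leb n]_x f x.
Proof.
move=> a0; elim: n c f => [|n IH] c f mf f0.
  rewrite expr0 invr1 mul1e; congr integral; apply/funext => x.
  by congr f; apply/colP => -[].
have mfc b : measurable_fun setT (fun x : 'cV[R]_n.+1 => f (a *: x + b)%R).
  by apply: measurableT_comp => //; exact: measurable_scale_add.
rewrite !ge0_integral_prod_measureS//.
pose g y := \int[mu]_x f (stack (x, y)).
have mg : measurable_fun setT g by exact: (measurable_integral_stack (fun=> mu)).
have g0 y : 0 <= g y by exact: integral_ge0.
have mfs y : measurable_fun setT (fun x : measurableTypeR R => f (stack (x, y))).
  by apply: measurableT_comp => //; exact: measurable_stackl.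
transitivity (\int[leb n]_y ((a^-1)%:E * g (a *: y + (unstack c).2)%R)).
  apply: eq_integral => y _; rewrite -(ge0_integral_lebesgue_affine (unstack c).1)//.
    apply: eq_integral => x _.
    by rewrite -[in LHS](unstackK c) [unstack c]surjective_pairing stack_affine.
  exact: mfs.
rewrite ge0_integralZl; first last.
- by rewrite lee_fin invr_ge0 ltW.
- by move=> y _; exact: g0.
- exact: measurableT_comp mg (measurable_scale_add _ _).
- exact: measurableT.
by rewrite IH// muleA -EFinM exprS invfM.
Qed.

Lemma ge0_integral_leb_shift n (c : 'cV[R]_n) (f : 'cV[R]_n -> \bar R) :
  measurable_fun setT f -> (forall x, 0 <= f x) ->
  \int[leb n]_x f (x + c)%R = \int[leb n]_x f x.
Proof.
move=> mf f0; rewrite -[RHS]mul1e -invr1 -(expr1n _ n).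
rewrite -(ge0_integral_leb_affine c)//.
by apply: eq_integral => x _; rewrite scale1r.
Qed.

Lemma dotC n (x y : 'cV[R]_n) : dot x y = dot y x.
Proof. by rewrite !dotE; apply: eq_bigr => i _; rewrite mulrC. Qed.

Lemma dotDl n (x y z : 'cV[R]_n) : dot (x + y)%R z = (dot x z + dot y z)%R.
Proof. by rewrite /dot linearD mulmxDl mxE. Qed.

Lemma dotZl n a (x z : 'cV[R]_n) : dot (a *: x)%R z = (a * dot x z)%R.
Proof. by rewrite /dot linearZ -scalemxAl mxE. Qed.

Lemma dotNN n (x : 'cV[R]_n) : dot (- x)%R (- x)%R = dot x x.
Proof. by rewrite !dotE; apply: eq_bigr => i _; rewrite mxE mulrNN. Qed.

Lemma dot_stack n x (y : 'cV[R]_n) x' y' :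
  dot (stack (x, y)) (stack (x', y')) = (x * x' + dot y y')%R.
Proof.
rewrite !dotE big_ord_recl !stack_head; congr (_ + _)%R.
by apply: eq_bigr => i _; rewrite !stack_tail.
Qed.

Lemma dotxx_ge0 n (x : 'cV[R]_n) : (0 <= dot x x)%R.
Proof. by rewrite dotE sumr_ge0// => i _; rewrite -expr2 sqr_ge0. Qed.

Lemma measurable_expN_dotxx n :
  measurable_fun setT (fun x : 'cV[R]_n => (expR (- dot x x))%:E).
Proof.
apply/measurable_EFinP; apply: measurableT_comp => //.
by apply: measurableT_comp => //; exact: measurable_dotxx.
Qed.

(** A positive function of known finite mass. It is the factor cancelled in the uniqueness argument
    for Haar measure below, and a multiple of it dominates indicators of bounded sets, which gives
    the finiteness of their measure. *)
Lemma integral_expN_dotxx n :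
  \int[leb n]_x (expR (- dot x x))%:E = (Num.sqrt pi ^+ n)%:E.
Proof.
elim: n => [|n IH].
  rewrite ge0_integral_prod_measure0//; last exact: measurable_expN_dotxx.
  by rewrite dotE big_ord0 oppr0 expR0 expr0.
rewrite ge0_integral_prod_measureS//; last exact: measurable_expN_dotxx.
transitivity (\int[leb n]_y ((Num.sqrt pi)%:E * (expR (- dot y y))%:E)).
  apply: eq_integral => y _; rewrite -integralT_gauss -ge0_integralZr//.
  - by apply: eq_integral => x _; rewrite dot_stack -EFinM -expRD opprD expr2.
  - by apply/measurable_EFinP; exact: measurable_gauss_fun.
  - by move=> x _; rewrite lee_fin gauss_fun_ge0.
rewrite ge0_integralZl//; first by rewrite IH -EFinM exprS.
exact: measurable_expN_dotxx.
Qed.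

(* Uniqueness of Haar measure: with g := exp(-|.|^2), translation invariance and
   Tonelli give (int g) (int f o T) = (int f) (int g (- T .)), and g o (- T) = g. *)
Lemma ge0_integral_leb_isometry n (T : 'cV[R]_n -> 'cV[R]_n) (f : 'cV[R]_n -> \bar R) :
  measurable_fun setT T -> {morph T : x y / (x + y)%R} -> involutive T ->
  (forall x, dot (T x) (T x) = dot x x) ->
  measurable_fun setT f -> (forall x, 0 <= f x) ->
  \int[leb n]_x f (T x) = \int[leb n]_x f x.
Proof.
move=> mT TD TK TT mf f0.
pose g (x : 'cV[R]_n) := (expR (- dot x x))%:E.
have g0 x : 0 <= g x by rewrite lee_fin expR_ge0.
have mg : measurable_fun setT g by exact: measurable_expN_dotxx.
have mD : measurable_fun setT (fun xy : 'cV[R]_n * 'cV[R]_n => (xy.1 + T xy.2)%R).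
  apply: measurable_cVP => i; under eq_fun do rewrite mxE.
  apply: measurable_funD.
    exact: measurableT_comp (measurable_coord i) _.
  by apply: measurableT_comp (measurable_coord i) _; exact: measurableT_comp.
have mB : measurable_fun setT (fun xy : 'cV[R]_n * 'cV[R]_n => (xy.1 - T xy.2)%R).
  apply: measurable_cVP => i; under eq_fun do rewrite !mxE.
  apply: measurable_funB.
    exact: measurableT_comp (measurable_coord i) _.
  by apply: measurableT_comp (measurable_coord i) _; exact: measurableT_comp.
have T0 : T 0%R = 0%R.
  by apply: (addrI (T 0%R)); rewrite -TD !addr0.
have TN x : T (- x)%R = (- T x)%R.
  by apply: (addrI (T x)); rewrite -TD !subrr.
have mfT : measurable_fun setT (f \o T) by exact: measurableT_comp.
have key : \int[leb n]_x g x * \int[leb n]_x f (T x) =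
           \int[leb n]_x g x * \int[leb n]_x f x.
  transitivity (\int[leb n]_x \int[leb n]_y (g x * f (x + T y)%R)).
    rewrite -ge0_integralZr//; last by apply: integral_ge0.
    apply: eq_integral => x _; rewrite -ge0_integralZl//.
    rewrite -[LHS](ge0_integral_leb_shift (T x)); last 2 first.
    - exact: measurable_funeM.
    - by move=> y; rewrite mule_ge0.
    by apply: eq_integral => y _; rewrite TD TK addrC.
  have mgf : measurable_fun setT (fun xy : 'cV[R]_n * 'cV[R]_n =>
      g xy.1 * f (xy.1 + T xy.2)%R).
    apply: emeasurable_funM; first exact: measurableT_comp.
    exact: measurableT_comp.
  rewrite (@fubini_tonelli _ _ _ _ _ _ _ (fun xy => g xy.1 * f (xy.1 + T xy.2)%R))//;
    last by move=> x; rewrite mule_ge0.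
  transitivity (\int[leb n]_y \int[leb n]_x (g (x - T y)%R * f x)).
    apply: eq_integral => y _.
    rewrite -[RHS](ge0_integral_leb_shift (T y)); last 2 first.
    - apply: emeasurable_funM => //; apply: measurableT_comp => //.
      exact: measurableT_comp mB (measurable_fun_pair _ _).
    - by move=> x; rewrite mule_ge0.
    by apply: eq_integral => x _; rewrite addrK.
  rewrite -(@fubini_tonelli _ _ _ _ _ _ _ (fun xy : 'cV[R]_n * 'cV[R]_n => g (xy.1 - T xy.2)%R * f xy.1))//;
    last 2 first.
  - by apply: emeasurable_funM; exact: measurableT_comp.
  - by move=> x; rewrite mule_ge0.
  rewrite -ge0_integralZl//; last by apply: integral_ge0.
  have mgT x : measurable_fun setT (fun y => g (x - T y)%R).
    apply: measurableT_comp => //.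
    exact: measurableT_comp mB (measurable_fun_pair _ _).
  apply: eq_integral => x _.
  transitivity ((\int[leb n]_y g (x - T y)%R) * f x).
    by rewrite -ge0_integralZr.
  congr (_ * _); rewrite -[LHS](ge0_integral_leb_shift (T x) (mgT x)); last first.
    by move=> y; exact: g0.
  apply: eq_integral => y _.
  by rewrite TD TK opprD addrCA subrr addr0 -TN /g TT dotNN.
move: key; rewrite /g integral_expN_dotxx => /(congr1 (fun z => ((Num.sqrt pi ^- n)%:E * z))).
rewrite !muleA -!EFinM mulVf ?mul1e// expf_eq0; apply/negP => /andP[_].
by rewrite sqrtr_eq0 leNgt pi_gt0.
Qed.

End lebesgue_affine.

(** * The surface measure of the sphere *)

(** The inverse is total, with value 0 at 0, and jumps there; it is therefore assembled from the
    powers of [x] and [- x] on the two half-lines. *)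
Lemma measurable_invr (R : realType) : measurable_fun setT (@GRing.inv R).
Proof.
rewrite (_ : @GRing.inv R = fun x => if 0 <= x then x `^ (-1) else - (- x) `^ (-1)).
  apply: measurable_fun_ifT => /=.
  - exact: measurable_fun_ler.
  - exact: measurable_powR.
  - apply: measurableT_comp => //.
    exact: measurableT_comp (measurable_powR _) _.
apply/funext => x; case: ifPn => [x0|]; first by rewrite powR_inv1.
by rewrite -ltNge => /ltW x0; rewrite powR_inv1 ?oppr_ge0// invrN opprK.
Qed.

(** * Integrals against the image of a measure with density *)

Section integral_density_map.
Context d d' (X : measurableType d) (Y : measurableType d') (R : realType).
Variables (mu : {measure set X -> \bar R}) (nu : {measure set Y -> \bar R}).
Variables (phi : X -> Y) (w : X -> R).
Local Open Scope ereal_scope.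
Hypotheses (mphi : measurable_fun setT phi) (mw : measurable_fun setT w).
Hypothesis w0 : forall x, (0 <= w x)%R.
Hypothesis nuE : forall A, measurable A ->
  nu A = \int[mu]_x (w x * \1_A (phi x))%:E.

Import HBNNSimple.

Let integral_density_map_nnsfun (g : {nnsfun Y >-> R}) :
  \int[nu]_y (g y)%:E = \int[mu]_x (w x * g (phi x))%:E.
Proof.
have mg r : measurable (g @^-1` [set r]) by [].
have mwg r : measurable_fun setT
    (fun x => r%:E * (w x * \1_(g @^-1` [set r]) (phi x))%:E).
  apply: measurable_funeM; apply/measurable_EFinP/measurable_funM => //.
  by apply: measurableT_comp mphi => //; exact: measurable_indic.
have wg0 r x : 0 <= (w x * \1_(g @^-1` [set r]) (phi x))%:E.
  by rewrite lee_fin mulr_ge0.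
rewrite integralT_nnsfun sintegralE.
transitivity (\sum_(r \in range g)
    \int[mu]_x (r%:E * (w x * \1_(g @^-1` [set r]) (phi x))%:E)).
  apply: eq_fsbigr => r /[!inE] -[y _ gy].
  rewrite nuE// ge0_integralZl//.
  - apply/measurable_EFinP/measurable_funM => //.
    by apply: measurableT_comp mphi => //; exact: measurable_indic.
  - by rewrite lee_fin -gy.
have rg0 r x : 0 <= r%:E * (w x * \1_(g @^-1` [set r]) (phi x))%:E.
  by rewrite -EFinM lee_fin mulrCA mulr_ge0// -lee_fin nnfun_muleindic_ge0.
rewrite -ge0_integral_fsum//.
apply: eq_integral => x _.
under eq_fsbigr do rewrite -EFinM mulrCA EFinM.
rewrite -ge0_mule_fsumr; last by move=> r; rewrite nnfun_muleindic_ge0.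
by rewrite fsumEFin// -fimfunE -EFinM.
Qed.

(** Common source of the changes of variables below: the projection onto the sphere, the
    substitution of the cosine, restriction to a set, the density of an observation, the normal
    density. Simple functions reduce to the hypothesis on sets, and monotone convergence does the
    rest. *)
Lemma ge0_integral_density_map (h : Y -> \bar R) :
  measurable_fun setT h -> (forall y, 0 <= h y) ->
  \int[nu]_y h y = \int[mu]_x ((w x)%:E * h (phi x)).
Proof.
move=> mh h0; pose g_ := nnsfun_approx measurableT mh.
have mgp n : measurable_fun setT (fun x => (w x * g_ n (phi x))%:E).
  by apply/measurable_EFinP/measurable_funM => //; exact: measurableT_comp.
transitivity (limn (fun n => \int[nu]_x (g_ n x)%:E)).
  rewrite -monotone_convergence//=.
  - apply: eq_integral => x _; apply/esym/cvg_lim => //.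
    by apply: cvg_nnsfun_approx => // *; exact: h0.
  - by move=> n; exact/measurable_EFinP.
  - by move=> n x _; rewrite lee_fin.
  - by move=> x _ a b ab; rewrite lee_fin//; exact/lefP/nd_nnsfun_approx.
under eq_fun do rewrite integral_density_map_nnsfun.
rewrite -monotone_convergence//=.
- apply: eq_integral => x _; apply/cvg_lim => //.
  under eq_fun do rewrite EFinM.
  apply: cvgeZl => //.
  by apply: cvg_nnsfun_approx => // *; exact: h0.
- by move=> n x _; rewrite lee_fin mulr_ge0.
- move=> x _ a b ab; rewrite lee_fin ler_wpM2l//.
  exact/lefP/nd_nnsfun_approx.
Qed.

End integral_density_map.

(** * Reflections and their opposites *)

Section isometric_involution.
Context {R : realType} {n : nat}.
Implicit Types (T : 'cV[R]_n -> 'cV[R]_n) (x y u : 'cV[R]_n).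

Lemma dotDr x y z : dot x (y + z) = dot x y + dot x z.
Proof. by rewrite dotC dotDl !(dotC x). Qed.

Lemma dotZr a x y : dot x (a *: y) = a * dot x y.
Proof. by rewrite dotC dotZl dotC. Qed.

Lemma dotNr x y : dot x (- y) = - dot x y.
Proof. by rewrite -scaleN1r dotZr mulN1r. Qed.

Lemma dotNl x y : dot (- x) y = - dot x y.
Proof. by rewrite dotC dotNr dotC. Qed.

Lemma dot0r x : dot x 0 = 0.
Proof. by rewrite -(scale0r 0) dotZr mul0r. Qed.

Lemma dotxx_eq0 x : (dot x x == 0) = (x == 0).
Proof.
apply/eqP/eqP => [|->]; last by rewrite dot0r.
rewrite dotE => /eqP; rewrite psumr_eq0; last first.
  by move=> i _; rewrite -expr2 sqr_ge0.
move=> /allP x0; apply/colP => i; rewrite mxE.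
by have /(_ (mem_index_enum _)) := x0 i; rewrite mulf_eq0 orbb => /eqP.
Qed.

Lemma sqr_enorm x : enorm x ^+ 2 = dot x x.
Proof. by rewrite sqr_sqrtr// dotxx_ge0. Qed.

Lemma enorm_ge0 x : 0 <= enorm x. Proof. exact: sqrtr_ge0. Qed.

Lemma enorm_eq0 x : (enorm x == 0) = (x == 0).
Proof. by rewrite -dotxx_eq0 -sqr_enorm expf_eq0. Qed.

Lemma enorm_gt0 x : (0 < enorm x) = (x != 0).
Proof. by rewrite lt0r enorm_eq0 enorm_ge0 andbT. Qed.

Lemma enormZ a x : enorm (a *: x) = `|a| * enorm x.
Proof.
by rewrite /enorm dotZl dotZr mulrA -expr2 sqrtrM ?sqr_ge0// sqrtr_sqr.
Qed.

Lemma spherexx x : sphere x -> dot x x = 1.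
Proof. by rewrite /sphere/= => x1; rewrite -sqr_enorm x1 expr1n. Qed.

Lemma measurable_dotr u : measurable_fun setT (fun x => dot x u).
Proof.
under eq_fun do rewrite dotE.
apply: measurable_sum => i; apply: measurable_funM => //.
exact: measurable_coord.
Qed.

(** Every symmetry needed is a reflection or its opposite. Restricting to involutions makes the map
    its own inverse and adjoint, so the invariance of Lebesgue measure follows without orthogonal
    matrices or determinants. *)
Record isometric_involution T : Prop := {
  isoT_measurable : measurable_fun setT T;
  isoT_add : {morph T : x y / x + y};
  isoT_scale : forall a, {morph T : x / a *: x};
  isoT_inv : involutive T;
  isoT_dot : forall x y, dot (T x) (T y) = dot x y }.

(** The Householder reflection; at [u = 0] it degenerates to the identity, so that exchanging two
    equal vectors is no exception. *)
Definition reflection u x := x - (2 * dot x u / dot u u) *: u.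

Lemma isometric_involution_reflection u : isometric_involution (reflection u).
Proof.
have [->|u0] := eqVneq u 0.
  have -> : reflection 0 = id.
    by apply/funext => x; rewrite /reflection scaler0 subr0.
  by split.
have uu0 : dot u u != 0 by rewrite dotxx_eq0.
split=> [|x y|a x|x|x y].
- apply: measurable_cVP => i; rewrite /reflection.
  under eq_fun do rewrite !mxE.
  apply: measurable_funB; first exact: measurable_coord.
  apply: measurable_funM => //; apply: measurable_funM => //.
  by apply: measurable_funM => //; exact: measurable_dotr.
- rewrite /reflection dotDl mulrDr mulrDl scalerDl opprD.
  by rewrite !addrA; congr (_ + _); rewrite -!addrA; congr (_ + _); rewrite addrC.
- by rewrite /reflection dotZl scalerBr scalerA; congr (_ - _ *: _); ring.
- have xu : dot (reflection u x) u = - dot x u.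
    by rewrite /reflection dotDl dotNl dotZl; field.
  by rewrite {1}/reflection xu mulrN mulNr scaleNr opprK subrK.
- rewrite /reflection !(dotDl, dotDr, dotNl, dotNr, dotZl, dotZr) (dotC u y).
  by field.
Qed.

Lemma isometric_involutionN T :
  isometric_involution T -> isometric_involution (fun x => - T x).
Proof.
case=> mT TD TZ TK TT; split=> [|x y|a x|x|x y].
- apply: measurable_cVP => i; under eq_fun do rewrite mxE.
  by apply: measurableT_comp => //; exact: measurableT_comp (measurable_coord i) _.
- by rewrite TD opprD.
- by rewrite TZ scalerN.
- by rewrite -[in X in T X]scaleN1r TZ scaleN1r opprK TK.
- by rewrite dotNl dotNr opprK TT.
Qed.

Lemma enorm_isometry T x : isometric_involution T -> enorm (T x) = enorm x.
Proof. by move=> iT; rewrite /enorm isoT_dot. Qed.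

(** Vectors of equal length are mirror images in the hyperplane orthogonal to their difference.
    Reflections thus act transitively on each sphere and stand in for rotations. *)
Lemma reflection_swap x y :
  dot x x = dot y y -> reflection (x - y) x = y.
Proof.
move=> xy; have [->|xy0] := eqVneq x y.
  by rewrite /reflection subrr scaler0 subr0.
have uu0 : dot (x - y) (x - y) != 0 by rewrite dotxx_eq0 subr_eq0.
have xu : 2 * dot x (x - y) / dot (x - y) (x - y) = 1.
  apply: (mulIf uu0); rewrite mulfVK// mul1r.
  by rewrite !(dotDl, dotDr, dotNl, dotNr) (dotC y x) -xy; ring.
by rewrite /reflection xu scale1r opprB addrC subrK.
Qed.

Lemma reflection_orthogonal u x : dot x u = 0 -> reflection u x = x.
Proof. by move=> xu; rewrite /reflection xu mulr0 mul0r scale0r subr0. Qed.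

End isometric_involution.

Section surface_integral.
Context {R : realType} {n : nat}.
Local Open Scope ereal_scope.
Local Notation leb n := (prod_measure n (fun=> @lebesgue_measure R)).
Local Notation sigma := (@surface_measure R n).

Definition punctured_ball : set 'cV[R]_n := [set x | 0 < enorm x <= 1]%R.

Lemma measurable_punctured_ball : measurable punctured_ball.
Proof.
rewrite (_ : punctured_ball = setT `&` @enorm R n @^-1` `]0%R, 1%R]).
  exact: measurable_enorm measurableT _ (measurable_itv _).
by apply/seteqP; split=> x; rewrite /punctured_ball /= in_itv/=; [split|case].
Qed.

Lemma ge0_integral_surface (h : 'cV[R]_n -> \bar R) :
  measurable_fun setT h -> (forall x, 0 <= h x) ->
  \int[sigma]_x h x = \int[leb n]_x
    ((n%:R * \1_punctured_ball x)%:E * h ((enorm x)^-1 *: x)%R).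
Proof.
move=> mh h0.
have mI : measurable_fun setT (\1_punctured_ball : 'cV[R]_n -> R).
  by apply: measurable_indic; exact: measurable_punctured_ball.
apply: (@ge0_integral_density_map _ _ _ _ _ _ _
    (fun x => (enorm x)^-1 *: x)%R (fun x => n%:R * \1_punctured_ball x)%R) => //.
- exact: measurable_normalize.
- exact: measurable_funM.
move=> A mA; rewrite -[LHS]/(surface_measure A) /surface_measure.
have mphi : measurable ((fun x : 'cV[R]_n => (enorm x)^-1 *: x)%R @^-1` A).
  by rewrite -[_ @^-1` _]setTI; exact: measurable_normalize.
transitivity (\int[leb n]_x (n%:R%:E * (\1_(punctured_ball `&`
    ((fun x : 'cV[R]_n => (enorm x)^-1 *: x)%R @^-1` A)) x)%:E)).
  rewrite ge0_integralZl//; last first.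
    apply/measurable_EFinP/measurable_indic/measurableI => //.
    exact: measurable_punctured_ball.
  congr (_ * _); rewrite integral_indic ?setIT//.
  by apply: measurableI => //; exact: measurable_punctured_ball.
apply: eq_integral => x _; rewrite -EFinM; congr EFin.
by rewrite indicI /= -mulrA; congr (_ * (_ * _))%R; rewrite !indicE !mem_setE.
Qed.

Lemma ge0_integral_surface_isometry T (h : 'cV[R]_n -> \bar R) :
  isometric_involution T -> measurable_fun setT h -> (forall x, 0 <= h x) ->
  \int[sigma]_x h (T x) = \int[sigma]_x h x.
Proof.
move=> iT mh h0.
rewrite !ge0_integral_surface//; last first.
  exact: measurableT_comp (isoT_measurable iT).
rewrite -[RHS](ge0_integral_leb_isometry (T := T)); first last.
- by move=> x; rewrite mule_ge0// lee_fin mulr_ge0.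
- apply: emeasurable_funM.
    apply/measurable_EFinP; apply: measurable_funM => //; apply: measurable_indic.
    exact: measurable_punctured_ball.
  by apply: measurableT_comp => //; exact: measurable_normalize.
- by move=> x; rewrite (isoT_dot iT).
- exact: isoT_inv iT.
- exact: isoT_add iT.
- exact: isoT_measurable iT.
apply: eq_integral => x _.
have Tx : (T x \in punctured_ball) = (x \in punctured_ball).
  by apply/idP/idP; rewrite !inE /punctured_ball /= enorm_isometry.
by rewrite (isoT_scale iT) !indicE Tx enorm_isometry.
Qed.

Lemma surface_sphere : sigma (~` @sphere R n) = 0.
Proof.
rewrite /surface_measure (_ : [set x | _] = set0) ?measure0 ?mule0//.
apply/seteqP; split=> // x /= [/andP[x0 _]]; apply.
rewrite /sphere/= enormZ ger0_norm ?invr_ge0 ?enorm_ge0// mulVf//.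
by rewrite lt0r_neq0.
Qed.

Lemma measurable_sphere : measurable (@sphere R n).
Proof.
rewrite (_ : @sphere R n = setT `&` @enorm R n @^-1` [set 1%R]).
  exact: measurable_enorm.
by apply/seteqP; split=> x; rewrite /sphere/=; [split|case].
Qed.

End surface_integral.

(** * Integrals over the sphere of a function of one cosine *)

Section zonal_integral.
Context {R : realType}.
Local Open Scope ereal_scope.
Local Notation mu := (@lebesgue_measure R).
Local Notation leb n := (prod_measure n (fun=> mu)).

Definition unit_ball n : set 'cV[R]_n := [set y | enorm y <= 1]%R.

Lemma measurable_unit_ball n : measurable (@unit_ball n).
Proof.
rewrite (_ : @unit_ball n = setT `&` @enorm R n @^-1` `]-oo, 1%R]).
  by apply: measurable_enorm => //; exact: measurable_itv.
by apply/seteqP; split=> x; rewrite /unit_ball/= in_itv/=; [split|case].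
Qed.

Lemma measurable_origin n : measurable [set 0%R : 'cV[R]_n].
Proof.
rewrite (_ : [set 0%R] = setT `&` @enorm R n @^-1` [set 0%R]).
  exact: measurable_enorm.
apply/seteqP; split=> x /=.
  by move=> ->; split=> //; apply/eqP; rewrite enorm_eq0.
by case=> _ /eqP; rewrite enorm_eq0 => /eqP.
Qed.

(** Doubling fixes the origin, so its measure [m] satisfies [m = 2^-q m]; it is finite by comparison
    with [exp (- |x|^2)], hence zero. The condition [0 < q] matters, the measure on R^0 being a
    Dirac mass. *)
Lemma leb_singleton0 q : (0 < q)%N -> leb q [set 0%R] = 0.
Proof.
move=> q0.
have m0 := @measurable_origin q.
have mI : measurable_fun setT (fun x : 'cV[R]_q => (\1_[set 0%R] x : R)%:E).
  exact/measurable_EFinP/measurable_indic.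
have fin : leb q [set 0%R] \is a fin_num.
  rewrite ge0_fin_numE//; apply: (@le_lt_trans _ _ (Num.sqrt pi ^+ q)%:E);
    last exact: ltry.
  rewrite -integral_expN_dotxx -(setIT [set 0%R]) -integral_indic//.
  apply: ge0_le_integral => //.
  - exact: measurable_expN_dotxx.
  move=> x _; rewrite lee_fin indicE.
  have [x0|x0] := pselect ([set 0%R] x).
    by rewrite mem_set// x0 dot0r oppr0 expR0.
  by rewrite memNset// expR_ge0.
have := @ge0_integral_leb_affine _ q 2 0 (fun x : 'cV[R]_q => (\1_[set 0%R] x : R)%:E)
  (ltr0Sn _ _) mI (fun x => _).
move=> /(_ (fun x => ltac:(by rewrite lee_fin))).
have -> : (fun x : 'cV[R]_q => (\1_[set 0%R] (2 *: x + 0)%R : R)%:E) =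
          (fun x : 'cV[R]_q => (\1_[set 0%R] x : R)%:E).
  apply/funext => x.
  have Tx : ((2 *: x)%R \in [set 0%R]) = (x \in [set 0%R : 'cV[R]_q]).
    by apply/idP/idP; rewrite !inE /= => /eqP; rewrite ?scaler_eq0 ?pnatr_eq0/= =>
      /eqP x0; rewrite x0 ?scaler0.
  by rewrite !indicE addr0 Tx.
have -> : \int[leb q]_x (\1_[set 0%R] x : R)%:E = leb q [set 0%R].
  by rewrite integral_indic// setIT.
move: fin; case: (leb q [set 0%R]) => // r _; rewrite -EFinM => -[E]; congr EFin.
have : ((1 - 2 ^- q) * r = 0)%R by rewrite mulrBl mul1r -E subrr.
move=> /eqP; rewrite mulf_eq0 subr_eq0 => /orP[|/eqP//].
rewrite eq_sym lt_eqF// invf_lt1 ?exprn_gt0//.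
by rewrite exprn_egt1// ?ltr1n// -lt0n.
Qed.

Definition sqrt1D (v : R) : R := Num.sqrt (1 + v ^+ 2).

Lemma sqrt1D_ge1 v : (1 <= sqrt1D v)%R.
Proof. by rewrite -[leLHS]sqrtr1 ler_wsqrtr// lerDl sqr_ge0. Qed.

Lemma sqrt1D_gt0 v : (0 < sqrt1D v)%R.
Proof. exact: lt_le_trans (sqrt1D_ge1 v). Qed.

Lemma measurable_sqrt1D : measurable_fun setT sqrt1D.
Proof.
apply: (measurableT_comp (f := @Num.sqrt R)).
  exact: continuous_measurable_fun (@sqrt_continuous R).
by apply: measurable_funD => //; exact: measurable_funX.
Qed.

Definition cone_coord (v : R) : R := (v / sqrt1D v)%R.

Lemma measurable_cone_coord : measurable_fun setT cone_coord.
Proof.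
apply: measurable_funM => //.
exact: measurableT_comp (@measurable_invr R) measurable_sqrt1D.
Qed.

(** Multiplied by [q.+1] this is the area of the unit sphere of R^q. Only its positivity will
    matter. *)
Definition zonal_const q : \bar R :=
  \int[leb q]_y (enorm y * \1_(@unit_ball q) y)%R%:E.

Lemma zonal_const_ge0 q : 0 <= zonal_const q.
Proof.
by apply: integral_ge0 => y _; rewrite lee_fin mulr_ge0// enorm_ge0.
Qed.

Lemma enorm_stack q (x : measurableTypeR R) (y : 'cV[R]_q) :
  enorm (stack (x, y)) = Num.sqrt (x ^+ 2 + enorm y ^+ 2).
Proof. by rewrite /enorm dot_stack -expr2 sqr_sqrtr// dotxx_ge0. Qed.

Lemma punctured_ball_stack q (v : R) (y : 'cV[R]_q) : y != 0%R ->
  \1_punctured_ball (stack ((enorm y * v)%R : measurableTypeR R, y)) =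
  \1_(@unit_ball q) (sqrt1D v *: y)%R :> R.
Proof.
move=> y0; have y_gt0 : (0 < enorm y)%R by rewrite enorm_gt0.
have E : enorm (stack ((enorm y * v)%R : measurableTypeR R, y)) =
    (sqrt1D v * enorm y)%R.
  rewrite enorm_stack /sqrt1D exprMn -[X in (_ + X)%R]mulr1 -mulrDr addrC.
  by rewrite sqrtrM ?sqr_ge0// sqrtr_sqr ger0_norm ?enorm_ge0// mulrC.
have F : enorm (sqrt1D v *: y)%R = (sqrt1D v * enorm y)%R.
  by rewrite enormZ ger0_norm// ltW// sqrt1D_gt0.
have Tx : (stack ((enorm y * v)%R : measurableTypeR R, y) \in punctured_ball) =
    ((sqrt1D v *: y)%R \in @unit_ball q).
  apply/idP/idP; rewrite !inE /punctured_ball /unit_ball /= E F.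
    by case/andP.
  by move=> ->; rewrite mulr_gt0// sqrt1D_gt0.
by rewrite !indicE Tx.
Qed.

(* Writing x = (x_0, y) with x_0 = |y| v turns the cosine x_0 / |x| into
   v / sqrt (1 + v^2), and scaling in y separates the variables. *)
Lemma ge0_integral_surface_zonal q (theta : 'cV[R]_q.+1) (G : R -> \bar R) :
  (0 < q)%N -> sphere theta -> measurable_fun setT G -> (forall s, 0 <= G s) ->
  \int[@surface_measure R q.+1]_x G (dot x theta) =
  q.+1%:R%:E * zonal_const q *
    \int[mu]_v (G (cone_coord v) * (sqrt1D v ^- q.+1)%:E).
Proof.
move=> q0 theta1 mG G0.
pose e0 : 'cV[R]_q.+1 := stack (1%R : measurableTypeR R, 0%R).
have dote0 x y : dot (stack (x, y)) e0 = x.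
  by rewrite dot_stack dot0r addr0 mulr1.
have e01 : dot e0 e0 = 1%R by rewrite dote0.
(* The reflection exchanging [theta] with the first basis vector turns the cosine into the first
   coordinate of the normalized vector. *)
pose T := reflection (theta - e0).
have iT : isometric_involution T by exact: isometric_involution_reflection.
have Ttheta : T theta = e0 by apply: reflection_swap; rewrite spherexx.
have mGd u : measurable_fun setT (fun x : 'cV[R]_q.+1 => G (dot x u)).
  by apply: measurableT_comp => //; exact: measurable_dotr.
transitivity (\int[@surface_measure R q.+1]_x G (dot x e0)).
  rewrite -[RHS](ge0_integral_surface_isometry iT)//.
  by apply: eq_integral => x _; rewrite -Ttheta isoT_dot.
rewrite ge0_integral_surface//.
pose Phi (x : 'cV[R]_q.+1) := (q.+1%:R * \1_punctured_ball x)%:E *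
  G (dot ((enorm x)^-1 *: x)%R e0).
have Phi0 x : 0 <= Phi x by rewrite mule_ge0// lee_fin mulr_ge0.
have mPhi : measurable_fun setT Phi.
  apply: emeasurable_funM.
    apply/measurable_EFinP; apply: measurable_funM => //; apply: measurable_indic.
    exact: measurable_punctured_ball.
  by apply: measurableT_comp (mGd e0) _; exact: measurable_normalize.
rewrite -[LHS]/(\int[leb q.+1]_x Phi x) ge0_integral_prod_measureS//.
pose K (vy : measurableTypeR R * 'cV[R]_q) :=
  (q.+1%:R * (enorm vy.2 * \1_(@unit_ball q) (sqrt1D vy.1 *: vy.2)))%:E * G (cone_coord vy.1).
have K0 vy : 0 <= K vy.
  by rewrite mule_ge0// lee_fin mulr_ge0// mulr_ge0// enorm_ge0.
have mK : measurable_fun setT K.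
  apply: emeasurable_funM; last first.
    by apply: measurableT_comp => //; exact: measurableT_comp measurable_cone_coord _.
  apply/measurable_EFinP; apply: measurable_funM => //; apply: measurable_funM.
    exact: measurableT_comp (@measurable_enorm R q) _.
  have mI : measurable_fun setT (\1_(@unit_ball q) : 'cV[R]_q -> R).
    by apply: measurable_indic; exact: measurable_unit_ball.
  apply: (measurableT_comp mI).
  apply: measurable_cVP => i; under eq_fun do rewrite mxE.
  apply: measurable_funM; first exact: measurableT_comp measurable_sqrt1D _.
  exact: measurableT_comp (measurable_coord i) _.
(* For fixed [y != 0] the substitution [x_0 = |y| v] has Jacobian [|y|]; the exceptional point
   [y = 0] is negligible because [q > 0]. *)
transitivity (\int[leb q]_y \int[mu]_v K (v, y)).
  apply: ge0_ae_eq_integral => //.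
  - exact: (measurable_integral_stack (fun=> mu)).
  - exact: (@measurable_fun_fubini_tonelli_G _ _ _ _ _ mu K).
  - by move=> y _; exact: integral_ge0.
  - by move=> y _; exact: integral_ge0.
  exists [set 0%R]; split => //.
  - exact: measurable_origin.
  - exact: leb_singleton0.
  move=> y /=; apply: contra_notP => /eqP y0 _.
  have y_gt0 : (0 < enorm y)%R by rewrite enorm_gt0.
  have mPy : measurable_fun setT (fun x : measurableTypeR R => Phi (stack (x, y))).
    by apply: measurableT_comp => //; exact: measurable_stackl.
  have := ge0_integral_lebesgue_affine 0 y_gt0 mPy (fun x => Phi0 _).
  move=> /(congr1 (fun z => (enorm y)%:E * z)).
  rewrite muleA -EFinM divff ?lt0r_neq0// mul1e => <-.
  rewrite -ge0_integralZl//; last 2 first.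
  - apply: (measurableT_comp mPy) => //.
    by apply: measurable_funD => //; exact: measurable_funM.
  - by rewrite lee_fin ltW.
  apply: eq_integral => v _; rewrite addr0 /Phi /K /= punctured_ball_stack//.
  rewrite muleA -EFinM mulrCA; congr (_ * G _).
  rewrite dotZl dote0 enorm_stack exprMn -[X in (_ + X)%R]mulr1 -mulrDr.
  rewrite sqrtrM ?sqr_ge0// sqrtr_sqr ger0_norm ?enorm_ge0// /cone_coord /sqrt1D.
  rewrite (addrC (v ^+ 2)%R) invfM mulrC mulrA; congr (_ * _)%R.
  by rewrite mulrC mulrA mulVf ?mul1r// lt0r_neq0.
rewrite -(@fubini_tonelli _ _ _ _ _ mu (leb q) K)//.
rewrite -[RHS]ge0_integralZl//; first last.
- by rewrite mule_ge0// zonal_const_ge0.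
- by move=> v _; rewrite mule_ge0// lee_fin invr_ge0 exprn_ge0// ltW// sqrt1D_gt0.
- apply: emeasurable_funM; first exact: measurableT_comp measurable_cone_coord.
  apply/measurable_EFinP; apply: (measurableT_comp (@measurable_invr R)).
  by apply: measurable_funX; exact: measurable_sqrt1D.
apply: eq_integral => v _.
pose H (y : 'cV[R]_q) := (enorm y * \1_(@unit_ball q) y)%R%:E.
have mH : measurable_fun setT H.
  apply/measurable_EFinP; apply: measurable_funM; first exact: measurable_enorm.
  by apply: measurable_indic; exact: measurable_unit_ball.
have H0 y : 0 <= H y by rewrite lee_fin mulr_ge0// enorm_ge0.
have c0 := sqrt1D_gt0 v.
have mHc : measurable_fun setT (fun y : 'cV[R]_q => H (sqrt1D v *: y + 0)%R).
  by apply: measurableT_comp => //; exact: measurable_scale_add.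
(* Rescaling [y] by [sqrt1D v] has a Jacobian with [q] factors [(sqrt1D v)^-1]; the weight [|y|]
   supplies one more, whence the exponent [q.+1]. *)
transitivity (\int[leb q]_y
    ((q.+1%:R / sqrt1D v)%:E * G (cone_coord v) * H (sqrt1D v *: y + 0)%R)).
  apply: eq_integral => y _; rewrite /K /H /= muleAC -EFinM addr0.
  congr (_%:E * _); rewrite enormZ (ger0_norm (ltW c0)).
  by field; rewrite lt0r_neq0.
rewrite ge0_integralZl//; last first.
  by rewrite mule_ge0// lee_fin mulr_ge0// invr_ge0 ltW.
rewrite ge0_integral_leb_affine// -/(zonal_const q) exprS invfM !EFinM.
by rewrite -!muleA; congr (_ * _); rewrite [RHS]muleC -!muleA muleCA.
Qed.

End zonal_integral.

Lemma ge0_integral_mrestr d (T : measurableType d) (R : realType)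
    (mu : {measure set T -> \bar R}) (D : set T) (mD : measurable D)
    (f : T -> \bar R) : measurable_fun setT f -> (forall x, 0 <= f x)%E ->
  (\int[mrestr mu mD]_x f x = \int[mu]_(x in D) f x)%E.
Proof.
move=> mf f0; rewrite (@ge0_integral_density_map _ _ _ _ _ mu (mrestr mu mD) id
  (\1_D : T -> R))//.
- rewrite [RHS]integral_mkcond; apply: eq_integral => x _.
  by rewrite patchE indicE; case: ifPn => _; rewrite ?mul1e ?mul0e.
- move=> A mA; transitivity (\int[mu]_x (\1_(D `&` A) x)%:E)%E.
    by rewrite integral_indic ?setIT 1?setIC//; exact: measurableI.
  by apply: eq_integral => x _; rewrite indicI.
Qed.

(** * From the cotangent [v] to the cosine [s] *)

Section cone_substitution.
Context {R : realType}.
Local Notation mu := (@lebesgue_measure R).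

Lemma sqr_sqrt1D (v : R) : sqrt1D v ^+ 2 = 1 + v ^+ 2.
Proof. by rewrite sqr_sqrtr// addr_ge0// sqr_ge0. Qed.

Lemma is_derive_sqrt1D (v : R) : is_derive v 1 sqrt1D (v / sqrt1D v).
Proof.
have D0 : 0 < 1 + v ^+ 2 by rewrite ltr_pwDl// sqr_ge0.
have := @is_derive1_comp _ (@Num.sqrt R) (fun v => 1 + v ^+ 2) v _ _
  (is_derive1_sqrt D0) _.
move=> /(_ (2 * v)); have Dp : is_derive v 1 (fun v : R => 1 + v ^+ 2) (2 * v).
  have D := is_deriveD (is_derive_cst (1 : R) v 1) (is_deriveX 2 (is_derive_id v (1 : R))).
  by apply: (@is_derive_eq _ _ _ _ _ _ _ _ D); rewrite add0r /GRing.scale /= mulr1.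
move=> /(_ Dp) h; apply: is_derive_eq; rewrite -/(sqrt1D v).
by field; rewrite lt0r_neq0// sqrt1D_gt0.
Qed.

Lemma is_derive_cone_coord (v : R) :
  is_derive v 1 cone_coord (sqrt1D v ^- 3).
Proof.
have c0 : sqrt1D v != 0 by rewrite lt0r_neq0// sqrt1D_gt0.
have dV := @is_deriveV _ _ _ _ _ c0 (is_derive_sqrt1D v).
have dM := is_deriveM (is_derive_id v 1) dV.
apply: is_derive_eq; rewrite /GRing.scale /= mulr1.
have := sqr_sqrt1D v => c2; rewrite -[X in _ = X]mul1r.
have {1}-> : 1 = sqrt1D v ^+ 2 - v ^+ 2 :> R by rewrite c2 addrK.
by field.
Qed.

Lemma continuous_cone_density : continuous (fun v : R => sqrt1D v ^- 3).
Proof.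
move=> v; apply: cvgV; first by rewrite expf_neq0// lt0r_neq0// sqrt1D_gt0.
apply: (continuous_comp (f := sqrt1D) (g := fun x => x ^+ 3)); last first.
  exact: exprn_continuous.
have [d _] := is_derive_sqrt1D v.
exact/differentiable_continuous/derivable1_diffP.
Qed.

Lemma measurable_cone_density :
  measurable_fun [set: R] (fun v : R => sqrt1D v ^- 3).
Proof.
apply: (measurableT_comp (@measurable_invr R)).
by apply: measurable_funX; exact: measurable_sqrt1D.
Qed.

Lemma cone_coordK_sub (s : R) : -1 < s < 1 ->
  cone_coord (s / Num.sqrt (1 - s ^+ 2)) = s.
Proof.
move=> s1; have D0 : 0 < 1 - s ^+ 2 by nra.
have q0 : Num.sqrt (1 - s ^+ 2) != 0 by rewrite sqrtr_eq0 -ltNge.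
have q2 : Num.sqrt (1 - s ^+ 2) ^+ 2 = 1 - s ^+ 2 by rewrite sqr_sqrtr// ltW.
rewrite /cone_coord; have -> : sqrt1D (s / Num.sqrt (1 - s ^+ 2)) =
    (Num.sqrt (1 - s ^+ 2))^-1.
  rewrite /sqrt1D -[RHS]ger0_norm ?invr_ge0 ?sqrtr_ge0// -sqrtr_sqr; congr Num.sqrt.
  rewrite exprVn expr_div_n q2; field.
  exact: lt0r_neq0.
by rewrite invrK mulfVK.
Qed.

Lemma cone_coord_bound (v : R) : -1 < cone_coord v < 1.
Proof.
have c0 := sqrt1D_gt0 v; have c2 := sqr_sqrt1D v.
by rewrite /cone_coord ltr_pdivrMr// ltr_pdivlMr// mul1r mulN1r; apply/andP; split;
  nra.
Qed.

Lemma integral_cone_density (x y : R) : x < y ->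
  (\int[mu]_(v in `]x, y]) (sqrt1D v ^- 3)%:E = (cone_coord y - cone_coord x)%:E)%E.
Proof.
move=> xy; have cc : continuous (@cone_coord R).
  move=> v; have [d _] := is_derive_cone_coord v.
  exact/differentiable_continuous/derivable1_diffP.
rewrite integral_itv_obnd_cbnd; last first.
  by apply/measurable_EFinP/measurable_funTS; exact: measurable_cone_density.
rewrite EFinB; apply: (@continuous_FTC2 _ (fun v => sqrt1D v ^- 3) cone_coord) => //.
- exact/continuous_subspaceT/continuous_cone_density.
- split=> [v _||].
  + by have [] := is_derive_cone_coord v.
  + by apply: cvg_at_right_filter; exact: cc.
  + by apply: cvg_at_left_filter; exact: cc.
- by move=> v _; rewrite derive1E; have [_] := is_derive_cone_coord v.
Qed.

Lemma cone_coord_lt (x y : R) : (cone_coord x < cone_coord y) = (x < y).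
Proof.
suff homo (a b : R) : a < b -> cone_coord a < cone_coord b.
  have [xy|yx|->] := ltgtP x y; first exact: homo.
    by apply/negbTE; rewrite -leNgt ltW// homo.
  by rewrite ltxx.
move=> ab; have cc : {within `[a, b], continuous (@cone_coord R)}.
  apply: continuous_subspaceT => v; have [d _] := is_derive_cone_coord v.
  exact/differentiable_continuous/derivable1_diffP.
have [c _ E] := MVT ab (fun v _ => is_derive_cone_coord v) cc.
rewrite -subr_gt0 E mulr_gt0 ?subr_gt0// invr_gt0 exprn_gt0//.
exact: sqrt1D_gt0.
Qed.

Lemma cone_coord_le (x y : R) : (cone_coord x <= cone_coord y) = (x <= y).
Proof. by rewrite !leNgt cone_coord_lt. Qed.

Local Open Scope ereal_scope.

(** Uniqueness of Lebesgue measure speaks of measures on the whole line, so the image of the density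
    over []x, y]] is completed by Lebesgue measure outside the image interval [J]. The patched
    measure is right on half-open intervals by the fundamental theorem of calculus. *)
Lemma lebesgue_cone_coord (x y : R) (A : set (measurableTypeR R)) : (x < y)%R ->
  measurable A ->
  mu (A `&` `]cone_coord x, cone_coord y]) =
  \int[mu]_(v in cone_coord @^-1` A `&` `]x, y]) (sqrt1D v ^- 3)%:E.
Proof.
move=> xy mA; pose J := `]cone_coord x, cone_coord y]%classic : set (measurableTypeR R).
have mJ : measurable J by exact: measurable_itv.
have mcc : measurable_fun setT (cone_coord : R -> measurableTypeR R).
  exact: measurable_cone_coord.
pose g v : \bar R := ((sqrt1D v ^- 3 * \1_`]x, y] v)%R)%:E.
have mg : measurable_fun setT g.
  apply/measurable_EFinP/measurable_funM; last exact: measurable_indic.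
  exact: measurable_cone_density.
have g0 v : 0 <= g v.
  by rewrite lee_fin mulr_ge0// invr_ge0 exprn_ge0// ltW// sqrt1D_gt0.
pose dens (B : set (measurableTypeR R)) := \int[mu]_(v in B) g v.
have densE B : measurable B ->
    dens B = \int[mu]_(v in B `&` `]x, y]) (sqrt1D v ^- 3)%:E.
  move=> mB; rewrite /dens integral_mkcondr; apply: eq_integral => v _.
  by rewrite /g patchE indicE; case: ifPn => _; rewrite ?mulr1 ?mulr0.
have dens_sigma : semi_sigma_additive dens.
  exact: (@semi_sigma_additive_nng_induced _ (measurableTypeR R) _ mu g).
pose M : {measure set (measurableTypeR R) -> \bar R} :=
  HB.pack dens (isMeasure.Build _ _ _ dens (integral_set0 _ _)
    (fun B => @integral_ge0 _ _ _ _ B _ (fun v _ => g0 v))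
    dens_sigma).
pose rho : {measure set (measurableTypeR R) -> \bar R} :=
  HB.pack (pushforward M (cone_coord : R -> measurableTypeR R)).
pose nu : {measure set (measurableTypeR R) -> \bar R} :=
  measure_add (rho mcc) (mrestr mu (measurableC mJ)).
have nuD B : nu B = dens (cone_coord @^-1` B) + mu (B `\` J).
  by rewrite -[LHS]/(measure_add (rho mcc) (mrestr mu (measurableC mJ)) B) measure_addE.
have nuE B : measurable B -> mu B = nu B.
  move=> mB; apply: lebesgue_measure_unique => // _ [[a b] _ <-].
  have mX : measurable (`]a, b]%classic : set (measurableTypeR R)) by [].
  rewrite nuD (measureDI mu mX mJ) addeC; congr (_ + _).
  rewrite densE; last first.
    by rewrite -[_ @^-1` _]setTI; exact: (mcc measurableT).
  pose a' := Num.max a (cone_coord x); pose b' := Num.min b (cone_coord y).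
  have -> : `]a, b]%classic `&` J = `]a', b']%classic.
    apply/seteqP; split=> t; rewrite /J /= !in_itv/= gt_max le_min.
      by move=> [/andP[-> ->] /andP[-> ->]].
    by move=> /andP[/andP[-> ->] /andP[-> ->]].
  have -> : cone_coord @^-1` `]a, b]%classic `&` `]x, y]%classic =
      cone_coord @^-1` `]a', b']%classic.
    apply/seteqP; split=> t; rewrite /= !in_itv/= gt_max le_min cone_coord_lt cone_coord_le.
      by move=> [/andP[-> ->] /andP[-> ->]].
    by move=> /andP[/andP[-> ->] /andP[-> ->]].
  have [ab'|ba'] := ltP a' b'; last first.
    rewrite !set_itv_ge ?bnd_simp -?leNgt//.
    by rewrite preimage_set0 measure0 integral_set0.
  have [xb yb] := (cone_coord_bound x, cone_coord_bound y).
  have a1 : (-1 < a' < 1)%R.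
    apply/andP; split; first by rewrite lt_max (andP xb).1 orbT.
    by rewrite (lt_trans ab')// gt_min (andP yb).2 orbT.
  have b1 : (-1 < b' < 1)%R.
    apply/andP; split; last by rewrite gt_min (andP yb).2 orbT.
    by rewrite (lt_trans _ ab')// lt_max (andP xb).1 orbT.
  rewrite -(cone_coordK_sub a1) -(cone_coordK_sub b1).
  set u := (_ / _)%R; set w := (_ / _)%R.
  have uw : (u < w)%R.
    by rewrite -cone_coord_lt /u /w !cone_coordK_sub.
  rewrite (_ : cone_coord @^-1` _ = `]u, w]%classic); last first.
    by apply/seteqP; split=> t; rewrite /= !in_itv/= cone_coord_lt cone_coord_le.
  rewrite integral_cone_density// [LHS]lebesgue_measure_itv/= lte_fin.
  by rewrite cone_coord_lt uw EFinB.
rewrite nuE; last exact: measurableI.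
rewrite nuD setDE -setIA setICr setI0 measure0 adde0.
rewrite densE; last first.
  by rewrite -[_ @^-1` _]setTI; apply: (mcc measurableT); exact: measurableI.
congr (integral _ _ _); apply/seteqP; split=> t; rewrite /J /= !in_itv/=.
  by move=> [[]].
by move=> [At /andP[xt ty]]; rewrite cone_coord_lt cone_coord_le xt ty.
Qed.

Lemma ge0_integral_cone_coord (H : R -> \bar R) :
  measurable_fun setT H -> (forall s, 0 <= H s) ->
  \int[mu]_(s in `](-1)%R, 1%R[) H s =
  \int[mu]_v ((sqrt1D v ^- 3)%:E * H (cone_coord v)).
Proof.
move=> mH H0; pose I := `](-1)%R, 1%R[%classic : set (measurableTypeR R).
have mI : measurable I by exact: measurable_itv.
rewrite -[LHS](ge0_integral_mrestr mu mI)//.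
have mcc : measurable_fun setT (cone_coord : R -> measurableTypeR R).
  exact: measurable_cone_coord.
have md : measurable_fun setT (fun v : R => sqrt1D v ^- 3)%R.
  exact: measurable_cone_density.
have d0 (v : R) : (0 <= sqrt1D v ^- 3)%R.
  by rewrite invr_ge0 exprn_ge0// ltW// sqrt1D_gt0.
apply: ge0_integral_density_map => // A mA.
have mcA : measurable (cone_coord @^-1` A : set (measurableTypeR R)).
  by rewrite -[_ @^-1` _]setTI; exact: mcc.
(* The bounded substitution is passed to the limit along growing intervals; their images [J n] fill
   []-1, 1[], since [s / sqrt (1 - s^2)] inverts [cone_coord] there. *)
pose F n := `](- n.+1%:R)%R, n.+1%:R]%classic : set (measurableTypeR R).
pose J n := `]cone_coord (- n.+1%:R), cone_coord n.+1%:R]%classic : set (measurableTypeR R).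
have mF n : measurable (F n) by exact: measurable_itv.
have mJ n : measurable (J n) by exact: measurable_itv.
have mono m n : (m <= n)%N -> (- n.+1%:R <= - m.+1%:R :> R)%R /\ (m.+1%:R <= n.+1%:R :> R)%R.
  by move=> mn; rewrite lerN2 ler_nat ltnS.
have IE : A `&` I = \bigcup_n (A `&` J n).
  rewrite -setI_bigcupr; congr (_ `&` _); apply/seteqP; split=> s.
    rewrite /I /= in_itv/= => s1; pose w := (s / Num.sqrt (1 - s ^+ 2))%R.
    exists (Num.trunc `|w|) => //; rewrite /J /= in_itv/=.
    rewrite -(cone_coordK_sub s1) -/w cone_coord_lt cone_coord_le.
    have := truncnS_gt `|w|; rewrite ltr_norml => /andP[-> /ltW ->].
    by [].
  move=> [n _]; rewrite /J /I /= !in_itv/= => /andP[ns sn].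
  have /andP[n1 _] := cone_coord_bound (- n.+1%:R).
  have /andP[_ n2] := cone_coord_bound n.+1%:R.
  by rewrite (lt_trans n1 ns) (le_lt_trans sn n2).
have FE : cone_coord @^-1` A = \bigcup_n (cone_coord @^-1` A `&` F n).
  rewrite -setI_bigcupr (_ : \bigcup_n F n = setT) ?setIT//.
  apply/seteqP; split=> // v _; exists (Num.trunc `|v|) => //=.
  rewrite /F /= in_itv/=; have := truncnS_gt `|v|.
  by rewrite ltr_norml => /andP[-> /ltW ->].
rewrite -[LHS]/(mu (A `&` I)) IE.
have c1 : mu (A `&` J n) @[n --> \oo] --> mu (\bigcup_n (A `&` J n)).
  apply: nondecreasing_cvg_mu.
  - by move=> n; exact: measurableI.
  - by apply: bigcup_measurable => n _; exact: measurableI.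
  move=> m n /mono[mn1 mn2]; apply/subsetPset; apply: setIS => t; rewrite /J /= !in_itv/=.
  move=> /andP[tm tn]; rewrite (le_lt_trans _ tm) ?cone_coord_le//.
  by rewrite (le_trans tn)// cone_coord_le.
have c2 : \int[mu]_(v in cone_coord @^-1` A `&` F n) (sqrt1D v ^- 3)%:E @[n --> \oo] -->
    \int[mu]_(v in \bigcup_n (cone_coord @^-1` A `&` F n)) (sqrt1D v ^- 3)%:E.
  apply: ge0_nondecreasing_set_cvg_integral => //.
  - move=> m n /mono[mn1 mn2]; apply/subsetPset; apply: setIS => t; rewrite /F /= !in_itv/=.
    by move=> /andP[tm tn]; rewrite (le_lt_trans _ tm)// (le_trans tn).
  - by move=> n; exact: measurableI.
  - by move=> n; apply/measurable_EFinP; exact: measurable_funTS.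
  - by move=> n v _; rewrite lee_fin d0.
transitivity (\int[mu]_(v in cone_coord @^-1` A) (sqrt1D v ^- 3)%:E).
  rewrite FE -(cvg_lim _ c1)// -(cvg_lim _ c2)//; congr (limn _).
  apply/funext => n; apply: lebesgue_cone_coord => //.
  by rewrite (@lt_trans _ _ 0%R)// oppr_lt0.
rewrite [LHS]integral_mkcond; apply: eq_integral => v _.
have Av : (v \in cone_coord @^-1` A) = (cone_coord v \in A).
  by apply/idP/idP; rewrite !inE.
by rewrite patchE indicE Av; case: ifPn => _; rewrite ?mulr1 ?mulr0.
Qed.

(** With [s = cone_coord v] one has [1 - s^2 = sqrt1D v ^- 2] and [ds = sqrt1D v ^- 3 dv], so the
    exponent [q.+1] splits as [3 + 2 * ((q.+1 - 3) / 2)]. *)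
Lemma ge0_integral_surface_zonal_beta q (theta : 'cV[R]_q.+1) (G : R -> \bar R) :
  (0 < q)%N -> sphere theta -> measurable_fun setT G -> (forall s, 0 <= G s) ->
  \int[@surface_measure R q.+1]_x G (dot x theta) =
  q.+1%:R%:E * zonal_const q * \int[mu]_(s in `](-1)%R, 1%R[)
    (G s * ((1 - s ^+ 2) `^ ((q.+1%:R - 3) / 2))%:E).
Proof.
move=> q0 theta1 mG G0; rewrite (ge0_integral_surface_zonal q0 theta1 mG G0).
congr (_ * _).
rewrite ge0_integral_cone_coord; first last.
- by move=> s; rewrite mule_ge0// lee_fin powR_ge0.
- apply: emeasurable_funM => //; apply/measurable_EFinP.
  apply: measurableT_comp (measurable_powR _) _.
  by apply: measurable_funB => //; exact: measurable_funX.
apply: eq_integral => v _; rewrite muleCA -EFinM; congr (_ * _%:E).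
have c0 := sqrt1D_gt0 v.
have -> : (1 - cone_coord v ^+ 2 = sqrt1D v `^ (- 2))%R.
  rewrite powRN powR_mulrn ?ltW// /cone_coord expr_div_n.
  have -> : (v ^+ 2 = sqrt1D v ^+ 2 - 1)%R by rewrite sqr_sqrt1D addrC addKr.
  by field; rewrite lt0r_neq0.
have cn n : (sqrt1D v ^- n = sqrt1D v `^ (- n%:R))%R.
  by rewrite powRN powR_mulrn// ltW.
rewrite !cn -powRrM -powRD; last by rewrite (lt0r_neq0 c0) implybT.
by congr (_ `^ _)%R; field.
Qed.

End cone_substitution.

(** * Laplace asymptotics of the angular distribution *)

Lemma nondecreasing_measurable (R : realType) (g : R -> R) :
  {homo g : x y / x <= y} -> measurable_fun setT g.
Proof.
move=> ndg; apply: (measurability _ (RGenOInfty.measurableE R)) => //.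
move=> /= _ [_ [a ->] <-]; rewrite setTI.
apply: is_interval_measurable => x y; rewrite /= !in_itv/= !andbT => gx _ z /andP[xz _].
by rewrite in_itv/= andbT (lt_le_trans gx)// ndg.
Qed.

Lemma is_derive_continuous (R : realType) (f : R -> R) (x df : R) :
  is_derive x 1 f df -> {for x, continuous f}.
Proof. by move=> [d _]; exact/differentiable_continuous/derivable1_diffP. Qed.

Section beta_laplace.
Context {R : realType}.
Variable a : R.
Local Notation mu := (@lebesgue_measure R).
Local Notation D := (`](-1)%R, 1%R[%classic : set R).
Local Notation w := (fun s : R => (1 - s ^+ 2) `^ a).
Hypothesis iw : mu.-integrable D (EFin \o w).

Let mD : measurable (D : set (measurableTypeR R)). Proof. exact: measurable_itv. Qed.

Let wD s : D s -> 0 < 1 - s ^+ 2 <= 1.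
Proof. by rewrite /= in_itv/= => /andP[s1 s2]; apply/andP; split; nra. Qed.

Lemma measurable_weight : measurable_fun setT w.
Proof.
apply: measurableT_comp (measurable_powR _) _.
by apply: measurable_funB => //; exact: measurable_funX.
Qed.

Lemma integrable_weightM (h : R -> R) (M : R) : measurable_fun setT h ->
  (forall s, D s -> `|h s| <= M) -> mu.-integrable D (fun s => (w s * h s)%:E).
Proof.
move=> mh hM; apply: (@le_integrable _ _ _ mu D mD _ (fun s => M%:E * (w s)%:E)%E).
- by apply/measurable_EFinP/measurable_funTS/measurable_funM => //;
    exact: measurable_weight.
- move=> s Ds /=; rewrite lee_fin normrM ger0_norm ?powR_ge0// mulrC normrM.
  rewrite (ger0_norm (powR_ge0 (1 - s ^+ 2) a)) ler_wpM2r ?powR_ge0//.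
  by rewrite (le_trans (hM s Ds))// ler_norm.
- exact: integrableZl.
Qed.

Definition weighted (h : R -> R) : R := \int[mu]_(s in D) (w s * h s).

Lemma weighted_le (h1 h2 : R -> R) M1 M2 :
  measurable_fun setT h1 -> measurable_fun setT h2 ->
  (forall s, D s -> `|h1 s| <= M1) -> (forall s, D s -> `|h2 s| <= M2) ->
  (forall s, D s -> h1 s <= h2 s) -> weighted h1 <= weighted h2.
Proof.
move=> mh1 mh2 hM1 hM2 h12; apply: le_Rintegral => //.
- exact: integrable_weightM hM1.
- exact: integrable_weightM hM2.
- by move=> s Ds; rewrite ler_wpM2l ?powR_ge0// h12.
Qed.

Lemma weighted_ge0 (h : R -> R) : (forall s, D s -> 0 <= h s) -> 0 <= weighted h.
Proof.
by move=> h0; apply: Rintegral_ge0 => s Ds; rewrite mulr_ge0 ?powR_ge0// h0.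
Qed.

Lemma weightedZ (c : R) (h : R -> R) M : measurable_fun setT h ->
  (forall s, D s -> `|h s| <= M) -> weighted (fun s => c * h s) = c * weighted h.
Proof.
move=> mh hM; rewrite /weighted -RintegralZl//; last exact: integrable_weightM hM.
by apply: eq_Rintegral => s _; rewrite mulrCA.
Qed.

Lemma weightedB (h1 h2 : R -> R) M1 M2 :
  measurable_fun setT h1 -> measurable_fun setT h2 ->
  (forall s, D s -> `|h1 s| <= M1) -> (forall s, D s -> `|h2 s| <= M2) ->
  weighted (fun s => h1 s - h2 s) = weighted h1 - weighted h2.
Proof.
move=> mh1 mh2 hM1 hM2; rewrite /weighted -RintegralB//.
- by apply: eq_Rintegral => s _; rewrite mulrBr.
- exact: integrable_weightM hM1.
- exact: integrable_weightM hM2.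
Qed.

Lemma weightedD (h1 h2 : R -> R) M1 M2 :
  measurable_fun setT h1 -> measurable_fun setT h2 ->
  (forall s, D s -> `|h1 s| <= M1) -> (forall s, D s -> `|h2 s| <= M2) ->
  weighted (fun s => h1 s + h2 s) = weighted h1 + weighted h2.
Proof.
move=> mh1 mh2 hM1 hM2; rewrite /weighted -RintegralD//.
- by apply: eq_Rintegral => s _; rewrite mulrDr.
- exact: integrable_weightM hM1.
- exact: integrable_weightM hM2.
Qed.

Lemma eq_weighted (h1 h2 : R -> R) :
  (forall s, D s -> h1 s = h2 s) -> weighted h1 = weighted h2.
Proof. by move=> h12; apply: eq_Rintegral => s; rewrite inE => /h12 ->. Qed.

Variable r : R.
Hypothesis r1 : 1 <= r.

Let r0 : 0 < r. Proof. exact: lt_le_trans r1. Qed.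

Let e (s : R) := expR ((s - 1) * r).

Let e_ge0 s : 0 <= e s. Proof. exact: expR_ge0. Qed.

Let e_le1 s : D s -> e s <= 1.
Proof.
rewrite /= in_itv/= => /andP[_ s1].
by rewrite -expR0 ler_expR pmulr_lle0// subr_le0 ltW.
Qed.

Let me : measurable_fun setT e.
Proof.
apply: measurableT_comp => //; apply: measurable_funM => //.
exact: measurable_funB.
Qed.

(** Up to an elementary factor, the modified Bessel function of order [a + j + 1/2] at [r]. The
    shift [s - 1] in the exponent keeps the exponential at most 1 on the interval. *)
Definition beta_laplace (j : nat) : R := weighted (fun s => (1 - s ^+ 2) ^+ j * e s).

Let mpe j : measurable_fun setT (fun s : R => (1 - s ^+ 2) ^+ j * e s).
Proof.
by apply: measurable_funM => //; apply: measurable_funX; exact: measurable_funB.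
Qed.

Let pe_le1 j s : D s -> `|(1 - s ^+ 2) ^+ j * e s| <= 1.
Proof.
move=> Ds; have /andP[w0 w1] := wD Ds.
rewrite ger0_norm ?mulr_ge0 ?exprn_ge0 ?(ltW w0)//.
rewrite mulr_ile1 ?exprn_ge0 ?(ltW w0) ?e_le1//.
by rewrite exprn_ile1// ltW.
Qed.

Let primitive j (s : R) := (1 - s ^+ 2) `^ (a + j.+1%:R) * e s.

Let primitive' j (s : R) := w s *
  ((1 - s ^+ 2) ^+ j.+1 * e s * r - (2 * (a + j.+1%:R)) * (s * ((1 - s ^+ 2) ^+ j * e s))).

Let is_derive_onemsqr (s : R) : is_derive s 1 (fun s : R => 1 - s ^+ 2) (- (2 * s)).
Proof.
have D1 := is_deriveB (is_derive_cst (1 : R) s 1) (is_deriveX 2 (is_derive_id s (1 : R))).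
apply: (@is_derive_eq _ _ _ _ _ _ _ _ D1).
by rewrite sub0r /GRing.scale /= mulr1.
Qed.

Let is_derive_e (s : R) : is_derive s 1 e (e s * r).
Proof.
have D1 := is_deriveB (is_derive_id s (1 : R)) (is_derive_cst (1 : R) s 1).
have D2 : is_derive s 1 (fun s : R => (s - 1) * r) r.
  apply: (@is_derive_eq _ _ _ _ _ _ _ _ (is_deriveM D1 (is_derive_cst r s 1))).
  by rewrite /GRing.scale /= mulr0 add0r subr0 mulr1.
exact: (@is_derive1_comp _ expR (fun s : R => (s - 1) * r) s _ _ (is_derive_expR _) D2).
Qed.

Let is_derive_primitive j s : D s -> is_derive s 1 (primitive j) (primitive' j s).
Proof.
move=> Ds; have /andP[w0 w1] := wD Ds.
have D1 := is_derive_onemsqr s.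
have D2 := @is_derive1_comp _ (fun x : R => x `^ (a + j.+1%:R)) _ s _ _ (is_derive1_powR _ w0) D1.
have D5 := is_derive_e s.
have D6 := is_deriveM D2 D5.
apply: (@is_derive_eq _ _ _ _ _ _ _ _ D6); rewrite /GRing.scale /= /primitive' -/(e s).
have -> : (1 - s ^+ 2) `^ (a + j.+1%:R) = w s * (1 - s ^+ 2) ^+ j.+1.
  by rewrite powRD ?(lt0r_neq0 w0) ?implybT// powR_mulrn ?ltW.
have -> : (1 - s ^+ 2) `^ (a + j.+1%:R - 1) = w s * (1 - s ^+ 2) ^+ j.
  rewrite -natr1 addrA addrK.
  by rewrite powRD ?(lt0r_neq0 w0) ?implybT// powR_mulrn ?ltW.
by ring.
Qed.

Let mprimitive' j : measurable_fun setT (primitive' j).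
Proof.
apply: measurable_funM; first exact: measurable_weight.
apply: measurable_funB; first by apply: measurable_funM => //; exact: mpe.
by apply: measurable_funM => //; apply: measurable_funM => //; exact: mpe.
Qed.

Let primitive'_integrable j : mu.-integrable D (EFin \o primitive' j).
Proof.
apply: (@integrable_weightM _ (r + `|2 * (a + j.+1%:R)|)).
  apply: measurable_funB; first by apply: measurable_funM => //; exact: mpe.
  by apply: measurable_funM => //; apply: measurable_funM => //; exact: mpe.
move=> s Ds; rewrite (le_trans (ler_normB _ _))// lerD//.
  by rewrite normrM (gtr0_norm r0) ler_piMl ?(ltW r0)// pe_le1.
rewrite normrM ler_piMr// normrM mulr_ile1 ?pe_le1//.
by move: Ds; rewrite /= in_itv/= ler_norml => /andP[/ltW -> /ltW ->].
Qed.

(** With [n.+2] the point [t n] is already positive at [n = 0], so [[- t n, t n]] is always a proper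
    interval. *)
Let t n : R := 1 - n.+2%:R^-1.

Let t01 n : 0 < t n < 1.
Proof.
rewrite /t subr_gt0 ltrBlDr ltrDl invr_gt0 ltr0n andbT.
by rewrite invf_lt1 ?ltr0n// ltr1n.
Qed.

Let tD n s : `[- t n, t n]%classic s -> D s.
Proof.
have /andP[t0 t1] := t01 n.
rewrite /= !in_itv/= => /andP[ts st]; apply/andP; split.
  by rewrite (lt_le_trans _ ts)// ltrN2.
exact: le_lt_trans t1.
Qed.

Let integral_primitive' j n :
  (\int[mu]_(s in `[(- t n)%R, t n]) (primitive' j s)%:E =
   (primitive j (t n) - primitive j (- t n))%:E)%E.
Proof.
have /andP[t0 t1] := t01 n.
have tt : - t n < t n by rewrite (lt_trans _ t0)// oppr_lt0.
have inD s : s \in `[- t n, t n] -> D s by move=> st; exact: (@tD n).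
have cp' s : D s -> {for s, continuous (primitive' j)}.
  move=> Ds; have /andP[w0 w1] := wD Ds.
  have cw : {for s, continuous w}.
    exact: is_derive_continuous (@is_derive1_comp _ (fun x => x `^ a) _ s _ _
      (is_derive1_powR a w0) (is_derive_onemsqr s)).
  have ce : {for s, continuous e} by exact: is_derive_continuous (is_derive_e s).
  have cX k : {for s, continuous (fun s : R => (1 - s ^+ 2) ^+ k)}.
    have c1 := is_derive_continuous (is_derive_onemsqr s).
    elim: k => [|k IH]; first exact: cvg_cst.
    rewrite /prop_for /continuous_at; under eq_fun do rewrite exprS.
    by rewrite exprS; exact: cvgM.
  apply: cvgM; first exact: cw.
  apply: cvgB; first exact: (cvgM (cvgM (cX j.+1) ce) (cvg_cst r)).
  exact: (cvgM (cvg_cst _) (cvgM (@cvg_id _ _) (cvgM (cX j) ce))).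
have cp s : D s -> {for s, continuous (primitive j)}.
  by move=> /(is_derive_primitive j)/is_derive_continuous.
rewrite EFinB; apply: (@continuous_FTC2 _ (primitive' j) (primitive j)) => //.
- apply: continuous_in_subspaceT => s; rewrite inE => /= st.
  by apply: cp'; exact: (@tD n).
- split.
  + move=> s /subset_itv_oo_cc/inD Ds.
    by have [] := is_derive_primitive j Ds.
  + by apply: cvg_at_right_filter; apply: cp; apply: inD; rewrite in_itv/= lexx ltW.
  + by apply: cvg_at_left_filter; apply: cp; apply: inD; rewrite in_itv/= lexx ltW.
- move=> s /subset_itv_oo_cc/inD Ds; rewrite derive1E.
  by have [_ ->] := is_derive_primitive j Ds.
Qed.

Hypothesis a1 : -1 < a.

Let t_cvg : t n @[n --> \oo] --> (1 : R).
Proof.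
rewrite -[X in _ --> X]subr0; apply: cvgB; first exact: cvg_cst.
have := @cvg_harmonic R; rewrite -(cvg_shiftn 1)/=.
by under eq_fun do rewrite addn1.
Qed.

Let primitive_cvg j (sg : bool) :
  primitive j ((-1) ^+ sg * t n) @[n --> \oo] --> (0 : R).
Proof.
have aj : 0 < a + j.+1%:R.
  by rewrite -natr1 addrCA addrC ltr_wpDr// -ltrBlDr sub0r.
have ct : (1 - (t n) ^+ 2) `^ (a + j.+1%:R) @[n --> \oo] --> (0 : R).
  have ht := t_cvg.
  have ht2 : 1 - (t n) ^+ 2 @[n --> \oo] --> (0 : R)^'+.
    have ht2' : 1 - (t n) ^+ 2 @[n --> \oo] --> (0 : R).
      have : 1 - t n * t n @[n --> \oo] --> (1 - 1 * 1 : R).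
        by apply: cvgB; [exact: cvg_cst|exact: cvgM].
      by rewrite mulr1 subrr; under eq_fun do rewrite -expr2.
    move=> A hA.
    have h : \forall n \near \oo, 0 < 1 - t n ^+ 2 -> A (1 - t n ^+ 2).
      exact: ht2' hA.
    apply: filterS h => n; apply.
    by have /andP[? ?] := t01 n; nra.
  exact: cvg_comp ht2 (powR_cvg0 aj).
apply: (@squeeze_cvgr _ _ _ _ (fun=> 0) (fun n => (1 - (t n) ^+ 2) `^ (a + j.+1%:R))) => //.
- near=> n; rewrite /primitive; have /andP[t0 t1] := t01 n.
  have -> : ((-1) ^+ sg * t n) ^+ 2 = t n ^+ 2 by rewrite exprMn sqrr_sign mul1r.
  rewrite mulr_ge0 ?powR_ge0//= ler_piMr ?powR_ge0// e_le1//.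
  by rewrite /= in_itv/=; case: sg; rewrite ?expr1 ?expr0 ?mulN1r ?mul1r;
    apply/andP; split; lra.
- exact: cvg_cst.
Unshelve. all: by end_near. Qed.

(** [primitive j] vanishes at both ends because [a + j + 1 > 0], so its derivative has integral
    zero. The weight is singular at the ends when [a < 0], which happens for [p = 2]; the
    fundamental theorem is therefore applied on [[- t n, t n]] and passed to the limit by dominated
    convergence. *)
Lemma beta_laplace_by_parts j :
  r * beta_laplace j.+1 =
  2 * (a + j.+1%:R) * weighted (fun s => s * ((1 - s ^+ 2) ^+ j * e s)).
Proof.
have cI : (\int[mu]_(s in `[(- t n)%R, t n]) (primitive' j s)%:E @[n --> \oo] -->
    \int[mu]_(s in D) (primitive' j s)%:E)%E.
  have tE n : `[- t n, t n]%classic = D `&` `[- t n, t n]%classic.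
    by apply/seteqP; split=> [s st|s []//]; split=> //; exact: (@tD n).
  under eq_fun do rewrite tE integral_mkcondr.
  have [] // := @dominated_convergence _ _ _ mu D mD
    (fun n => (fun s => (primitive' j s)%:E) \_ `[- t n, t n])
    (fun s => (primitive' j s)%:E) (fun s => `|primitive' j s|%:E).
  - move=> n; apply: measurable_funTS; apply/(measurable_restrictT _ _).1 => //.
    by apply/measurable_EFinP/measurable_funTS; exact: mprimitive'.
  - by apply/measurable_EFinP/measurable_funTS; exact: mprimitive'.
  - apply: aeW => s; rewrite /= in_itv/= => /andP[s1 s2]; apply: cvg_near_cst.
    have ht : t n @[n --> \oo] --> (1 : R) by exact: t_cvg.
    near=> n; rewrite patchE mem_set//= in_itv/= -ler_norml.
    near: n; apply: (cvgr_ge 1) => //.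
    by rewrite ltr_norml s1 s2.
  - exact: integrable_norm (primitive'_integrable j).
  - apply: aeW => s n _; rewrite patchE; case: ifPn => _; first exact: lexx.
    by rewrite abse0 lee_fin.
have I0 : (\int[mu]_(s in D) (primitive' j s)%:E = 0)%E.
  rewrite -(cvg_lim _ cI)//; apply: cvg_lim => //.
  under eq_fun do rewrite integral_primitive'.
  apply: cvg_EFin; first exact: nearW.
  rewrite -(subr0 0); apply: cvgB.
    by have := @primitive_cvg j false; under eq_fun do rewrite expr0 mul1r.
  by have := @primitive_cvg j true; under eq_fun do rewrite expr1 mulN1r.
have : weighted (fun s => (1 - s ^+ 2) ^+ j.+1 * e s * r -
    (2 * (a + j.+1%:R)) * (s * ((1 - s ^+ 2) ^+ j * e s))) = 0.
  by rewrite /weighted /Rintegral I0.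
have sb s : D s -> `|s * ((1 - s ^+ 2) ^+ j * e s)| <= 1.
  move=> Ds; rewrite normrM mulr_ile1 ?pe_le1//.
  by move: Ds; rewrite /= in_itv/= ler_norml => /andP[/ltW -> /ltW ->].
rewrite (@weightedB _ _ r (`|2 * (a + j.+1%:R)|)); first last.
- by move=> s Ds; rewrite normrM ler_piMr// sb.
- by move=> s Ds; rewrite normrM (gtr0_norm r0) ler_piMl ?(ltW r0)// pe_le1.
- by apply: measurable_funM => //; apply: measurable_funM => //; exact: mpe.
- by apply: measurable_funM => //; exact: mpe.
rewrite (@weightedZ _ _ 1)//; last by apply: measurable_funM => //; exact: mpe.
move=> /eqP; rewrite subr_eq0 => /eqP <-; rewrite /beta_laplace -(@weightedZ _ _ 1)//.
  by apply: eq_weighted => s _; rewrite mulrC.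
exact: pe_le1.
Unshelve. all: by end_near. Qed.

End beta_laplace.

(** * Exponential moments for large [r] *)

Section beta_asymptotics.
Context {R : realType}.
Variable a : R.
Local Notation mu := (@lebesgue_measure R).
Local Notation D := (`](-1)%R, 1%R[%classic : set R).
Hypothesis iw : mu.-integrable D (EFin \o (fun s : R => (1 - s ^+ 2) `^ a)).
Hypothesis a1 : -1 < a.
Local Notation b r j := (beta_laplace a r j).
Local Notation e r := (fun s : R => expR ((s - 1) * r)).

Implicit Types (r s : R) (j : nat).

Let mD : measurable (D : set (measurableTypeR R)). Proof. exact: measurable_itv. Qed.

Let a1j (j : nat) : 0 < a + j.+1%:R.
Proof. by rewrite -natr1 addrCA addrC ltr_wpDr// -ltrBlDr sub0r. Qed.

Let wD s : D s -> 0 < 1 - s ^+ 2 <= 1.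
Proof. by rewrite /= in_itv/= => /andP[s1 s2]; apply/andP; split; nra. Qed.

Lemma measurable_expR_laplace r : measurable_fun setT (e r).
Proof.
apply: measurableT_comp => //; apply: measurable_funM => //.
exact: measurable_funB.
Qed.

Lemma expR_laplace_le1 r s : 0 < r -> D s -> e r s <= 1.
Proof.
move=> r0; rewrite /= in_itv/= => /andP[_ s1].
by rewrite expR_le1 pmulr_lle0// subr_le0 ltW.
Qed.

Lemma measurable_onemsqrX j : measurable_fun setT (fun s : R => (1 - s ^+ 2) ^+ j).
Proof. by apply: measurable_funX; exact: measurable_funB. Qed.

Lemma onemsqrXM_le1 (h : R -> R) j s : D s -> 0 <= h s <= 1 ->
  `|(1 - s ^+ 2) ^+ j * h s| <= 1.
Proof.
move=> /wD/andP[w0 w1] /andP[h0 h1]; rewrite ger0_norm ?mulr_ge0 ?exprn_ge0 ?(ltW w0)//.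
by rewrite mulr_ile1 ?exprn_ge0 ?(ltW w0)// exprn_ile1// ltW.
Qed.

Let e01 r s : 0 < r -> D s -> 0 <= e r s <= 1.
Proof. by move=> r0 Ds; rewrite expR_ge0 expR_laplace_le1. Qed.

Let mXe j r : measurable_fun setT (fun s : R => (1 - s ^+ 2) ^+ j * e r s).
Proof.
apply: measurable_funM; first exact: measurable_onemsqrX.
exact: measurable_expR_laplace.
Qed.

Let sXe_le1 j r s : 0 < r -> D s -> `|s * ((1 - s ^+ 2) ^+ j * e r s)| <= 1.
Proof.
move=> r0 Ds; rewrite normrM mulr_ile1 ?(@onemsqrXM_le1 (e r)) ?e01//.
by move: Ds; rewrite /= in_itv/= ler_norml => /andP[/ltW -> /ltW ->].
Qed.

(** Integration by parts with the factor [s] bounded by 1. Iterated, it shows that [r^j b_j] stays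
    bounded by a multiple of [b_0]. *)
Lemma beta_laplace_step r j : 1 <= r -> r * b r j.+1 <= 2 * (a + j.+1%:R) * b r j.
Proof.
move=> r1; have r0 : 0 < r by exact: lt_le_trans r1.
rewrite beta_laplace_by_parts// ler_wpM2l ?mulr_ge0 ?(ltW (a1j j))//.
apply: (@weighted_le _ _ iw _ _ 1 1).
- by apply: measurable_funM => //; exact: mXe.
- exact: mXe.
- by move=> s; exact: sXe_le1.
- by move=> s Ds; apply: (@onemsqrXM_le1 (e r)) => //; exact: e01.
move=> s Ds; rewrite ler_piMl//.
  by rewrite mulr_ge0 ?expR_ge0// exprn_ge0//; have /andP[/ltW] := wD Ds.
by move: Ds; rewrite /= in_itv/= => /andP[_ /ltW].
Qed.

Let powR_lb (x : R) : 2^-1 <= x <= 2 -> 2 `^ (- `|a|) <= x `^ a.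
Proof.
move=> /andP[x1 x2]; have x0 : 0 < x by rewrite (lt_le_trans _ x1).
have [a0|a0] := leP 0 a.
  rewrite ger0_norm// powRN -powR_inv1 ?powR_ge0// -powRrM mulrN1 -mulN1r powRrM.
  rewrite powR_inv1//; apply: ge0_ler_powR => //; rewrite nnegrE ?(ltW x0)//.
have aV (y : R) : y `^ a = (y `^ (- a))^-1 by rewrite powRN invrK.
rewrite ltr0_norm// opprK !aV lef_pV2 ?posrE ?powR_gt0//.
by apply: ge0_ler_powR => //; rewrite ?nnegrE ?oppr_ge0 ?(ltW a0) ?(ltW x0).
Qed.

(** Only [[1 - 1/r, 1 - 1/(2r)]] is kept: there the exponential is at least [1/e], [r (1 - s^2)]
    lies in [[1/2, 2]], and the length is [1/(2r)]. This is the bound that makes the error of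
    condition (iv) small relative to [b_0]. *)
Lemma beta_laplace_lb : exists2 c, 0 < c &
  forall r, 1 <= r -> c * r `^ (- (a + 1)) <= b r 0.
Proof.
exists (2 `^ (- `|a|) * expR (- 1) / 2).
  by rewrite divr_gt0// mulr_gt0 ?powR_gt0 ?expR_gt0.
move=> r r1; have r0 : 0 < r by exact: lt_le_trans r1.
pose S := `[1 - r^-1, 1 - (2 * r)^-1]%classic : set (measurableTypeR R).
pose m := 2 `^ (- `|a|) * r `^ (- a) * expR (- 1).
have ri : r^-1 <= 1 by rewrite invf_le1.
have ri0 : 0 < r^-1 by rewrite invr_gt0.
have SD : S `<=` D.
  move=> s; rewrite /S /= !in_itv/= invfM => /andP[s1 s2].
  by apply/andP; split; lra.
have mS : measurable S by exact: measurable_itv.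
have iS : mu.-integrable D (fun s => (m * \1_S s)%:E).
  apply: (@integrableZl _ _ _ mu D mD m (fun s => (\1_S s)%:E)).
  apply: (integrableS measurableT) => //.
  exact: (@integrable_indic_itv R (1 - r^-1) (1 - (2 * r)^-1) true false).
have -> : 2 `^ (- `|a|) * expR (- 1) / 2 * r `^ (- (a + 1)) =
    \int[mu]_(s in D) (m * \1_S s).
  rewrite RintegralZl//; last first.
    apply: (integrableS measurableT) => //.
    exact: (@integrable_indic_itv R (1 - r^-1) (1 - (2 * r)^-1) true false).
  rewrite /Rintegral integral_indic// (setIidl SD).
  have muS : mu S = ((2 * r)^-1)%:E.
    rewrite lebesgue_measure_itv/= lte_fin ifT; last by rewrite invfM; lra.
    by rewrite -EFinB; congr EFin; field; rewrite lt0r_neq0.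
  rewrite [X in m * fine X](_ : _ = ((2 * r)^-1)%:E); last exact: muS.
  rewrite /= /m opprD powRD; last by rewrite lt0r_neq0 ?implybT.
  rewrite [r `^ - 1]powR_inv1 ?(ltW r0)//.
  by field; rewrite lt0r_neq0.
apply: le_Rintegral => //.
- apply: (@integrable_weightM _ _ iw _ 1).
    exact: mXe.
  by move=> s Ds; apply: (@onemsqrXM_le1 (e r)) => //; exact: e01.
move=> s Ds; have [Ss|Ss] := pselect (S s); last first.
  by rewrite indicE memNset//= mulr0 mulr_ge0 ?powR_ge0// expr0 mul1r expR_ge0.
rewrite indicE mem_set//= mulr1 expr0 mul1r /m.
have /andP[s1 s2] : 1 - r^-1 <= s <= 1 - r^-1 / 2.
  by move: Ss; rewrite /S /= in_itv/= invfM [2^-1 * _]mulrC.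
have rV : r * r^-1 = 1 by rewrite divff// lt0r_neq0.
have rs1 : r * (1 - s) <= 1 by rewrite -rV ler_pM2l//; lra.
have rs2 : 2^-1 <= r * (1 - s).
  by move: (ler_wpM2l (ltW r0) s2); rewrite mulrBr mulr1 mulrA rV; lra.
have s0 : 0 <= s by rewrite (le_trans _ s1)// subr_ge0.
have sl1 : s <= 1 by rewrite (le_trans s2)// lerBlDr lerDl divr_ge0// ltW.
have x12 : 2^-1 <= r * (1 - s ^+ 2) <= 2.
  have -> : r * (1 - s ^+ 2) = r * (1 - s) * (1 + s) by ring.
  by apply/andP; split; nra.
rewrite ler_pM ?mulr_ge0 ?powR_ge0 ?expR_ge0//.
  have -> : 1 - s ^+ 2 = r^-1 * (r * (1 - s ^+ 2)).
    by rewrite mulrA mulVf ?mul1r// lt0r_neq0.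
  rewrite powRM ?invr_ge0 ?(ltW r0)//; last by move: x12 => /andP[x1 _]; lra.
  rewrite -powR_inv1 ?(ltW r0)// -powRrM mulN1r mulrC ler_wpM2l ?powR_ge0//.
  exact: powR_lb.
by rewrite ler_expR; lra.
Qed.

Lemma beta_laplace_gt0 r : 1 <= r -> 0 < b r 0.
Proof.
have [c c0 h] := beta_laplace_lb => r1; apply: lt_le_trans (h r r1).
by rewrite mulr_gt0// powR_gt0// (lt_le_trans _ r1).
Qed.

(** For [s >= 0], [1 - s <= 1 - s^2]; for [s < 0] the exponential is below [exp (- r)] and [1 - s]
    below 2. *)
Let weightedons r : 1 <= r ->
  weighted a (fun s => (1 - s) * e r s) <=
  b r 1 + 2 * expR (- r) * weighted a (fun=> 1).
Proof.
move=> r1; have r0 : 0 < r by exact: lt_le_trans r1.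
rewrite -(@weightedZ _ _ iw _ _ 1)//; last by move=> s _; rewrite normr1.
rewrite /beta_laplace -(@weightedD _ _ iw _ _ 1 `|2 * expR (- r) * 1|)//.
- apply: (@weighted_le _ _ iw _ _ 2 (1 + `|2 * expR (- r) * 1|)) => //.
  + apply: measurable_funM; first exact: measurable_funB.
    exact: measurable_expR_laplace.
  + by apply: measurable_funD => //; exact: mXe.
  + move=> s Ds; have /andP[e0 e1] := e01 r0 Ds.
    rewrite normrM (ger0_norm e0) -[leRHS]mulr1 ler_pM//.
    by move: Ds; rewrite /= in_itv/= ler_norml => /andP[s1 s2]; apply/andP; split; lra.
  + move=> s Ds; rewrite (le_trans (ler_normD _ _))// lerD//.
    by apply: (@onemsqrXM_le1 (e r)) => //; exact: e01.
  + move=> s Ds; rewrite expr1 mulr1.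
    have [s0|s0] := leP 0 s.
      rewrite ler_wpDr ?mulr_ge0 ?expR_ge0// ler_wpM2r ?expR_ge0//.
      by move: Ds; rewrite /= in_itv/= => /andP[_ s1]; nra.
    rewrite ler_wpDl//.
      by rewrite mulr_ge0 ?expR_ge0//; have /andP[/ltW] := wD Ds.
    rewrite ler_pM ?expR_ge0//.
    * by move: Ds; rewrite /= in_itv/= => /andP[s1 _]; lra.
    * by move: Ds; rewrite /= in_itv/= => /andP[s1 _]; lra.
    * by rewrite ler_expR; nra.
by move=> s Ds; apply: (@onemsqrXM_le1 (e r)) => //; exact: e01.
Qed.

(** By parts, [r b_1 = 2 (a + 1) (b_0 - d)] with [d] the weighted integral of [(1 - s) e]. Up to an
    exponentially small term [d] is at most [b_1], which [beta_laplace_step] bounds by a multiple of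
    [b_0 / r]. *)
Lemma beta_laplace_ratio : exists2 K, 0 <= K &
  forall r, 1 <= r -> `|r * b r 1 - 2 * (a + 1) * b r 0| <= K / r * b r 0.
Proof.
have [c c0 lb] := beta_laplace_lb.
pose N := Num.trunc (a + 2).
pose W := weighted a (fun=> 1).
have W0 : 0 <= W by apply: weighted_ge0.
have a10 : 0 <= a + 1 by have := ltW (a1j 0).
exists (2 * (a + 1) * (2 * (a + 1) + 2 * (N.+1)`!%:R * W / c)).
  by rewrite mulr_ge0 ?mulr_ge0// addr_ge0 ?mulr_ge0// ?invr_ge0 ?(ltW c0)// !mulr_ge0.
move=> r r1; have r0 : 0 < r by exact: lt_le_trans r1.
have b0 := beta_laplace_gt0 r1.
pose d := weighted a (fun s => (1 - s) * e r s).
have mse : measurable_fun setT (fun s : R => s * ((1 - s ^+ 2) ^+ 0 * e r s)).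
  by apply: measurable_funM => //; exact: mXe.
have dE : weighted a (fun s => s * ((1 - s ^+ 2) ^+ 0 * e r s)) = b r 0 - d.
  have -> : d = weighted a (fun s => (1 - s ^+ 2) ^+ 0 * e r s -
      s * ((1 - s ^+ 2) ^+ 0 * e r s)).
    by apply: eq_weighted => s _; rewrite expr0 mul1r mulrBl mul1r.
  rewrite (@weightedB _ _ iw _ _ 1 1)//.
  - by rewrite opprB addrC subrK.
  - by move=> s Ds; apply: (@onemsqrXM_le1 (e r)) => //; exact: e01.
  - by move=> s; exact: sXe_le1.
have d0 : 0 <= d.
  apply: weighted_ge0 => s; rewrite /= in_itv/= => /andP[_ s1].
  by rewrite mulr_ge0 ?expR_ge0// subr_ge0 ltW.
rewrite beta_laplace_by_parts// dE mulrBr addrC addKr normrN ger0_norm; last first.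
  by rewrite mulr_ge0// mulr_ge0.
suff key : d <= (2 * (a + 1) + 2 * (N.+1)`!%:R * W / c) / r * b r 0.
  have := ler_wpM2l (mulr_ge0 (ler0n R 2) a10) key; by rewrite !mulrA.
rewrite 2!mulrDl.
rewrite (le_trans (weightedons r1))// lerD//.
  rewrite mulrAC ler_pdivlMr// mulrC.
  exact: (beta_laplace_step 0 r1).
(* The exponential beats every power: since [a + 2 <= N.+1], [r^(a+2) <= r^(N+1) <= (N+1)! exp r].
   One factor [r] gives the rate, the remaining [r^(a+1)] is paid by the lower bound on [b_0]. *)
have er : expR (- r) <= (N.+1)`!%:R / c / r * b r 0.
  have h1 : r `^ (a + 2) <= (N.+1)`!%:R * expR r.
    apply: (@le_trans _ _ (r ^+ N.+1)).
      rewrite -powR_mulrn ?(ltW r0)// ler_powR//.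
      exact: ltW (truncnS_gt _).
    rewrite mulrC -ler_pdivrMr ?ltr0n ?fact_gt0//.
    by rewrite (le_trans _ (expR_ge1Dxn N (ltW r0)))// lerDr.
  have h2 := lb r r1.
  have h3 : r `^ (- (a + 1)) = r * (r `^ (a + 2))^-1.
    rewrite -powRN -{2}(powRr1 (ltW r0)) -powRD; last by rewrite lt0r_neq0 ?implybT.
    by congr (_ `^ _); ring.
  rewrite expRN -[leLHS]mul1r ler_pdivrMr ?expR_gt0//.
  have P0 : 0 < r `^ (a + 2) by exact: powR_gt0.
  rewrite h3 mulrA ler_pdivrMr// in h2.
  have F0 : 0 < (N.+1)`!%:R :> R by rewrite ltr0n fact_gt0.
  rewrite -(ler_pM2l (mulr_gt0 c0 r0)) mulr1 (le_trans h2)//.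
  have -> : c * r * ((N.+1)`!%:R / c / r * b r 0 * expR r) =
      b r 0 * ((N.+1)`!%:R * expR r).
    by field; rewrite !lt0r_neq0.
  by rewrite ler_wpM2l ?(ltW b0).
rewrite (_ : 2 * (N.+1)`!%:R * W / c / r * b r 0 =
  2 * ((N.+1)`!%:R / c / r * b r 0) * W); last by field; rewrite !lt0r_neq0.
by rewrite ler_wpM2r// ler_wpM2l.
Qed.

End beta_asymptotics.

(** * From the exponential to an angular function of the class *)

Section classF_concentration.
Context {R : realType}.
Variables (a : R) (f : R -> R).
Local Notation mu := (@lebesgue_measure R).
Local Notation D := (`](-1)%R, 1%R[%classic : set R).
Hypothesis iw : mu.-integrable D (EFin \o (fun s : R => (1 - s ^+ 2) `^ a)).
Hypothesis a1 : -1 < a.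
Hypothesis Ff : classF f.
Implicit Types (r s kappa : R) (j : nat).

Definition rate (f : R -> R) (kappa : R) : R := kappa * varphi f kappa.

Let mD : measurable (D : set (measurableTypeR R)). Proof. exact: measurable_itv. Qed.

(** [f] is monotone on each half-line only; composing with [min x 0] and [max x 0] gives two
    functions monotone on the whole line, to be glued at 0. *)
Lemma classF_measurable : measurable_fun setT f.
Proof.
pose f1 (x : R) := f (Num.min x 0); pose f2 (x : R) := f (Num.max x 0).
have nd1 : {homo f1 : x y / x <= y}.
  move=> x y xy; apply: (classF_nondecreasing Ff).
  - by rewrite in_itv/= ge_min lexx orbT.
  - by rewrite in_itv/= ge_min lexx orbT.
  - by rewrite le_min !ge_min xy lexx orbT.
have nd2 : {homo f2 : x y / x <= y}.
  move=> x y xy; have : Num.max x 0 <= Num.max y 0.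
    by rewrite ge_max !le_max xy lexx orbT.
  rewrite le_eqVlt => /predU1P[E|xy']; first by rewrite /f2 E.
  apply/ltW/(classF_increasing Ff) => //.
  - by rewrite in_itv/= andbT le_max lexx orbT.
  - by rewrite in_itv/= andbT le_max lexx orbT.
have -> : f = fun x => if x <= 0 then f1 x else f2 x.
  apply/funext => x; rewrite /f1 /f2; case: ifPn => [x0|]; first by rewrite min_l.
  by rewrite -ltNge => x0; rewrite max_l// ltW.
apply: measurable_fun_ifT; [exact: measurable_fun_ler|exact: nondecreasing_measurable..].
Qed.

Lemma classF_gt0 kappa : 0 < kappa -> 0 < f kappa.
Proof.
move=> k0; apply: (le_lt_trans (classF_ge0 Ff 0)).
by apply: (classF_increasing Ff) => //; rewrite in_itv/= ?lexx ?(ltW k0).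
Qed.

Lemma classF_ratio01 kappa s : 0 < kappa -> D s -> 0 <= f (kappa * s) / f kappa <= 1.
Proof.
move=> k0; rewrite /= in_itv/= => /andP[s1 s2]; have fk := classF_gt0 k0.
rewrite divr_ge0 ?(classF_ge0 Ff) ?(ltW fk)//= ler_pdivrMr// mul1r.
have [s0|s0] := leP s 0; last first.
  apply/ltW/(classF_increasing Ff); rewrite ?in_itv/= ?andbT ?mulr_ge0 ?(ltW k0) ?(ltW s0)//.
  by rewrite gtr_pMr.
apply: (@le_trans _ _ (f 0)).
  by apply: (classF_nondecreasing Ff); rewrite ?in_itv/= ?lexx// pmulr_rle0.
by apply/ltW/(classF_increasing Ff); rewrite ?in_itv/= ?lexx ?(ltW k0).
Qed.

Lemma measurable_classF_ratio kappa :
  measurable_fun setT (fun s : R => f (kappa * s) / f kappa).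
Proof.
apply: measurable_funM => //; apply: measurableT_comp classF_measurable _.
exact: measurable_funM.
Qed.

Definition angular_moment kappa j : R :=
  weighted a (fun s => (1 - s ^+ 2) ^+ j * (f (kappa * s) / f kappa)).

Let mXg j kappa : measurable_fun setT
  (fun s : R => (1 - s ^+ 2) ^+ j * (f (kappa * s) / f kappa)).
Proof.
apply: measurable_funM; first exact: measurable_onemsqrX.
exact: measurable_classF_ratio.
Qed.

Let mXe j r : measurable_fun setT (fun s : R => (1 - s ^+ 2) ^+ j * expR ((s - 1) * r)).
Proof.
apply: measurable_funM; first exact: measurable_onemsqrX.
exact: measurable_expR_laplace.
Qed.

(** Where [f] vanishes, the logarithm is [-oo] and its exponential 0, so condition (iv) really
    compares the ratio [f (kappa s) / f kappa] with an exponential. *)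
Lemma expeR_lne_ratio kappa x : 0 < kappa ->
  (expeR (lne (f x)%:E - lne (f kappa)%:E) = (f x / f kappa)%:E)%E.
Proof.
move=> k0; have fk := classF_gt0 k0.
have [fx|fx] := leP (f x) 0.
  have -> : f x = 0 by apply/eqP; rewrite eq_le fx (classF_ge0 Ff).
  have -> : lne (0%:E : \bar R) = -oo%E by rewrite /= lexx.
  by rewrite mul0r (lne_EFin fk).
rewrite (lne_EFin fx) (lne_EFin fk) -EFinB /=; congr EFin.
by rewrite expRD expRN !lnK.
Qed.

(** Condition (iv) with [xi = zeta = a + j], since [(1 - s)(1 + s) = 1 - s^2]. The absolute value
    stays inside the integral because the defect below weighs the same difference by [1 - s]. *)
Lemma classF_ratio_laplace j eps : 0 < eps -> \forall kappa \near +oo,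
  weighted a (fun s => `|(1 - s ^+ 2) ^+ j * (f (kappa * s) / f kappa) -
    (1 - s ^+ 2) ^+ j * expR ((s - 1) * rate f kappa)|) <=
  eps * rate f kappa `^ (- (a + j%:R + 1)).
Proof.
move=> eps0; have aj : -1 < a + j%:R by rewrite ltr_wpDr.
have approx := classF_approx Ff aj aj eps0.
near=> kappa.
have k0 : 0 < kappa by near: kappa; exact: nbhs_pinfty_gt.
have r0 : 0 < rate f kappa.
  near: kappa; exact: (cvgryPgt _).1 (classF_diverges Ff) 0.
pose g s := f (kappa * s) / f kappa.
pose e s := expR ((s - 1) * rate f kappa).
have g1 s : D s -> `|(1 - s ^+ 2) ^+ j * g s| <= 1.
  by move=> Ds; apply: (onemsqrXM_le1 (h := g)) => //; exact: classF_ratio01.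
have e1 s : D s -> `|(1 - s ^+ 2) ^+ j * e s| <= 1.
  move=> Ds; apply: (onemsqrXM_le1 (h := e)) => //.
  by rewrite expR_ge0 (expR_laplace_le1 r0 Ds).
pose h s := (1 - s ^+ 2) ^+ j * g s - (1 - s ^+ 2) ^+ j * e s.
have mh : measurable_fun setT h by apply: measurable_funB; [exact: mXg|exact: mXe].
have ih : mu.-integrable D (fun s => ((1 - s ^+ 2) `^ a * h s)%:E).
  apply: (@integrable_weightM _ _ iw _ 2) => // s Ds.
  by have := g1 s Ds; have := e1 s Ds => ? ?; apply: (le_trans (ler_normB _ _)); lra.
rewrite -lee_fin; apply: (@le_trans _ _ (approx_error f (a + j%:R) (a + j%:R) kappa)); last first.
  have -> : eps * rate f kappa `^ (- (a + j%:R + 1)) =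
      eps * (1 / (kappa * varphi f kappa) `^ (a + j%:R + 1)).
    by rewrite div1r -powRN.
  by near: kappa; exact: approx.
apply: (@le_trans _ _ (\int[mu]_(s in D) `|(1 - s ^+ 2) `^ a * h s|)%:E).
  rewrite lee_fin le_eqVlt; apply/orP; left; apply/eqP.
  by apply: eq_Rintegral => s _; rewrite normrM (ger0_norm (powR_ge0 _ _)).
rewrite /Rintegral fineK; last first.
  exact: integrable_fin_num (integrable_norm ih).
have E s : D s -> (((1 - s) `^ (a + j%:R) * (1 + s) `^ (a + j%:R))%:E *
     `| expeR (lne (f (kappa * s))%:E - lne (f kappa)%:E)
        - (expR ((s - 1) * (kappa * varphi f kappa)))%:E | =
     `|(1 - s ^+ 2) `^ a * h s|%:E)%E.
  move=> Ds; rewrite expeR_lne_ratio// -EFinB abse_EFin -EFinM; congr EFin.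
  have [s1 s2] : -1 < s /\ s < 1 by move: Ds; rewrite /= in_itv/= => /andP[].
  have w0 : 0 < 1 - s ^+ 2 by nra.
  rewrite -powRM; [|by lra|by lra].
  have -> : (1 - s) * (1 + s) = 1 - s ^+ 2 by ring.
  rewrite /h -mulrBr [RHS]normrM normrM (ger0_norm (powR_ge0 _ _)).
  rewrite (ger0_norm (exprn_ge0 j (ltW w0))) [RHS]mulrA; congr (_ * _).
  by rewrite powRD ?(lt0r_neq0 w0) ?implybT// powR_mulrn ?(ltW w0).
rewrite /approx_error [X in (_ <= X)%E]integral_itv_bndoo; last first.
  apply: (eq_measurable_fun (fun s => (`|(1 - s ^+ 2) `^ a * h s|)%:E)).
    by move=> s; rewrite inE => Ds; rewrite E.
  by have := measurable_int _ (integrable_norm ih).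
rewrite le_eqVlt; apply/orP; left; apply/eqP.
by apply: eq_integral => s; rewrite inE => Ds; rewrite E.
Unshelve. all: by end_near. Qed.

Lemma classF_angular_moment j eps : 0 < eps -> \forall kappa \near +oo,
  `|angular_moment kappa j - beta_laplace a (rate f kappa) j| <=
  eps * rate f kappa `^ (- (a + j%:R + 1)).
Proof.
move=> eps0; near=> kappa.
have k0 : 0 < kappa by near: kappa; exact: nbhs_pinfty_gt.
have r0 : 0 < rate f kappa.
  near: kappa; exact: (cvgryPgt _).1 (classF_diverges Ff) 0.
have L1 : weighted a (fun s => `|(1 - s ^+ 2) ^+ j * (f (kappa * s) / f kappa) -
    (1 - s ^+ 2) ^+ j * expR ((s - 1) * rate f kappa)|) <=
    eps * rate f kappa `^ (- (a + j%:R + 1)).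
  by near: kappa; exact: classF_ratio_laplace.
pose g s := f (kappa * s) / f kappa.
pose e s := expR ((s - 1) * rate f kappa).
have g1 s : D s -> `|(1 - s ^+ 2) ^+ j * g s| <= 1.
  by move=> Ds; apply: (onemsqrXM_le1 (h := g)) => //; exact: classF_ratio01.
have e1 s : D s -> `|(1 - s ^+ 2) ^+ j * e s| <= 1.
  move=> Ds; apply: (onemsqrXM_le1 (h := e)) => //.
  by rewrite expR_ge0 (expR_laplace_le1 r0 Ds).
apply: le_trans L1; rewrite /angular_moment /beta_laplace -(@weightedB _ _ iw _ _ 1 1);
  [|exact: mXg|exact: mXe|exact: g1|exact: e1].
apply: (le_trans (le_normr_Rintegral _ _)) => //.
  apply: (@integrable_weightM _ _ iw _ 2).
    by apply: measurable_funB; [exact: mXg|exact: mXe].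
  by move=> s Ds; have := g1 s Ds; have := e1 s Ds => ? ?; apply: (le_trans (ler_normB _ _)); lra.
rewrite le_eqVlt; apply/orP; left; apply/eqP.
by apply: eq_Rintegral => s _; rewrite normrM (ger0_norm (powR_ge0 _ _)).
Unshelve. all: by end_near. Qed.

Definition angular_defect kappa : R :=
  weighted a (fun s => (1 - s) * (f (kappa * s) / f kappa)).

(* For the exponential angular function, integration by parts turns
   [int s (1 - s^2)^a e^((s-1)r)] into [r b_1 / (2(a+1))], which is equivalent to [b_0]. *)
Lemma classF_angular_defect eps : 0 < eps -> \forall kappa \near +oo,
  angular_defect kappa <= eps * angular_moment kappa 0.
Proof.
move=> eps0.
have [c c0 lb] := beta_laplace_lb iw.
have [K K0 ratio] := beta_laplace_ratio iw a1.
have a10 : 0 < a + 1 by rewrite -ltrBlDr sub0r.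
(* The bound [1/2] ensures [b_0 <= 2 I_0]. With [eps / 8], twice the distance costs [eps / 4] of
   [b_0], and [rK] makes the exponential part cost another [eps / 4]; in total [eps / 2] of [b_0],
   hence [eps] of [I_0]. *)
pose dl := Num.min 2^-1 (eps / 8).
have dl0 : 0 < dl by rewrite lt_min invr_gt0 ltr0n divr_gt0.
have [dl1 dl2] : dl <= 2^-1 /\ dl <= eps / 8 by rewrite !ge_min !lexx orbT.
have cd0 : 0 < c * dl by rewrite mulr_gt0.
near=> kappa.
have k0 : 0 < kappa by near: kappa; exact: nbhs_pinfty_gt.
have r1 : 1 <= rate f kappa.
  by near: kappa; exact: (cvgryPge _).1 (classF_diverges Ff) 1.
have rK : 4 * (K / (2 * (a + 1))) / eps <= rate f kappa.
  by near: kappa; exact: (cvgryPge _).1 (classF_diverges Ff) _.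
have L1 : weighted a (fun s => `|(1 - s ^+ 2) ^+ 0 * (f (kappa * s) / f kappa) -
    (1 - s ^+ 2) ^+ 0 * expR ((s - 1) * rate f kappa)|) <=
    c * dl * rate f kappa `^ (- (a + 0%:R + 1)).
  by near: kappa; exact: (classF_ratio_laplace 0 cd0).
have E0 : `|angular_moment kappa 0 - beta_laplace a (rate f kappa) 0| <=
    c * dl * rate f kappa `^ (- (a + 0%:R + 1)).
  by near: kappa; exact: (classF_angular_moment 0 cd0).
have r0 : 0 < rate f kappa by exact: lt_le_trans r1.
have lbr : c * dl * rate f kappa `^ (- (a + 0%:R + 1)) <= dl * beta_laplace a (rate f kappa) 0.
  by rewrite addr0 [c * dl]mulrC -mulrA ler_wpM2l ?(ltW dl0)//; exact: lb.
have {}L1 := le_trans L1 lbr; have {lbr}E0 := le_trans E0 lbr.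
have b0 := beta_laplace_gt0 iw r1.
have h3 := ratio _ r1.
pose g s := f (kappa * s) / f kappa.
pose e s := expR ((s - 1) * rate f kappa).
have s1 s : D s -> `|s| <= 1.
  by rewrite /= in_itv/= ler_norml => /andP[/ltW -> /ltW ->].
have g1 s : D s -> 0 <= g s <= 1 by exact: classF_ratio01.
have e1 s : D s -> 0 <= e s <= 1.
  by move=> Ds; rewrite expR_ge0 (expR_laplace_le1 r0 Ds).
have mg : measurable_fun setT g by exact: measurable_classF_ratio.
have me : measurable_fun setT e by exact: measurable_expR_laplace.
have mD0 : measurable_fun setT (fun s =>
    `|(1 - s ^+ 2) ^+ 0 * g s - (1 - s ^+ 2) ^+ 0 * e s|).
  apply: measurableT_comp => //.
  by apply: measurable_funB; [exact: mXg|exact: mXe].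
have bD s : D s -> `| `|(1 - s ^+ 2) ^+ 0 * g s - (1 - s ^+ 2) ^+ 0 * e s| | <= 1.
  move=> Ds; have /andP[g0 g01] := g1 s Ds; have /andP[e0 e01] := e1 s Ds.
  rewrite normr_id expr0 !mul1r; move: (g s) (e s) g0 g01 e0 e01 => x y x0 x1 y0 y1.
  by rewrite ler_norml; apply/andP; split; lra.
have b2D s : D s -> `|2 * `|(1 - s ^+ 2) ^+ 0 * g s - (1 - s ^+ 2) ^+ 0 * e s| | <= 2.
  by move=> Ds; rewrite normrM (ger0_norm (ler0n _ 2)) -[leRHS]mulr1 ler_wpM2l// (bD s Ds).
have be s : D s -> `|e s| <= 1.
  by move=> Ds; have /andP[e0 e01] := e1 s Ds; rewrite ger0_norm.
have bse s : D s -> `|s * ((1 - s ^+ 2) ^+ 0 * e s)| <= 1.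
  by move=> Ds; rewrite expr0 mul1r normrM mulr_ile1 ?(s1 s Ds) ?(be s Ds).
have mse : measurable_fun setT (fun s => s * ((1 - s ^+ 2) ^+ 0 * e s)).
  by apply: measurable_funM => //; exact: mXe.
have bese s : D s -> `|e s - s * ((1 - s ^+ 2) ^+ 0 * e s)| <= 2.
  by move=> Ds; rewrite (le_trans (ler_normB _ _))// (_ : 2 = 1 + 1)// lerD ?(be s Ds) ?(bse s Ds).
have mese : measurable_fun setT (fun s => e s - s * ((1 - s ^+ 2) ^+ 0 * e s)).
  exact: measurable_funB.
(* As [0 <= 1 - s <= 2], passing from [g] to [e] costs at most twice the weighted distance between
   them. *)
have le1 : weighted a (fun s => (1 - s) * g s) <=
    weighted a (fun s => e s - s * ((1 - s ^+ 2) ^+ 0 * e s)) +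
    weighted a (fun s => 2 * `|(1 - s ^+ 2) ^+ 0 * g s - (1 - s ^+ 2) ^+ 0 * e s|).
  rewrite -(@weightedD _ _ iw _ _ 2 2)//; last by apply: measurable_funM.
  apply: (@weighted_le _ _ iw _ _ 2 4).
  - by apply: measurable_funM => //; exact: measurable_funB.
  - by apply: measurable_funD => //; exact: measurable_funM.
  - move=> s Ds; have /andP[g0 g01] := g1 s Ds; have := s1 s Ds.
    rewrite ler_norml ler_norml => /andP[l1 l2].
    by apply/andP; split; nra.
  - by move=> s Ds; rewrite (le_trans (ler_normD _ _))// (_ : 4 = 2 + 2) ?lerD ?(bese s Ds) ?(b2D s Ds)//; ring.
  - move=> s Ds; rewrite expr0 !mul1r; have := s1 s Ds.
    rewrite ler_norml => /andP[l1 l2].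
    have := ler_norm (g s - e s); have := normr_ge0 (g s - e s); nra.
have V0 : rate f kappa * beta_laplace a (rate f kappa) 1 =
    2 * (a + 1) * weighted a (fun s => s * ((1 - s ^+ 2) ^+ 0 * e s)).
  exact: beta_laplace_by_parts.
have wB : weighted a (fun s => e s - s * ((1 - s ^+ 2) ^+ 0 * e s)) =
    beta_laplace a (rate f kappa) 0 - weighted a (fun s => s * ((1 - s ^+ 2) ^+ 0 * e s)).
  rewrite (@weightedB _ _ iw _ _ 1 1)//; congr (_ - _).
  by apply: eq_weighted => s _; rewrite expr0 mul1r.
rewrite /angular_defect (le_trans le1)// wB (@weightedZ _ _ iw _ _ 1)//.
move: L1 E0 h3 b0 V0; rewrite -/g -/e.
set V := weighted a (fun s => s * _); set L := weighted a _.
set b := beta_laplace a _ 0; set b1 := beta_laplace _ _ _; set I := angular_moment _ _.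
move=> L1 E0 h3 b0 V0.
have KK : K / rate f kappa <= 2 * (a + 1) * (eps / 4).
  rewrite ler_pdivrMr//; move: rK; rewrite ler_pdivrMr// => rK.
  have a20 : 0 < 2 * (a + 1) by rewrite mulr_gt0.
  have := ler_wpM2l (ltW a20) rK; rewrite (_ : 2 * (a + 1) * (4 * _) = 4 * K).
    by move=> h; lra.
  by field; rewrite gt_eqF.
have Vb : b - V <= eps / 4 * b.
  have a20 : 0 < 2 * (a + 1) by rewrite mulr_gt0.
  have := le_trans h3 (ler_wpM2r (ltW b0) KK); rewrite V0 distrC -mulrBr normrM.
  rewrite (gtr0_norm a20) => h.
  by rewrite (le_trans (ler_norm _))// -(ler_pM2l a20) [leRHS]mulrA.
have := le_trans (ler_wpM2l (ler0n R 2) L1) (ler_wpM2l (ler0n R 2) (ler_wpM2r (ltW b0) dl2)).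
have bI : b <= 2 * I.
  by move: E0; rewrite ler_norml => /andP[h0 _]; nra.
have := ler_wpM2l (ltW eps0) bI; lra.
Unshelve. all: by end_near. Qed.

Lemma classF_angular_moments : exists C, forall eps, 0 < eps ->
  \forall kappa \near +oo,
  [/\ 0 < angular_moment kappa 0,
      `|rate f kappa * angular_moment kappa 1 - 2 * (a + 1) * angular_moment kappa 0| <=
        eps * angular_moment kappa 0 &
      rate f kappa ^+ 2 * angular_moment kappa 2 <= C * angular_moment kappa 0].
Proof.
have [c c0 lb] := beta_laplace_lb iw.
have [K K0 ratio] := beta_laplace_ratio iw a1.
have a10 : 0 < a + 1 by rewrite -ltrBlDr sub0r.
(* Product of the factors of [beta_laplace_step] for [j = 1] and [j = 0]. In [2 * (L + 1)], the 1
   absorbs the error of condition (iv) and the 2 converts [b_0] into [I_0]; the choice is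
   independent of [eps]. *)
pose L := 2 * (a + 2) * (2 * (a + 1)).
exists (2 * (L + 1)) => eps eps0.
(* Collects the two approximation errors, of weight 1 for the moment of order 1 and [2 (a + 1)] for
   that of order 0. *)
pose M := 2 * (a + 1) + 1.
have M0 : 0 < M by rewrite addr_gt0// mulr_gt0.
pose dl := Num.min 2^-1 (eps / (4 * M)).
have dl0 : 0 < dl by rewrite lt_min invr_gt0 ltr0n divr_gt0// mulr_gt0.
have [dl1 dl2] : dl <= 2^-1 /\ dl <= eps / (4 * M) by rewrite !ge_min !lexx orbT.
have cd0 : 0 < c * dl by rewrite mulr_gt0.
near=> kappa.
have r1 : 1 <= rate f kappa.
  by near: kappa; exact: (cvgryPge _).1 (classF_diverges Ff) 1.
have rK : 4 * K / eps <= rate f kappa.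
  by near: kappa; exact: (cvgryPge _).1 (classF_diverges Ff) _.
have E0 : `|angular_moment kappa 0 - beta_laplace a (rate f kappa) 0| <=
    c * dl * rate f kappa `^ (- (a + 0%:R + 1)).
  by near: kappa; exact: (classF_angular_moment 0 cd0).
have E1 : `|angular_moment kappa 1 - beta_laplace a (rate f kappa) 1| <=
    c * dl * rate f kappa `^ (- (a + 1%:R + 1)).
  by near: kappa; exact: (classF_angular_moment 1 cd0).
have E2 : `|angular_moment kappa 2 - beta_laplace a (rate f kappa) 2| <=
    c * dl * rate f kappa `^ (- (a + 2%:R + 1)).
  by near: kappa; exact: (classF_angular_moment 2 cd0).
move: E0 E1 E2 r1 rK; set r := rate f kappa; set I := angular_moment kappa.
move=> E0 E1 E2 r1 rK.
have r0 : 0 < r by exact: lt_le_trans r1.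
set b := beta_laplace a r.
have b0 : 0 < b 0%N by exact: beta_laplace_gt0.
have appr j : `|I j - b j| <= c * dl * r `^ (- (a + j%:R + 1)) ->
    `|I j - b j| <= dl * (b 0%N) / r ^+ j.
  move=> /le_trans; apply.
  have -> : - (a + j%:R + 1) = - (a + 1) + - j%:R by ring.
  rewrite powRD; last by rewrite (lt0r_neq0 r0) implybT.
  rewrite powR_invn ?(ltW r0)// mulrA ler_wpM2r ?invr_ge0 ?exprn_ge0 ?(ltW r0)//.
  rewrite [c * dl]mulrC -mulrA ler_wpM2l ?(ltW dl0)//; exact: lb.
have h0 : `|I 0%N - b 0%N| <= dl * b 0%N.
  by have := appr 0 E0; rewrite expr0 divr1.
have h1 : `|I 1%N - b 1%N| <= dl * b 0%N / r.
  by have := appr 1 E1; rewrite expr1.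
have h2 : `|I 2%N - b 2%N| <= dl * b 0%N / r ^+ 2 by exact: appr.
have bI : b 0%N <= 2 * I 0%N.
  move: h0; rewrite ler_norml => /andP[h0 _]; nra.
have I0 : 0 < I 0%N by lra.
split=> //.
- have h1' : `|r * I 1%N - r * b 1%N| <= dl * b 0%N.
    rewrite -mulrBr normrM (gtr0_norm r0).
    by rewrite (le_trans (ler_wpM2l (ltW r0) h1))// mulrC divfK// lt0r_neq0.
  have h3 := ratio r r1.
  have h3' : `|r * b 1%N - 2 * (a + 1) * b 0%N| <= eps / 4 * b 0%N.
    rewrite (le_trans h3)// ler_wpM2r ?(ltW b0)// ler_pdivrMr//.
    by move: rK; rewrite ler_pdivrMr// => rK; lra.
  have -> : r * I 1%N - 2 * (a + 1) * I 0%N = (r * I 1%N - r * b 1%N) +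
      (r * b 1%N - 2 * (a + 1) * b 0%N) - 2 * (a + 1) * (I 0%N - b 0%N) by ring.
  rewrite (le_trans (ler_normB _ _))// (le_trans (lerD (ler_normD _ _) (lexx _)))//.
  rewrite [in X in _ + X <= _]normrM (gtr0_norm (mulr_gt0 (ltr0Sn _ 1) a10)).
  apply: (@le_trans _ _ (dl * b 0%N + eps / 4 * b 0%N + 2 * (a + 1) * (dl * b 0%N))).
    by rewrite lerD ?lerD ?ler_wpM2l// mulr_ge0// ltW.
  have -> : dl * b 0%N + eps / 4 * b 0%N + 2 * (a + 1) * (dl * b 0%N) =
      (M * dl + eps / 4) * b 0%N by rewrite /M; ring.
  have Md : M * dl <= eps / 4.
    rewrite mulrC -ler_pdivlMr// (le_trans dl2)// invfM mulrA.
    by rewrite lexx.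
  apply: (@le_trans _ _ (eps / 2 * b 0%N)); first by rewrite ler_wpM2r ?(ltW b0)//; lra.
  by have := ler_wpM2l (ltW eps0) bI; lra.
- have h2' : r ^+ 2 * I 2%N <= r ^+ 2 * b 2%N + dl * b 0%N.
    have r20 : 0 < r ^+ 2 by rewrite exprn_gt0.
    move: h2; rewrite ler_norml => /andP[_ h2].
    have := ler_wpM2l (ltW r20) h2; rewrite [leRHS]mulrC divfK ?lt0r_neq0//; lra.
  have s1 := beta_laplace_step iw a1 0 r1; have s2 := beta_laplace_step iw a1 1 r1.
  rewrite -/b in s1 s2.
  have s3 : r ^+ 2 * b 2%N <= L * b 0%N.
    rewrite expr2 -mulrA; apply: le_trans (ler_wpM2l (ltW r0) s2) _.
    rewrite mulrCA /L -mulrA ler_wpM2l// mulr_ge0//.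
    by have := ltW a10; lra.
  have a20 : 0 <= a + 2 by lra.
  have L0 : 0 <= L by rewrite /L mulr_ge0 // mulr_ge0 // ltW.
  nra.
Unshelve. all: by end_near. Qed.

End classF_concentration.

(** * The law of one observation *)

Lemma integral_probability_cst d (T : measurableType d) (R : realType)
  (P : probability T R) (r : R) : (\int[P]_x r%:E = r%:E)%E.
Proof. by rewrite integral_cst// [X in (_ * X)%E]probability_setT mule1. Qed.

Section tangent.
Context {R : realType} {n : nat}.
Variable theta : 'cV[R]_n.
Hypothesis theta1 : sphere theta.
Implicit Types x v w : 'cV[R]_n.

Definition tangent x := x - dot x theta *: theta.

Lemma dot_tangent_theta x : dot (tangent x) theta = 0.
Proof. by rewrite /tangent dotDl dotNl dotZl (spherexx theta1) mulr1 subrr. Qed.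

Lemma dot_tangent_tangent x v : dot (tangent x) (tangent v) = dot (tangent x) v.
Proof. by rewrite {2}/tangent dotDr dotNr dotZr dot_tangent_theta mulr0 subr0. Qed.

Lemma dot_tangentxx x : dot (tangent x) (tangent x) = dot x x - dot x theta ^+ 2.
Proof.
rewrite dot_tangent_tangent /tangent dotDl dotNl dotZl (dotC theta x).
by rewrite expr2.
Qed.

Lemma dot_tangent x v : dot v theta = 0 -> dot (tangent x) v = dot x v.
Proof.
by move=> v0; rewrite /tangent dotDl dotNl dotZl (dotC theta v) v0 mulr0 subr0.
Qed.

Lemma measurable_tangent : measurable_fun setT tangent.
Proof.
apply: measurable_cVP => i; rewrite /tangent; under eq_fun do rewrite !mxE.
apply: measurable_funB; first exact: measurable_coord.
by apply: measurable_funM => //; exact: measurable_dotr.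
Qed.

Lemma dot_delta x i : dot x (delta_mx i 0) = x i 0.
Proof.
rewrite dotE (bigD1 i)//= big1 ?addr0 ?mxE ?eqxx ?mulr1// => j ji.
by rewrite mxE (negbTE ji) mulr0.
Qed.

(** The trace of the projection orthogonal to [theta], computed on the canonical basis. *)
Lemma sum_tangent_delta : \sum_i dot (tangent (delta_mx i 0)) (tangent (delta_mx i 0))
  = n%:R - 1.
Proof.
under eq_bigr do rewrite dot_tangentxx dot_delta dotC dot_delta mxE !eqxx expr2.
rewrite sumrB sumr_const card_ord -dotE spherexx//.
Qed.

Lemma cauchy_schwarz x v : dot x v ^+ 2 <= dot x x * dot v v.
Proof.
have [->|v0] := eqVneq v 0; first by rewrite !dot0r expr0n mulr0.
have vv : 0 < dot v v by rewrite lt0r dotxx_eq0 v0 dotxx_ge0.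
rewrite -subr_ge0 -(pmulr_rge0 _ vv).
have := dotxx_ge0 (dot v v *: x - dot x v *: v).
rewrite !(dotDl, dotDr, dotNl, dotNr, dotZl, dotZr) (dotC v x).
by congr (0 <= _); ring.
Qed.

End tangent.

(** * Moments of one observation *)

Section observation.
Context {R : realType} {q : nat}.
Variables (theta : 'cV[R]_q.+1) (kappa : R) (f : R -> R).
Variable nu : probability 'cV[R]_q.+1 R.
Hypotheses (q0 : (0 < q)%N) (theta1 : sphere theta) (k0 : 0 < kappa) (Ff : classF f).
Hypothesis nuE : forall A, measurable A ->
  (nu A = \int[@surface_measure R q.+1]_(x in A) (density theta kappa f x)%:E)%E.
Local Notation sigma := (@surface_measure R q.+1).
Local Notation leb := (prod_measure q.+1 (fun=> @lebesgue_measure R)).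
Local Notation mu := (@lebesgue_measure R).
Local Notation a := ((q.+1%:R - 3) / 2 : R).
Local Notation D := (`](-1)%R, 1%R[%classic : set R).

Let c := cst_c q.+1 kappa f * Gamma ((q.+1%:R - 1) / 2) /
  (2 * pi `^ ((q.+1%:R - 1) / 2)).

Let densE x : density theta kappa f x = c * f (kappa * dot x theta).
Proof. by []. Qed.

Let mf : measurable_fun setT (fun s : R => f (kappa * s)).
Proof.
apply: measurableT_comp (classF_measurable Ff) _.
exact: measurable_funM.
Qed.

Let mfx : measurable_fun setT (fun x : 'cV[R]_q.+1 => f (kappa * dot x theta)).
Proof. by apply: measurableT_comp mf _; exact: measurable_dotr. Qed.

(** Read off from the total mass: a nonpositive constant would give the probability [nu] a
    nonpositive mass. Neither Gamma nor [cst_c] has to be examined. *)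
Let c_gt0 : 0 < c.
Proof.
rewrite ltNge; apply/negP => c0.
have g0 x : 0 <= - density theta kappa f x.
  by rewrite densE oppr_ge0 mulr_le0_ge0// (classF_ge0 Ff).
have : (\int[sigma]_x (density theta kappa f x)%:E <= 0)%E.
  rewrite (eq_integral (fun x => - (- density theta kappa f x)%:E)%E); last first.
    by move=> x _; rewrite -EFinN opprK.
  rewrite (@integral_ge0N _ _ _ _ _ (fun x => (- density theta kappa f x)%:E)); last first.
    by move=> x _; rewrite lee_fin.
  by rewrite leeNl oppe0; apply: integral_ge0 => x _; rewrite lee_fin.
rewrite -(nuE measurableT) probability_setT.
by rewrite leNgt lte_fin ltr01.
Qed.

Let density_ge0 x : 0 <= density theta kappa f x.
Proof. by rewrite densE mulr_ge0 ?(ltW c_gt0) ?(classF_ge0 Ff). Qed.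

Lemma ge0_integral_observation (h : 'cV[R]_q.+1 -> \bar R) :
  measurable_fun setT h -> (forall x, 0 <= h x)%E ->
  (\int[nu]_x h x = \int[sigma]_x ((density theta kappa f x)%:E * h x))%E.
Proof.
move=> mh h0; apply: (@ge0_integral_density_map _ _ _ _ _ _ _ id) => //.
- exact: measurable_funM.
move=> A mA; rewrite [LHS](nuE mA) [LHS]integral_mkcond; apply: eq_integral => x _.
by rewrite patchE indicE; case: ifPn => _; rewrite ?mulr1 ?mulr0.
Qed.

Lemma integral_observation_isometry T (h : 'cV[R]_q.+1 -> \bar R) :
  isometric_involution T -> T theta = theta -> measurable_fun setT h ->
  (\int[nu]_x h (T x) = \int[nu]_x h x)%E.
Proof.
move=> iT Tt mh.
have ge0 (g : 'cV[R]_q.+1 -> \bar R) : measurable_fun setT g ->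
    (forall x, 0 <= g x)%E -> (\int[nu]_x g (T x) = \int[nu]_x g x)%E.
  move=> mg g0; rewrite !ge0_integral_observation//; last first.
    exact: measurableT_comp (isoT_measurable iT).
  rewrite -[RHS](ge0_integral_surface_isometry iT); first last.
  - by move=> x; rewrite mule_ge0// lee_fin densE mulr_ge0 ?(ltW c_gt0) ?(classF_ge0 Ff).
  - by apply: emeasurable_funM => //; apply/measurable_EFinP; exact: measurable_funM.
  apply: eq_integral => x _; congr (_%:E * _)%E.
  by rewrite !densE -[in RHS]Tt (isoT_dot iT).
rewrite integralE [RHS]integralE; congr (_ - _)%E.
  rewrite -(ge0 h^\+%E (measurable_funepos mh) (funepos_ge0 h)).
  by apply: eq_integral => x _; rewrite !funeposE.
rewrite -(ge0 h^\-%E (measurable_funeneg mh) (funeneg_ge0 h)).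
by apply: eq_integral => x _; rewrite !funenegE.
Qed.

Let mS : measurable (~` @sphere R q.+1).
Proof. by apply: measurableC; exact: measurable_sphere. Qed.

Lemma observation_sphere : nu (~` @sphere R q.+1) = 0%E.
Proof.
rewrite (nuE mS); apply: null_set_integral => //.
- by apply: measurable_funTS; apply/measurable_EFinP; exact: measurable_funM.
- exact: surface_sphere.
Qed.

Lemma observation_ae (Q : 'cV[R]_q.+1 -> Prop) :
  (forall x, sphere x -> Q x) -> {ae nu, forall x, Q x}.
Proof.
move=> sQ; exists (~` @sphere R q.+1); split => //; first exact: observation_sphere.
by move=> x /= nQ /sQ.
Qed.

Let zonal (G : R -> R) : measurable_fun setT G -> (forall s, 0 <= G s) ->
  (\int[nu]_x (G (dot x theta))%:E =
   c%:E * (q.+1%:R%:E * zonal_const q) *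
   \int[mu]_(s in D) ((1 - s ^+ 2) `^ a * (f (kappa * s) * G s))%:E)%E.
Proof.
move=> mG G0; rewrite ge0_integral_observation; first last.
- by move=> x; rewrite lee_fin.
- by apply/measurable_EFinP; apply: measurableT_comp mG _; exact: measurable_dotr.
pose H s := (f (kappa * s) * G s)%:E.
have H0 s : (0 <= H s)%E by rewrite lee_fin mulr_ge0 ?(classF_ge0 Ff).
have mH : measurable_fun setT H by apply/measurable_EFinP; exact: measurable_funM.
transitivity (\int[sigma]_x (c%:E * H (dot x theta)))%E.
  by apply: eq_integral => x _; rewrite /H -!EFinM densE mulrA.
rewrite ge0_integralZl_EFin//; first last.
- exact: ltW c_gt0.
- by apply: measurableT_comp mH _; exact: measurable_dotr.
rewrite (ge0_integral_surface_zonal_beta q0 theta1 mH H0) muleA.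
by congr (_ * _)%E; apply: eq_integral => s _; rewrite /H -EFinM mulrC.
Qed.

Let zonal_const_gt0 : (0 < @zonal_const R q)%E.
Proof.
rewrite lt0e zonal_const_ge0 andbT; apply/eqP => z0.
have := zonal (@measurable_cst _ _ _ _ setT (1 : R)) (fun=> ler01).
under eq_integral do rewrite /cst.
rewrite integral_probability_cst z0 mule0 mule0 mul0e => /eqP.
by rewrite eqe oner_eq0.
Qed.

(** The punctured unit ball has finite measure because [exp (1 - |x|^2)] dominates its indicator. *)
Let surface_fin : (sigma setT < +oo)%E.
Proof.
rewrite /surface_measure; apply: lte_mul_pinfty => //; rewrite ?lee_fin//.
rewrite (_ : [set x | _] = @punctured_ball R q.+1); last first.
  by apply/seteqP; split=> [x []|x].
have mB := @measurable_punctured_ball R q.+1.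
have E : (\int[leb]_(x in punctured_ball) 1%:E = leb (@punctured_ball R q.+1))%E.
  by rewrite (integral_cst _ mB) mul1e.
rewrite -[X in (X < _)%E]E.
apply: (@le_lt_trans _ _ (\int[leb]_x ((expR 1)%:E * (expR (- dot x x))%:E))%E).
  rewrite [leLHS]integral_mkcond; apply: ge0_le_integral => //.
  - by move=> x _; rewrite patchE; case: ifP.
  - apply/(measurable_restrictT _ mB); exact: measurable_cst.
  - by apply: measurable_funeM; exact: measurable_expN_dotxx.
  - move=> x _; rewrite patchE; case: ifPn => [|_]; last first.
      by rewrite -EFinM lee_fin mulr_ge0 ?expR_ge0.
    rewrite inE /punctured_ball/= => /andP[x0 x1].
    rewrite -EFinM lee_fin -expRD -[leLHS]expR0 ler_expR subr_ge0 -sqr_enorm.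
    by rewrite expr_le1 ?enorm_ge0.
rewrite ge0_integralZl_EFin ?expR_ge0//; last exact: measurable_expN_dotxx.
by rewrite integral_expN_dotxx -EFinM ltry.
Qed.

(** The finite area of the sphere is a positive multiple of the integral of the weight; no beta
    integral is computed. *)
Lemma integrable_beta_weight : mu.-integrable D (EFin \o (fun s : R => (1 - s ^+ 2) `^ a)).
Proof.
have mw : measurable_fun D (EFin \o (fun s : R => (1 - s ^+ 2) `^ a)).
  by apply: measurable_funTS; apply/measurable_EFinP; exact: measurable_weight.
apply/integrableP; split => //.
have := ge0_integral_surface_zonal_beta q0 theta1 (@measurable_cst _ _ _ _ setT (1%E : \bar R)) (fun=> lee01).
rewrite integral_cst// mul1e.
under eq_integral do rewrite mul1e.
move=> E; under eq_integral do rewrite /= ger0_norm ?powR_ge0//.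
rewrite ltey; apply/eqP => J; move: surface_fin.
by rewrite E J gt0_muley ?ltxx// mule_gt0.
Qed.

Let angular_moment0_ge0 : 0 <= angular_moment a f kappa 0.
Proof.
apply: weighted_ge0 => s Ds; rewrite expr0 mul1r.
by have /andP[] := classF_ratio01 Ff k0 Ds.
Qed.

Let ge0_integral_zonal : exists2 K : \bar R, (0 <= K)%E & forall (g : R -> R) M,
  measurable_fun setT g -> (forall s, 0 <= g s) -> (forall s, D s -> `|g s| <= M) ->
  (\int[nu]_x (g (dot x theta))%:E =
   K * (weighted a (fun s => g s * (f (kappa * s) / f kappa)))%:E)%E.
Proof.
have fk := classF_gt0 Ff k0.
exists (c%:E * (q.+1%:R%:E * zonal_const q) * (f kappa)%:E)%E.
  by rewrite !mule_ge0// ?lee_fin ?(ltW c_gt0) ?(ltW fk) ?zonal_const_ge0.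
move=> g M mg g0 gM; rewrite (zonal mg)// -[RHS]muleA; congr (_ * _)%E.
have mh : measurable_fun setT (fun s : R => g s * (f (kappa * s) / f kappa)).
  by apply: measurable_funM => //; exact: measurable_classF_ratio.
rewrite /weighted /Rintegral fineK; last first.
  have hM s : D s -> `|g s * (f (kappa * s) / f kappa)| <= M.
    move=> Ds; have /andP[r0 r1] := classF_ratio01 Ff k0 Ds.
    by rewrite normrM (ger0_norm r0) (le_trans _ (gM s Ds))// ler_piMr.
  apply: integrable_fin_num; first exact: measurable_itv.
  exact: (@integrable_weightM _ _ integrable_beta_weight _ _ mh hM).
rewrite -ge0_integralZl_EFin//; first last.
- exact: ltW.
- apply: measurable_funTS; apply/measurable_EFinP.
  by apply: measurable_funM => //; exact: measurable_weight.
- move=> s Ds; rewrite lee_fin mulr_ge0 ?powR_ge0// mulr_ge0//.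
  by have /andP[] := classF_ratio01 Ff k0 Ds.
apply: eq_integral => s _; rewrite -EFinM; congr _%:E.
by field; rewrite gt_eqF.
Qed.

Lemma angular_moment0_gt0 : 0 < angular_moment a f kappa 0.
Proof.
have [K K0 E] := ge0_integral_zonal.
have b1 s : D s -> `|1 : R| <= 1 by rewrite normr1.
have := E (fun=> 1) 1 (measurable_cst _) (fun=> ler01) b1.
rewrite integral_probability_cst => E1.
rewrite lt0r angular_moment0_ge0 andbT; apply/eqP => z.
have : weighted a (fun s => 1 * (f (kappa * s) / f kappa)) = 0.
  by rewrite -z; apply: eq_weighted => s _; rewrite expr0.
by move=> w0; move: E1; rewrite w0 mule0 => /eqP; rewrite eqe oner_eq0.
Qed.

(** The zonal formula applied to [g = 1] determines its own constant as the inverse of the moment of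
    order 0, so dividing by that case removes every normalization. *)
Lemma integral_zonal (g : R -> R) M : measurable_fun setT g -> (forall s, 0 <= g s) ->
  (forall s, D s -> `|g s| <= M) ->
  (\int[nu]_x (g (dot x theta))%:E = (weighted a (fun s => g s * (f (kappa * s) / f kappa)) /
    angular_moment a f kappa 0)%:E)%E.
Proof.
move=> mg g0 gM; have [K K0 E] := ge0_integral_zonal.
have I0 := angular_moment0_gt0.
have b1 s : D s -> `|1 : R| <= 1 by rewrite normr1.
have := E (fun=> 1) 1 (measurable_cst _) (fun=> ler01) b1.
rewrite integral_probability_cst (_ : weighted a _ = angular_moment a f kappa 0); last first.
  by apply: eq_weighted => s _; rewrite expr0.
(* The constant [K] is a priori extended; an infinite value would contradict total mass 1, the
   moment of order 0 being positive. *)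
rewrite (E _ _ mg g0 gM); case: K K0 {E} => [K K0|_|//]; last by rewrite gt0_mulye.
rewrite -!EFinM => -[E0]; congr _%:E.
by apply: (mulIf (lt0r_neq0 I0)); rewrite divfK ?lt0r_neq0// mulrAC -E0 mul1r.
Qed.

Lemma observation_angular_moment j :
  (\int[nu]_x (dot (tangent theta x) (tangent theta x) ^+ j)%:E =
   (angular_moment a f kappa j / angular_moment a f kappa 0)%:E)%E.
Proof.
(* The absolute value makes the function of the cosine nonnegative on the whole line, as
   [integral_zonal] requires; on the sphere it changes nothing. *)
have mG : measurable_fun setT (fun s : R => `|1 - s ^+ 2| ^+ j).
  apply: measurable_funX; apply: measurableT_comp => //.
  by apply: measurable_funB => //; exact: measurable_funX.
transitivity (\int[nu]_x (`|1 - dot x theta ^+ 2| ^+ j)%:E)%E.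
  apply: ge0_ae_eq_integral => //.
  - apply/measurable_EFinP/measurable_funX.
    exact: measurableT_comp (@measurable_dotxx R q.+1) (measurable_tangent theta).
  - by apply/measurable_EFinP; apply: measurableT_comp mG _; exact: measurable_dotr.
  - by move=> x _; rewrite lee_fin exprn_ge0// dotxx_ge0.
  apply: observation_ae => x sx _; congr (_ ^+ _)%:E.
  have := dotxx_ge0 (tangent theta x); rewrite (dot_tangentxx theta1) (spherexx sx).
  by move=> /ger0_norm ->.
have D1 s : D s -> 0 <= 1 - s ^+ 2 <= 1.
  by rewrite /= in_itv/= => /andP[s1 s2]; apply/andP; split; nra.
rewrite (@integral_zonal _ 1 mG) => [|s|s Ds].
- congr (_ / _)%:E; apply: eq_weighted => s Ds; congr (_ ^+ _ * _).
  by have /andP[w0 _] := D1 s Ds; rewrite ger0_norm.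
- by rewrite exprn_ge0.
- have /andP[w0 w1] := D1 s Ds.
  by rewrite normrX normr_id ger0_norm// exprn_ile1.
Qed.

Lemma observation_angular_defect :
  (\int[nu]_x `|1 - dot x theta|%:E =
   (angular_defect a f kappa / angular_moment a f kappa 0)%:E)%E.
Proof.
have mG : measurable_fun setT (fun s : R => `|1 - s|).
  by apply: measurableT_comp => //; exact: measurable_funB.
rewrite (@integral_zonal _ 2 mG) => [|s|s].
- congr (_ / _)%:E; apply: eq_weighted => s.
  by rewrite /= in_itv/= => /andP[s1 s2]; rewrite ger0_norm//; lra.
- exact: normr_ge0.
- rewrite /= in_itv/= => /andP[s1 s2]; rewrite normr_id ler_norml; apply/andP; split; lra.
Qed.

Lemma observation_integrable (h : 'cV[R]_q.+1 -> R) M : measurable_fun setT h ->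
  (forall x, sphere x -> `|h x| <= M) -> nu.-integrable setT (EFin \o h).
Proof.
move=> mh hM; apply/integrableP; split; first exact/measurable_EFinP.
apply: (@le_lt_trans _ _ (\int[nu]_x (`|M|%:E))%E).
  apply: ae_ge0_le_integral => //.
  - by apply/measurableT_comp => //; exact/measurable_EFinP.
  - by apply: observation_ae => x sx _ /=; rewrite lee_fin (le_trans (hM x sx)) ?ler_norm.
by rewrite integral_probability_cst ltry.
Qed.

Let tangent_le1 x : sphere x -> dot (tangent theta x) (tangent theta x) <= 1.
Proof. by move=> sx; rewrite (dot_tangentxx theta1) (spherexx sx) gerBl sqr_ge0. Qed.

Let mt v : measurable_fun setT (fun x => dot (tangent theta x) v).
Proof. exact: measurableT_comp (measurable_dotr v) (measurable_tangent theta). Qed.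

Let dot_tangent_sqr_le x v : sphere x -> dot (tangent theta x) v ^+ 2 <= dot v v.
Proof.
move=> sx; rewrite (le_trans (cauchy_schwarz _ _))//.
by rewrite ler_piMl ?dotxx_ge0 ?tangent_le1.
Qed.

Lemma observation_tangent_integrable v :
  nu.-integrable setT (EFin \o (fun x => dot (tangent theta x) v)).
Proof.
apply: (@observation_integrable _ (1 + dot v v) (mt v)) => x sx.
have := @dot_tangent_sqr_le _ v sx; have := dotxx_ge0 v.
move: (dot _ v) (dot v v) => b e; rewrite ler_norml => e0 be; apply/andP; split; nra.
Qed.

Lemma observation_tangent_sqr_integrable v :
  nu.-integrable setT (EFin \o (fun x => dot (tangent theta x) v ^+ 2)).
Proof.
apply: (@observation_integrable _ (dot v v) (measurable_funX 2 (mt v))) => x sx.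
by rewrite ger0_norm ?sqr_ge0// dot_tangent_sqr_le.
Qed.

Lemma observation_tangent_mean v : \int[nu]_x dot (tangent theta x) v = 0.
Proof.
(* The opposite of the reflection along [theta] fixes [theta] and reverses its orthogonal
   complement, so the tangent mean equals its own opposite. *)
pose T x : 'cV[R]_q.+1 := - reflection theta x.
have iT : isometric_involution T.
  by apply: isometric_involutionN; exact: isometric_involution_reflection.
have Tt : T theta = theta.
  rewrite /T /reflection (spherexx theta1) mulr1 divr1 opprB -{2}[theta]scale1r.
  by rewrite -scalerBl (_ : 2 - 1 = 1) ?scale1r//; ring.
have E x : dot (tangent theta (T x)) v = - dot (tangent theta x) v.
  rewrite -dotNl; congr (dot _ v).
  have Dx : dot (T x) theta = dot x theta by rewrite -{1}Tt (isoT_dot iT).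
  rewrite /tangent Dx /T /reflection (spherexx theta1) divr1.
  by apply/matrixP => i j; rewrite !mxE; ring.
set I := LHS; suff : I = - I by move=> /eqP; rewrite -addr_eq0 -mulr2n mulrn_eq0/= => /eqP.
rewrite {2}/I -mulN1r -RintegralZl//; last exact: observation_tangent_integrable.
rewrite /I /Rintegral -(integral_observation_isometry iT Tt (h := fun x => (dot (tangent theta x) v)%:E)).
  by congr fine; apply: eq_integral => x _; rewrite E mulN1r.
exact/measurable_EFinP.
Qed.

(** Isotropy: two vectors orthogonal to [theta] and of equal length are exchanged by a reflection
    fixing [theta], so the variance along [v] is a constant times [|v|^2]. Summing over the
    projected canonical basis identifies the constant, the trace being [q]. *)
Lemma observation_tangent_variance v : dot v theta = 0 ->
  \int[nu]_x (dot (tangent theta x) v ^+ 2) =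
  dot v v * (\int[nu]_x dot (tangent theta x) (tangent theta x) / q%:R).
Proof.
pose V v := \int[nu]_x (dot (tangent theta x) v ^+ 2).
have VZ b u : V (b *: u) = b ^+ 2 * V u.
  rewrite /V -RintegralZl//; last exact: observation_tangent_sqr_integrable.
  by apply: eq_Rintegral => x _; rewrite dotZr exprMn.
have Veq u w : dot u theta = 0 -> dot w theta = 0 -> dot u u = dot w w -> V u = V w.
  move=> u0 w0 uw.
  have iT := isometric_involution_reflection (u - w).
  have Tt : reflection (u - w) theta = theta.
    by apply: reflection_orthogonal; rewrite dotDr dotNr !(dotC theta) u0 w0 subrr.
  rewrite /V /Rintegral -[X in _ = fine X](integral_observation_isometry iT Tt); last first.
    by apply/measurable_EFinP; exact: measurable_funX 2 (mt w).
  congr fine; apply: eq_integral => x _; congr (_ ^+ _)%:E.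
  rewrite !dot_tangent// -{2}(reflection_swap uw).
  by rewrite (isoT_dot iT).
(* The cross-multiplied form avoids normalizing, since a projected basis vector may vanish. *)
have Vr u w : dot u theta = 0 -> dot w theta = 0 -> dot w w * V u = dot u u * V w.
  move=> u0 w0; rewrite -!sqr_enorm -!VZ; apply: Veq.
  - by rewrite dotZl u0 mulr0.
  - by rewrite dotZl w0 mulr0.
  - by rewrite !dotZl !dotZr !mulrA -!expr2 !sqr_enorm mulrC.
move=> v0; pose w i := tangent theta (delta_mx i 0).
have w0 i : dot (w i) theta = 0 by exact: dot_tangent_theta.
have wE i x : dot (tangent theta x) (w i) = tangent theta x i 0.
  by rewrite dotC dot_tangent ?dot_tangent_theta// dotC dot_delta.
have SE : \sum_i V (w i) = \int[nu]_x dot (tangent theta x) (tangent theta x).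
  rewrite /V; under [RHS]eq_Rintegral do rewrite dotE.
  rewrite /Rintegral; under [X in _ = fine X]eq_integral do rewrite -sumEFin.
  have iX i : nu.-integrable setT (fun x => (tangent theta x i 0 * tangent theta x i 0)%:E).
    have := observation_tangent_sqr_integrable (w i).
    apply: eq_integrable => // x _ /=; congr _%:E.
    by rewrite wE expr2.
  rewrite integral_sum//.
  rewrite -sum_fine; last by move=> i _; apply: integrable_fin_num.
  apply: eq_bigr => i _; congr fine; apply: eq_integral => x _; congr _%:E.
  by rewrite wE expr2.
rewrite -SE mulrA mulr_sumr.
rewrite (eq_bigr (fun i => dot (w i) (w i) * V v)); last by move=> i _; rewrite Vr.
rewrite -mulr_suml sum_tangent_delta// mulrAC.
have -> : q.+1%:R - 1 = q%:R :> R by rewrite -addn1 natrD addrK.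
rewrite divff ?mul1r//.
by rewrite pnatr_eq0 -lt0n.
Qed.

End observation.

(** * Sums of independent vectors *)

Section rectangles.
Context {d1 d2 : measure_display} {T1 : measurableType d1} {T2 : measurableType d2}
  {R : realType}.
Local Open Scope ereal_scope.

Lemma scaled_product_measure_unique (m1 : probability T1 R) (m2 : probability T2 R)
    (c : R) (m' : {measure set (T1 * T2) -> \bar R}) : (0 <= c)%R ->
  (forall A B, measurable A -> measurable B ->
    m' (A `*` B) = c%:E * (m1 A * m2 B)) ->
  forall X, measurable X -> m' X = c%:E * (m1 \x m2) X.
Proof.
move=> c0 m'E X mX; have [z|cn0] := eqVneq c 0%R.
  rewrite z mul0e; apply/eqP; rewrite eq_le measure_ge0 andbT.
  rewrite (_ : 0 = m' setT); first by apply: le_measure; rewrite ?inE.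
  by rewrite -setXTT m'E// z mul0e.
have ci0 : (0 <= c^-1)%R by rewrite invr_ge0.
pose r := NngNum ci0.
rewrite (@product_measure_unique _ _ _ _ _ m1 m2 (mscale r m'))//.
  by rewrite /mscale/= muleA -EFinM divff// mul1e.
move=> A B mA mB; transitivity (c^-1%:E * m' (A `*` B)) => //.
rewrite (m'E _ _ mA mB).
by rewrite muleA -EFinM mulVf// mul1e.
Qed.

End rectangles.

Section chain.
Context {R : realType} {p n : nat} {d dV : measure_display}
  {Omega : measurableType d} {V : measurableType dV}.
Variables (P : probability Omega R) (X : 'I_n -> {RV P >-> 'cV[R]_p}).
Hypothesis indX : mutually_independent X.
Variables (S : nat -> Omega -> V) (s0 : V) (step : V * 'cV[R]_p -> V).
Hypotheses (S0 : S 0%N = cst s0) (mstep : measurable_fun setT step).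
Hypothesis SS : forall k : 'I_n, S k.+1 = fun w => step (S k w, X k w).
Local Open Scope ereal_scope.

Lemma measurable_chain k : (k <= n)%N -> measurable_fun setT (S k).
Proof.
elim: k => [_|k IH kn]; first by rewrite S0.
rewrite (SS (Ordinal kn)); apply: measurableT_comp mstep _.
by apply/measurable_fun_pairP; split; [exact: IH (ltnW kn)|exact: measurable_funPT].
Qed.

Let tail k (A : 'I_n -> set 'cV[R]_p) :=
  \bigcap_(i in [set i : 'I_n | (k <= i)%N]) X i @^-1` A i.

Let mX (i : 'I_n) (A : set 'cV[R]_p) : measurable A -> measurable (X i @^-1` A).
Proof. by move=> mA; rewrite -[_ @^-1` _]setTI; exact: (measurable_funPT (X i)). Qed.

Let mtail k A : (forall i, measurable (A i)) -> measurable (tail k A).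
Proof.
move=> mA; apply: fin_bigcap_measurable; first exact: finite_finset.
by move=> i _; exact: mX.
Qed.

Let tailS (k : 'I_n) A : tail k A = X k @^-1` A k `&` tail k.+1 A.
Proof.
apply/seteqP; split=> w.
  by move=> H; split=> [|i /= ki]; apply: H => //=; rewrite ltnW.
move=> [Hk H] i /=; rewrite leq_eqVlt => /orP[/eqP/val_inj <-//|]; exact: H.
Qed.

Let tail_prob k A : R := (\prod_(i < n | (k <= i)%N) fine (P (X i @^-1` A i)))%R.

Let tail_probS (k : 'I_n) A :
  tail_prob k A = (fine (P (X k @^-1` A k)) * tail_prob k.+1 A)%R.
Proof.
rewrite /tail_prob (bigD1 k)//=; congr (_ * _)%R; apply: eq_bigl => i.
by rewrite ltn_neqAle eq_sym andbC.
Qed.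

Let tail_prob_ge0 k A : (0 <= tail_prob k A)%R.
Proof. by apply: prodr_ge0 => i _; rewrite fine_ge0. Qed.

Let joint (k : 'I_n) w := (S k w, X k w).

Let mjoint k : measurable_fun setT (joint k).
Proof.
apply/measurable_fun_pairP; split; last exact: measurable_funPT.
by apply: measurable_chain; exact: ltnW.
Qed.

(** The induction hypothesis involves all the observations from [k] on, not just the next one: the
    later ones must remain available after [X k] has been absorbed into the chain. *)
Let independent_at k := forall C A, measurable C -> (forall i, measurable (A i)) ->
  P (S k @^-1` C `&` tail k A) = P (S k @^-1` C) * (tail_prob k A)%:E.

Let mS (k : 'I_n) : measurable_fun setT (S k).
Proof. exact: measurable_chain (ltnW (ltn_ord k)). Qed.

Let SM (k : 'I_n) : {RV P >-> V} := HB.pack (S k) (isMeasurableFun.Build _ _ _ _ _ (mS k)).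
Let JM (k : 'I_n) : {RV P >-> (V * 'cV[R]_p)%type} :=
  HB.pack (joint k) (isMeasurableFun.Build _ _ _ _ _ (mjoint k)).

Let mSC (k : 'I_n) C : measurable C -> measurable (S k @^-1` C).
Proof. by move=> mC; rewrite -[_ @^-1` _]setTI; exact: (mS k). Qed.

(** An event on the chain at time [k.+1] is an event on the pair at time [k] that need not be a
    rectangle. Independence on rectangles is extended by uniqueness of product measures, applied to
    [P] restricted to the tail event. *)
Let joint_tail (k : 'I_n) A B : independent_at k -> (forall i, measurable (A i)) ->
  measurable B -> P (joint k @^-1` B `&` tail k.+1 A) =
    (tail_prob k.+1 A)%:E * (distribution P (SM k) \x distribution P (X k)) B.
Proof.
move=> Ik mA mB.
have mt := mtail k.+1 mA.
pose rho : {measure set (V * 'cV[R]_p) -> \bar R} :=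
  HB.pack (pushforward (mrestr P mt) (JM k)).
apply: (@scaled_product_measure_unique _ _ _ _ _ _ _ _ (pushforward (mrestr P mt) (JM k))) => //.
move=> C D mC mD; rewrite /pushforward /mrestr/=.
pose A' i := if i == k then D else A i.
have mA' i : measurable (A' i) by rewrite /A'; case: ifP.
have := Ik C A' mC mA'.
rewrite tailS tail_probS /A' eqxx.
have -> : tail k.+1 A' = tail k.+1 A.
  apply: eq_bigcapr => i /= ki; rewrite /A'; case: eqP => // E.
  by move: ki; rewrite E ltnn.
have -> : tail_prob k.+1 A' = tail_prob k.+1 A.
  apply: eq_bigr => i ki; rewrite /A'; case: eqP => // E.
  by move: ki; rewrite E ltnn.
rewrite setIA => E; rewrite [LHS]E.
rewrite EFinM fineK; last by apply: fin_num_measure; exact: mX.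
by rewrite muleA muleC.
Qed.

Let chain_independent k : (k <= n)%N -> independent_at k.
Proof.
elim: k => [_ C A mC mA|k IH kn C A mC mA].
  rewrite S0; have [C0|C0] := pselect (C s0).
    rewrite (_ : cst s0 @^-1` C = setT); last by apply/seteqP; split.
    rewrite setTI probability_setT mul1e.
    have := indX mA; rewrite (_ : \bigcap_(i in _) _ = tail 0 A); last first.
      by apply/seteqP; split=> w H i _; exact: H.
    move=> ->; rewrite -prodEFin; apply: eq_bigr => i _.
    by rewrite fineK//; apply: fin_num_measure; exact: mX.
  rewrite (_ : cst s0 @^-1` C = set0); last by apply/seteqP; split.
  by rewrite set0I measure0 mul0e.
have {}IH := IH (ltnW kn); pose k' := Ordinal kn.
pose B := step @^-1` C.
have mB : measurable B by rewrite /B -[_ @^-1` _]setTI; exact: mstep.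
have SB : S k.+1 @^-1` C = joint k' @^-1` B by rewrite (SS k').
rewrite SB (joint_tail (k := k') IH mA mB) muleC; congr (_ * _).
have := joint_tail (k := k') (A := fun=> setT) IH (fun=> measurableT) mB.
rewrite (_ : tail _ _ = setT); last by apply/seteqP; split.
rewrite setIT => ->; rewrite (_ : tail_prob _ _ = 1%R) ?mul1e//.
by apply: big1 => i _; rewrite preimage_setT probability_setT.
Qed.

(** The position at time [k] depends on the earlier observations only, so its joint law with [X k]
    is a product and Tonelli allows integrating the new observation first. *)
Lemma ge0_integral_chain (k : 'I_n) (phi : V * 'cV[R]_p -> \bar R) :
  measurable_fun setT phi -> (forall z, 0 <= phi z) ->
  \int[P]_w phi (S k w, X k w) =
  \int[P]_w \int[distribution P (X k)]_x phi (S k w, x).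
Proof.
move=> mphi phi0.
rewrite -[LHS](ge0_integral_distribution (JM k))//.
transitivity (\int[distribution P (SM k) \x distribution P (X k)]_z phi z).
  apply: eq_measure_integral => B mB _.
  have := joint_tail (k := k) (A := fun=> setT) (chain_independent (ltnW (ltn_ord k))) (fun=> measurableT) mB.
  rewrite (_ : tail _ _ = setT); last by apply/seteqP; split.
  rewrite setIT => E; rewrite [LHS]E (_ : tail_prob _ _ = 1%R) ?mul1e//.
  by apply: big1 => i _; rewrite preimage_setT probability_setT.
rewrite fubini_tonelli1// /fubini_F ge0_integral_distribution//.
  exact: measurable_fun_fubini_tonelli_F.
by move=> s; apply: integral_ge0.
Qed.

End chain.

(** * A Lindeberg argument along the heat semigroup *)

Section taylor.
Context {R : realType}.
Implicit Types (g : R -> R) (C t u : R).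

Lemma mvt_le g g1 C t : 0 <= t -> (forall u : R, 0 <= u <= t -> is_derive u 1 g (g1 u)) ->
  (forall u : R, 0 <= u <= t -> `|g1 u| <= C) -> `|g t - g 0| <= C * t.
Proof.
move=> t0 dg C1.
have [u| |c] := @MVT_segment R g g1 0 t t0; last first.
- by rewrite in_itv/= => ct ->; rewrite normrM subr0 (ger0_norm t0) ler_wpM2r// C1.
- apply: derivable_within_continuous => u; rewrite in_itv/= => ut.
  by have [] := dg u ut.
- by rewrite in_itv/= => /andP[u0 ut]; apply: dg; rewrite !ltW.
Qed.

Lemma taylor1_le g g1 g2 C t : 0 <= t ->
  (forall u : R, 0 <= u <= t -> is_derive u 1 g (g1 u)) ->
  (forall u : R, 0 <= u <= t -> is_derive u 1 g1 (g2 u)) ->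
  (forall u : R, 0 <= u <= t -> `|g2 u| <= C) -> `|g t - g 0 - t * g1 0| <= C * t ^+ 2.
Proof.
move=> t0 d1 d2 C2.
have C0 : 0 <= C by apply: le_trans (C2 0 _); rewrite ?lexx.
pose D u := g u - u * g1 0.
have -> : g t - g 0 - t * g1 0 = D t - D 0 by rewrite /D; ring.
rewrite expr2 mulrA; apply: (@mvt_le _ (fun u => g1 u - g1 0)) => // u ut.
  have := is_deriveB (d1 _ ut) (is_deriveM (is_derive_id u (1 : R)) (is_derive_cst (g1 0) u 1)).
  by move/is_derive_eq; apply; rewrite /GRing.scale/= mulr0 add0r mulr1.
have /andP[u0 ut'] := ut.
apply: (le_trans (@mvt_le g1 g2 C u u0 _ _)); last by rewrite ler_wpM2l.
- by move=> v /andP[v0 vu]; apply: d2; rewrite v0 (le_trans vu).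
- by move=> v /andP[v0 vu]; apply: C2; rewrite v0 (le_trans vu).
Qed.

(** The mean value inequality is iterated on the remainders, at the price of losing the factorial;
    only the order of the error is needed later. *)
Lemma taylor2_le g g1 g2 g3 C t : 0 <= t ->
  (forall u : R, 0 <= u <= t -> is_derive u 1 g (g1 u)) ->
  (forall u : R, 0 <= u <= t -> is_derive u 1 g1 (g2 u)) ->
  (forall u : R, 0 <= u <= t -> is_derive u 1 g2 (g3 u)) ->
  (forall u : R, 0 <= u <= t -> `|g3 u| <= C) ->
  `|g t - g 0 - t * g1 0 - t ^+ 2 / 2 * g2 0| <= C * t ^+ 3.
Proof.
move=> t0 d1 d2 d3 C3.
have C0 : 0 <= C by apply: le_trans (C3 0 _); rewrite ?lexx.
pose D u := g u - u * g1 0 - u ^+ 2 / 2 * g2 0.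
have -> : g t - g 0 - t * g1 0 - t ^+ 2 / 2 * g2 0 = D t - D 0 by rewrite /D; ring.
rewrite exprSr mulrA; apply: (@mvt_le _ (fun u => g1 u - g1 0 - u * g2 0)) => // u ut.
  have d1u := d1 _ ut.
  have dX : is_derive u 1 (fun u : R => u ^+ 2 / 2 * g2 0) (u * g2 0).
    have := is_deriveM (is_deriveM (is_deriveX 2 (is_derive_id u (1 : R))) (is_derive_cst (2^-1 : R) u 1)) (is_derive_cst (g2 0) u 1).
    by move/is_derive_eq; apply; rewrite /GRing.scale/=; field.
  have := is_deriveB (is_deriveB d1u (is_deriveM (is_derive_id u (1 : R)) (is_derive_cst (g1 0) u 1))) dX.
  by move/is_derive_eq; apply; rewrite /GRing.scale/= mulr0 add0r mulr1.
have /andP[u0 ut'] := ut.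
apply: (le_trans (@taylor1_le g1 g2 g3 C u u0 _ _ _)).
- by move=> v /andP[v0 vu]; apply: d2; rewrite v0 (le_trans vu).
- by move=> v /andP[v0 vu]; apply: d3; rewrite v0 (le_trans vu).
- by move=> v /andP[v0 vu]; apply: C3; rewrite v0 (le_trans vu).
- by rewrite ler_wpM2l// lerXn2r// nnegrE.
Qed.

Lemma mulr_expRN_le1 (v : R) : 0 <= v -> v * expR (- v) <= 1.
Proof.
move=> v0; rewrite expRN ler_pdivrMr ?expR_gt0// mul1r.
by rewrite (le_trans _ (expR_ge1Dx v))// lerDr.
Qed.

Lemma sqrM_expRN_le2 (v : R) : 0 <= v -> v ^+ 2 * expR (- v) <= 2.
Proof.
move=> v0; rewrite expRN ler_pdivrMr ?expR_gt0//.
have := @expR_ge1Dxn R v 1 v0; rewrite (_ : 2`!%:R = 2 :> R)//; lra.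
Qed.

End taylor.

Section heat_step.
Context {R : realType}.

(* [b ^ 2 <= 4 a c] says that [a + b u + c u^2] is nonnegative; the bound is third
   order because [c ^ (3/2) <= (s c ^ 2 + c / s) / 2]. *)
Lemma gauss_taylor2 (a b c s : R) : 0 < s -> 0 <= a -> 0 <= c -> b ^+ 2 <= 4 * a * c ->
  `|expR (- (a + b + c)) - expR (- a) * (1 - b + (b ^+ 2 / 2 - c))| <=
  19 * (s * c ^+ 2 + c / s).
Proof.
move=> s0 a0 c0 bac.
(* In the application [b] is linear and [c] quadratic in the increment, so expanding in [u] at 0 and
   evaluating at 1 sorts the terms by their degree in the increment. *)
pose Q u := a + b * u + c * u ^+ 2.
pose X u := b + 2 * c * u.
pose g u := expR (- Q u).
have Q0 u : 0 <= Q u.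
  have [c00|cn0] := eqVneq c 0.
    have b0 : b = 0.
      by apply/eqP; rewrite -sqrf_eq0 eq_le sqr_ge0 andbT (le_trans bac)// c00 mulr0.
    by rewrite /Q b0 c00 !mul0r !addr0.
  have cp : 0 < c by rewrite lt0r cn0.
  rewrite -(pmulr_rge0 _ (_ : 0 < 4 * c)) ?mulr_gt0//.
  have -> : 4 * c * Q u = X u ^+ 2 + (4 * a * c - b ^+ 2) by rewrite /Q /X; ring.
  by rewrite addr_ge0 ?sqr_ge0// subr_ge0.
(* The derivative [X] of a nonnegative quadratic is controlled by the quadratic itself, so powers of
   [X] in the third derivative are absorbed by [exp (- Q)]. *)
have XQ u : X u ^+ 2 <= 4 * c * Q u.
  by rewrite -subr_ge0 (_ : _ - _ = 4 * a * c - b ^+ 2) ?subr_ge0// /Q /X; ring.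
have dQ (u : R) : is_derive u 1 (fun u => - Q u) (- X u).
  have D1 := is_deriveM (is_derive_cst b u 1) (is_derive_id u (1 : R)).
  have D2 := is_deriveM (is_derive_cst c u 1) (is_deriveX 2 (is_derive_id u (1 : R))).
  have := is_deriveN (is_deriveD (is_deriveD (is_derive_cst a u 1) D1) D2).
  by move/is_derive_eq; apply; rewrite /X /GRing.scale/=; ring.
have dg (u : R) : is_derive u 1 g (- X u * g u).
  have := @is_derive1_comp _ expR _ u _ _ (is_derive_expR _) (dQ u).
  by move/is_derive_eq; apply; rewrite mulrC.
have dX (u : R) : is_derive u 1 X (2 * c).
  have := is_deriveD (is_derive_cst b u 1) (is_deriveM (is_derive_cst (2 * c) u 1) (is_derive_id u (1 : R))).
  by move/is_derive_eq; apply; rewrite /GRing.scale/=; ring.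
have dg1 (u : R) : is_derive u 1 (fun u => - X u * g u) ((X u ^+ 2 - 2 * c) * g u).
  have dNX : is_derive u 1 (fun u => - X u) (- (2 * c)) := is_deriveN (dX u).
  have := is_deriveM dNX (dg u).
  by move/is_derive_eq; apply; rewrite /GRing.scale/=; ring.
have dg2 (u : R) : is_derive u 1 (fun u => (X u ^+ 2 - 2 * c) * g u)
    ((6 * c * X u - X u ^+ 3) * g u).
  have dX2 : is_derive u 1 (fun u => X u ^+ 2 - 2 * c) (4 * c * X u).
    have := is_deriveB (is_deriveX 2 (dX u)) (is_derive_cst (2 * c) u 1).
    by move/is_derive_eq; apply; rewrite /GRing.scale/=; ring.
  have := is_deriveM dX2 (dg u).
  by move/is_derive_eq; apply; rewrite /GRing.scale/=; ring.
have := @taylor2_le R g _ _ _ (19 * (s * c ^+ 2 + c / s)) 1 ler01 (fun u _ => dg u)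
  (fun u _ => dg1 u) (fun u _ => dg2 u) _.
rewrite !expr1n mulr1 (_ : g 1 - _ - _ - _ = expR (- (a + b + c)) - expR (- a) * (1 - b + (b ^+ 2 / 2 - c))).
  apply=> u _; rewrite normrM (ger0_norm (expR_ge0 _)).
  have Xb : `|6 * c * X u - X u ^+ 3| <=
      3 * (s * c ^+ 2 + (4 * c * Q u) / s) +
      (s * (16 * c ^+ 2 * Q u ^+ 2) + (4 * c * Q u) / s) / 2.
    rewrite (le_trans (ler_normB _ _))// lerD//.
      have cX : 2 * (c * `|X u|) <= s * c ^+ 2 + X u ^+ 2 / s.
        rewrite -subr_ge0 (_ : _ - _ = s * (c - `|X u| / s) ^+ 2); last first.
          by rewrite -[X u ^+ 2]real_normK ?num_real//; field; rewrite gt_eqF.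
        by rewrite mulr_ge0 ?sqr_ge0// ltW.
      rewrite !normrM (ger0_norm c0) ger0_norm// (_ : 6 * c * `|X u| = 3 * (2 * (c * `|X u|))); last by ring.
      by rewrite ler_wpM2l// (le_trans cX)// lerD2l ler_wpM2r ?invr_ge0 ?(ltW s0).
    have X3 : 2 * `|X u| ^+ 3 <= s * `|X u| ^+ 4 + `|X u| ^+ 2 / s.
      rewrite -subr_ge0 (_ : _ - _ = s * `|X u| ^+ 2 * (`|X u| - s^-1) ^+ 2); last first.
        by field; rewrite gt_eqF.
      by apply: mulr_ge0; rewrite ?sqr_ge0// mulr_ge0 ?sqr_ge0// ltW.
    rewrite normrX ler_pdivlMr// mulrC (le_trans X3)// real_normK ?num_real// lerD//.
      rewrite ler_wpM2l ?(ltW s0)// (_ : `|X u| ^+ 4 = (X u ^+ 2) ^+ 2); last first.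
        by rewrite -[X u ^+ 2]real_normK ?num_real// -exprM.
      rewrite (_ : 16 * _ * _ = (4 * c * Q u) ^+ 2); last by ring.
      by rewrite lerXn2r// nnegrE ?sqr_ge0// !mulr_ge0.
    by rewrite ler_wpM2r ?invr_ge0 ?(ltW s0).
  rewrite (le_trans (ler_wpM2r (expR_ge0 _) Xb))//.
  have e1 : expR (- Q u) <= 1 by rewrite expR_le1 oppr_le0.
  have := mulr_expRN_le1 (Q0 u); have := sqrM_expRN_le2 (Q0 u).
  rewrite /g; move: (expR _) e1 => e e1 e2 e3.
  (* Origin of 19: [3 e + 8 Q^2 e <= 3 + 16], using [Q^2 e <= 2]. The other coefficient is only
     [14 Q e <= 14]. *)
  rewrite (_ : _ * e = s * c ^+ 2 * (3 * e + 8 * (Q u ^+ 2 * e)) + c / s * (14 * (Q u * e))); last by field; rewrite gt_eqF.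
  rewrite [leRHS]mulrDr lerD// [leRHS]mulrC ler_wpM2l//; last 2 first.
  - by rewrite divr_ge0// ltW.
  - lra.
  - by rewrite mulr_ge0 ?sqr_ge0// ltW.
  - lra.
by rewrite /g /Q /X !mulr1 expr1n !mulr0 expr0n/= !mulr0 !addr0 mulr1; field.
Qed.

(** The mean of [exp (- |x + sqrt u N|^2)] for a standard normal [N] in dimension [m] and
    [|x|^2 = rho]. The power of [1 + 2 u] is written with [ln], so that products become sums of
    exponents. *)
Definition gauss_heat (m u rho : R) : R :=
  expR (- (m / 2) * ln (1 + 2 * u) - rho / (1 + 2 * u)).

(** The coefficient [2 rho - m] times [exp (- rho)] is half the Laplacian of [exp (- |x|^2)]: the
    first order in time of the heat flow. *)
Lemma gauss_heat_taylor1 (m u rho : R) : 0 <= m -> 0 <= u -> 0 <= rho ->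
  `|gauss_heat m u rho - expR (- rho) * (1 + u * (2 * rho - m))| <=
  (m ^+ 2 + 6 * m + 16) * u ^+ 2.
Proof.
move=> m0 u0 rho0.
pose w v : R := 1 + 2 * v.
pose h v := gauss_heat m v rho.
pose k v := - m / w v + 2 * rho / w v ^+ 2.
have w1 (v : R) : 0 <= v -> 1 <= w v by move=> v0; rewrite lerDl mulr_ge0.
have w0 (v : R) : 0 <= v -> 0 < w v by move=> /w1; exact: lt_le_trans.
have dw (v : R) : is_derive v 1 w 2.
  have := is_deriveD (is_derive_cst (1 : R) v 1) (is_deriveM (is_derive_cst (2 : R) v 1) (is_derive_id v (1 : R))).
  by move/is_derive_eq; apply; rewrite /GRing.scale/=; ring.
have dV (v : R) : 0 <= v -> is_derive v 1 (fun v => (w v)^-1) (- 2 / w v ^+ 2).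
  move=> v0; have := is_deriveV (lt0r_neq0 (w0 v v0)) (dw v).
  by move/is_derive_eq; apply; rewrite /GRing.scale/=; ring.
have dh (v : R) : 0 <= v -> is_derive v 1 h (k v * h v).
  move=> v0; have wn0 := lt0r_neq0 (w0 v v0).
  have Dl := @is_derive1_comp _ (@ln R) w v _ _ (is_derive1_ln (w0 v v0)) (dw v).
  have D1 := is_deriveM (is_derive_cst (- (m / 2)) v 1) Dl.
  have D2 := is_deriveM (is_derive_cst rho v 1) (dV v v0).
  have D : is_derive v 1 (fun v => - (m / 2) * ln (w v) - rho / w v) (k v).
    by move: (is_deriveB D1 D2) => /is_derive_eq; apply; rewrite /GRing.scale/= /k; field.
  have := @is_derive1_comp _ expR _ v _ _ (is_derive_expR _) D.
  by move/is_derive_eq; apply; rewrite mulrC.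
have dk (v : R) : 0 <= v -> is_derive v 1 k (2 * m / w v ^+ 2 - 8 * rho / w v ^+ 3).
  move=> v0; have wn0 := lt0r_neq0 (w0 v v0).
  have D1 := is_deriveM (is_derive_cst (- m) v 1) (dV v v0).
  have D2 := is_deriveM (is_derive_cst (2 * rho) v 1) (is_deriveX 2 (dV v v0)).
  have E : k = (fun v => - m * (w v)^-1 + 2 * rho * ((w v)^-1) ^+ 2).
    by apply/funext => z; rewrite /k exprVn.
  rewrite E; have := is_deriveD D1 D2.
  by move/is_derive_eq; apply; rewrite /GRing.scale/=; field.
have dkh (v : R) : 0 <= v -> is_derive v 1 (fun v => k v * h v)
    ((k v ^+ 2 + (2 * m / w v ^+ 2 - 8 * rho / w v ^+ 3)) * h v).
  move=> v0; have := is_deriveM (dk v v0) (dh v v0).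
  by move/is_derive_eq; apply; rewrite /GRing.scale/=; ring.
have := @taylor1_le R h (fun v => k v * h v) _ (m ^+ 2 + 6 * m + 16) u u0
  (fun v vu => dh v (proj1 (andP vu))) (fun v vu => dkh v (proj1 (andP vu))) _.
rewrite (_ : h u - _ - _ = gauss_heat m u rho - expR (- rho) * (1 + u * (2 * rho - m))).
  apply=> v /andP[v0 vu]; have wp := w0 v v0.
  pose i := (w v)^-1; pose y := rho / w v.
  have i0 : 0 <= i by rewrite invr_ge0 ltW.
  have i1 : i <= 1 by rewrite invf_le1// w1.
  have y0 : 0 <= y by rewrite divr_ge0// ltW.
  have hy : h v <= expR (- y).
    by rewrite ler_expR gerDr mulNr oppr_le0 mulr_ge0 ?divr_ge0// ln_ge0// w1.
  rewrite normrM (ger0_norm (expR_ge0 _)).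
  have kb : `|k v ^+ 2 + (2 * m / w v ^+ 2 - 8 * rho / w v ^+ 3)| <=
      (m + 2 * y) ^+ 2 + (2 * m + 8 * y).
    have -> : k v = i * (2 * y - m) by rewrite /k /y /i; field; rewrite gt_eqF.
    have -> : 2 * m / w v ^+ 2 - 8 * rho / w v ^+ 3 = i ^+ 2 * (2 * m - 8 * y).
      by rewrite /y /i; field; rewrite gt_eqF.
    have ii : i ^+ 2 <= 1 by rewrite expr_le1.
    rewrite exprMn -mulrDr normrM (ger0_norm (sqr_ge0 _)).
    rewrite (le_trans (ler_piMl _ ii))// ler_norml; apply/andP; split; nra.
  rewrite (le_trans (ler_wpM2r (expR_ge0 _) kb))//.
  rewrite (le_trans (ler_wpM2l _ hy))// ?addr_ge0 ?sqr_ge0 ?mulr_ge0//.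
  have e1 : expR (- y) <= 1 by rewrite expR_le1 oppr_le0.
  have := mulr_expRN_le1 y0; have := sqrM_expRN_le2 y0.
  move: (expR _) e1 => e e1 e2 e3.
  (* With [y e <= 1] and [y^2 e <= 2] the sum is at most [m^2 + 4 m + 8 + 2 m + 8]. *)
  rewrite (_ : _ * e = m ^+ 2 * e + 4 * m * (y * e) + 4 * (y ^+ 2 * e) + 2 * m * e + 8 * (y * e)); last by ring.
  have := ler_wpM2l (sqr_ge0 m) e1; have := ler_wpM2l m0 e1; have := ler_wpM2l m0 e3.
  rewrite !mulr1; lra.
by rewrite /k /h /gauss_heat /w mulr0 addr0 ln1 !divr1 mulr0 sub0r expr1n; field.
Qed.

End heat_step.

Section integrable_EFin.
Context {R : realType} {d : measure_display} {T : measurableType d}.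
Variable mu : {measure set T -> \bar R}.
Implicit Types h k : T -> R.

Lemma integrable_EFinZ (c : R) h : mu.-integrable setT (EFin \o h) ->
  mu.-integrable setT (EFin \o (fun x => c * h x)).
Proof.
move=> ih; have := integrableZl measurableT c ih.
by apply: eq_integrable => // x _; rewrite /= EFinM.
Qed.

Lemma integrable_EFinD h k : mu.-integrable setT (EFin \o h) ->
  mu.-integrable setT (EFin \o k) -> mu.-integrable setT (EFin \o (fun x => h x + k x)).
Proof.
move=> ih ik; have := integrableD measurableT ih ik.
by apply: eq_integrable => // x _; rewrite /= EFinD.
Qed.

Lemma integrable_EFinB h k : mu.-integrable setT (EFin \o h) ->
  mu.-integrable setT (EFin \o k) -> mu.-integrable setT (EFin \o (fun x => h x - k x)).
Proof.
move=> ih ik; have := integrableB measurableT ih ik.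
by apply: eq_integrable => // x _; rewrite /= EFinB.
Qed.

End integrable_EFin.

Lemma integrable_bounded d (T : measurableType d) (R : realType)
    (P : probability T R) (h : T -> R) (M : R) :
  measurable_fun setT h -> (forall x, `|h x| <= M) -> P.-integrable setT (EFin \o h).
Proof.
move=> mh hM; apply/integrableP; split; first exact/measurable_EFinP.
apply: (@le_lt_trans _ _ (\int[P]_x (`|M|%:E))%E); last first.
  by rewrite integral_probability_cst ltry.
apply: ge0_le_integral => //.
- by apply/measurableT_comp => //; exact/measurable_EFinP.
- by move=> x _; rewrite lee_fin (le_trans (hM x))// ler_norm.
Qed.

Lemma Rintegral_probability_cst d (T : measurableType d) (R : realType)
  (P : probability T R) (r : R) : \int[P]_x r = r.
Proof. by rewrite /Rintegral integral_probability_cst. Qed.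

Section heat_step.
Context {R : realType} {d : measure_display} {T : measurableType d}.
Variables (nu : probability T R) (B Q : T -> R) (a m delta s : R).
Hypotheses (mB : measurable_fun setT B) (mQ : measurable_fun setT Q).
Hypotheses (iB : nu.-integrable setT (EFin \o B))
  (iB2 : nu.-integrable setT (EFin \o (fun x => B x ^+ 2)))
  (iQ : nu.-integrable setT (EFin \o Q))
  (iQ2 : nu.-integrable setT (EFin \o (fun x => Q x ^+ 2))).
Hypotheses (a0 : 0 <= a) (m0 : 0 <= m) (delta0 : 0 <= delta) (s0 : 0 < s).
Hypotheses (Q0 : forall x, 0 <= Q x) (BQ : forall x, B x ^+ 2 <= 4 * a * Q x).
Hypotheses (EB : \int[nu]_x B x = 0) (EB2 : \int[nu]_x (B x ^+ 2) = 4 * a * delta)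
  (EQ : \int[nu]_x Q x = m * delta).

(** Under the three moment hypotheses the mean of [- B + B^2 / 2 - Q] is [delta (2 a - m)], exactly
    the first order term of the heat flow over time [delta]. Only the remainders of the two
    expansions are left. *)
Lemma heat_step : `|\int[nu]_x expR (- (a + B x + Q x)) - gauss_heat m delta a| <=
  19 * (s * \int[nu]_x (Q x ^+ 2) + m * delta / s) +
  (m ^+ 2 + 6 * m + 16) * delta ^+ 2.
Proof.
pose L x := expR (- a) * (1 + (- 1 * B x + (2^-1 * B x ^+ 2 + - 1 * Q x))).
have i1 : nu.-integrable setT (EFin \o (fun x => 2^-1 * B x ^+ 2 + - 1 * Q x)).
  by apply: integrable_EFinD; exact: integrable_EFinZ.
have i2 : nu.-integrable setT
    (EFin \o (fun x => - 1 * B x + (2^-1 * B x ^+ 2 + - 1 * Q x))).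
  by apply: integrable_EFinD => //; exact: integrable_EFinZ.
have ic : nu.-integrable setT (EFin \o (fun=> 1 : R)).
  by apply: (@integrable_bounded _ _ _ _ _ 1) => // x; rewrite normr1.
have i3 := integrable_EFinD ic i2.
have iL : nu.-integrable setT (EFin \o L) by exact: integrable_EFinZ.
have EL : \int[nu]_x L x = expR (- a) * (1 + delta * (2 * a - m)).
  rewrite /L RintegralZl// RintegralD// Rintegral_probability_cst RintegralD//; last exact: integrable_EFinZ.
  rewrite RintegralD//; [|exact: integrable_EFinZ|exact: integrable_EFinZ].
  by rewrite !RintegralZl// EB EB2 EQ; congr (_ * (_ + _)); field.
have mE : measurable_fun setT (fun x => expR (- (a + B x + Q x))).
  apply: measurableT_comp => //; apply: measurable_funN; apply: measurable_funD => //.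
  exact: measurable_funD.
have aBQ x : 0 <= a + B x + Q x.
  have := BQ x; have := Q0 x; move: (B x) (Q x) => b c c0 bac.
  rewrite leNgt; apply/negP => h.
  have p1 : 0 < - b - (a + c) by lra.
  have ac : 0 <= a + c by rewrite addr_ge0.
  have p2 : 0 < - b + (a + c) by lra.
  by have := mulr_gt0 p1 p2; have := sqr_ge0 (a - c); lra.
have iE : nu.-integrable setT (EFin \o (fun x => expR (- (a + B x + Q x)))).
  apply: (@integrable_bounded _ _ _ _ _ 1) => // x.
  by rewrite ger0_norm ?expR_ge0// expR_le1 oppr_le0.
pose U x := 19 * (s * Q x ^+ 2 + s^-1 * Q x).
have iU : nu.-integrable setT (EFin \o U).
  by apply/integrable_EFinZ/integrable_EFinD; exact: integrable_EFinZ.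
have EU : \int[nu]_x U x = 19 * (s * \int[nu]_x (Q x ^+ 2) + m * delta / s).
  rewrite /U RintegralZl//; last by apply: integrable_EFinD; exact: integrable_EFinZ.
  rewrite RintegralD//; [|exact: integrable_EFinZ|exact: integrable_EFinZ].
  by rewrite !RintegralZl// EQ [in RHS]mulrC [in LHS]mulrC (mulrC s^-1).
rewrite (le_trans (ler_distD (\int[nu]_x L x) _ _))// lerD//; last first.
  by rewrite EL distrC; exact: gauss_heat_taylor1.
have iEL := integrable_EFinB iE iL.
rewrite -RintegralB// (le_trans (le_normr_Rintegral _ _))//.
rewrite -EU; apply: le_Rintegral => //; first exact: integrable_norm.
move=> x _; rewrite /L /U.
have := gauss_taylor2 s0 a0 (Q0 x) (BQ x).
by rewrite -/(L x); congr (`|_ - _ * _| <= 19 * (_ + _)); [field|rewrite mulrC].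
Qed.

End heat_step.

Section semigroup.
Context {R : realType}.
Implicit Types m u v rho : R.

(** The semigroup law in scaled form. Dividing [v] and [rho] by [1 + 2 u] reduces a step made at
    time [u] to a step made at time 0. *)
Lemma gauss_heatD m u v rho : 0 <= u -> 0 <= v ->
  gauss_heat m (u + v) rho = expR (- (m / 2) * ln (1 + 2 * u)) *
    gauss_heat m (v / (1 + 2 * u)) (rho / (1 + 2 * u)).
Proof.
move=> u0 v0.
have A0 : 0 < 1 + 2 * u by rewrite ltr_pwDl// mulr_ge0.
have A1 : 0 < 1 + 2 * u + 2 * v by rewrite ltr_pwDl// mulr_ge0.
rewrite /gauss_heat -expRD; congr expR.
have -> : 1 + 2 * (u + v) = (1 + 2 * u) * (1 + 2 * (v / (1 + 2 * u))).
  by field; rewrite gt_eqF.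
rewrite lnM ?posrE//; last by rewrite ltr_pwDl// mulr_ge0// divr_ge0// ltW.
by rewrite [in LHS]invfM mulrA; ring.
Qed.

Lemma gauss_heat0 m rho : gauss_heat m 0 rho = expR (- rho).
Proof. by rewrite /gauss_heat mulr0 addr0 ln1 mulr0 sub0r divr1. Qed.

Lemma gauss_heat_le1 m u rho : 0 <= m -> 0 <= u -> 0 <= rho -> gauss_heat m u rho <= 1.
Proof.
move=> m0 u0 r0; rewrite /gauss_heat expR_le1 mulNr -opprD oppr_le0.
have A1 : 1 <= 1 + 2 * u by rewrite lerDl mulr_ge0.
by apply: addr_ge0; [rewrite mulr_ge0 ?divr_ge0 ?ln_ge0|rewrite divr_ge0// (le_trans ler01 A1)].
Qed.

Lemma measurable_gauss_heat m u : measurable_fun setT (gauss_heat m u).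
Proof.
apply: measurableT_comp => //; apply: measurable_funB => //.
exact: measurable_funM.
Qed.

End semigroup.

(** * The walk with independent isotropic increments *)

Section heat_chain.
Context {R : realType} {p n : nat} {d : measure_display} {Omega : measurableType d}.
Variables (P : probability Omega R) (X : 'I_n -> {RV P >-> 'cV[R]_p}).
Hypothesis indX : mutually_independent X.
Variables (perp : 'cV[R]_p -> Prop) (Y : 'cV[R]_p -> 'cV[R]_p).
Hypotheses (mY : measurable_fun setT Y) (perpD : forall s x, perp s -> perp (s + Y x)).
Variables (m delta q2 : R).
Hypotheses (m0 : 0 <= m) (delta0 : 0 <= delta).
Local Notation nu i := (distribution P (X i)).
Local Notation Y2 x := (dot (Y x) (Y x)).
Hypotheses
  (iY : forall i s, perp s -> (nu i).-integrable setT (EFin \o (fun x => dot s (Y x))))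
  (iYs : forall i s, perp s ->
    (nu i).-integrable setT (EFin \o (fun x => dot s (Y x) ^+ 2)))
  (iY2 : forall i, (nu i).-integrable setT (EFin \o (fun x => Y2 x)))
  (iY4 : forall i, (nu i).-integrable setT (EFin \o (fun x => Y2 x ^+ 2))).
Hypotheses
  (EY : forall i s, perp s -> \int[nu i]_x dot s (Y x) = 0)
  (EYs : forall i s, perp s -> \int[nu i]_x (dot s (Y x) ^+ 2) = delta * dot s s)
  (EY2 : forall i, \int[nu i]_x Y2 x = m * delta)
  (EY4 : forall i, \int[nu i]_x (Y2 x ^+ 2) = q2).

Let mdotY s : measurable_fun setT (fun x => dot s (Y x)).
Proof. by under eq_fun do rewrite dotC; exact: measurableT_comp (measurable_dotr s) mY. Qed.

Let mY2 : measurable_fun setT (fun x => Y2 x).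
Proof. exact: measurableT_comp (@measurable_dotxx R p) mY. Qed.

Definition heat_step_error (k s : R) := 19 * (s * (k ^+ 2 * q2) + m * (k * delta) / s) +
  (m ^+ 2 + 6 * m + 16) * (k * delta) ^+ 2.

(** Factoring out the flow up to time [k t] leaves [heat_step] with [b = k / (1 + 2 k t) <= k] and a
    prefactor at most 1, so that one error bound serves for all times [t]. *)
Lemma gauss_heat_step i k t sigma s : 0 <= k -> 0 <= t -> 0 < sigma -> perp s ->
  `|\int[nu i]_x gauss_heat m (k * t) (k * dot (s + Y x) (s + Y x)) -
    gauss_heat m (k * t + k * delta) (k * dot s s)| <= heat_step_error k sigma.
Proof.
move=> k0 t0 sigma0 ps.
pose A := 1 + 2 * (k * t).
have A1 : 1 <= A by rewrite lerDl !mulr_ge0.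
have A0 : 0 < A := lt_le_trans ltr01 A1.
pose b := k / A.
have b0 : 0 <= b by rewrite divr_ge0// ltW.
have bk : b <= k by rewrite ler_pdivrMr// ler_peMr.
pose c := expR (- (m / 2) * ln A).
have c0 : 0 <= c by exact: expR_ge0.
have c1 : c <= 1 by rewrite expR_le1 mulNr oppr_le0 mulr_ge0 ?divr_ge0 ?ln_ge0.
pose B x := 2 * b * dot s (Y x).
pose Q x := b * Y2 x.
have q20 : 0 <= q2 by rewrite -(EY4 i); apply: Rintegral_ge0 => x _; rewrite sqr_ge0.
have EQ2 : \int[nu i]_x (Q x ^+ 2) = b ^+ 2 * q2.
  rewrite -(EY4 i) -RintegralZl//; last exact: iY4.
  by apply: eq_Rintegral => x _; rewrite exprMn.
have E1 x : gauss_heat m (k * t) (k * dot (s + Y x) (s + Y x)) =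
    c * expR (- (b * dot s s + B x + Q x)).
  rewrite /gauss_heat -/A /c -expRD; congr (expR (_ + _)).
  rewrite /B /Q /b !(dotDl, dotDr) (dotC (Y x) s); field.
  by rewrite gt_eqF.
have mE : measurable_fun setT (fun x => expR (- (b * dot s s + B x + Q x))).
  apply: measurableT_comp => //; apply: measurable_funN; apply: measurable_funD => //.
    by apply: measurable_funD => //; exact: measurable_funM.
  exact: measurable_funM.
have E2 : gauss_heat m (k * t + k * delta) (k * dot s s) =
    c * gauss_heat m (b * delta) (b * dot s s).
  have -> : b * delta = k * delta / A by rewrite /b; ring.
  have -> : b * dot s s = k * dot s s / A by rewrite /b; ring.
  by rewrite gauss_heatD ?mulr_ge0.
have iE : (nu i).-integrable setT (EFin \o (fun x => expR (- (b * dot s s + B x + Q x)))).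
  apply: (@integrable_bounded _ _ _ _ _ 1) => // x.
  rewrite ger0_norm ?expR_ge0// expR_le1 oppr_le0.
  have -> : b * dot s s + B x + Q x = b * dot (s + Y x) (s + Y x).
    by rewrite /B /Q !(dotDl, dotDr) (dotC (Y x) s); ring.
  by rewrite mulr_ge0 ?dotxx_ge0.
rewrite E2; under eq_Rintegral do rewrite E1.
rewrite RintegralZl// -mulrBr normrM (ger0_norm c0).
rewrite (le_trans (ler_piMl _ c1))//.
have H := @heat_step _ _ _ (nu i) B Q (b * dot s s) m (b * delta) sigma.
apply: le_trans (H _ _ _ _ _ _ _ _ _ _ _ _ _ _ _) _.
- exact: measurable_funM.
- exact: measurable_funM.
- by apply: integrable_EFinZ; exact: iY.
- have := integrable_EFinZ ((2 * b) ^+ 2) (iYs i ps).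
  by apply: eq_integrable => // x _ /=; congr _%:E; rewrite /B [in RHS]exprMn.
- exact: integrable_EFinZ (iY2 i).
- have := integrable_EFinZ (b ^+ 2) (iY4 i).
  by apply: eq_integrable => // x _ /=; congr _%:E; rewrite /Q [in RHS]exprMn.
- by rewrite mulr_ge0 ?dotxx_ge0.
- by [].
- by rewrite mulr_ge0.
- by [].
- by move=> x; rewrite mulr_ge0 ?dotxx_ge0.
- move=> x; rewrite /B /Q exprMn (_ : 4 * _ * _ = (2 * b) ^+ 2 * (dot s s * Y2 x)); last by ring.
  by rewrite ler_wpM2l ?sqr_ge0// cauchy_schwarz.
- by rewrite RintegralZl ?EY ?mulr0//; exact: iY.
- under eq_Rintegral do rewrite /B exprMn.
  by rewrite RintegralZl ?EYs//; [ring|exact: iYs].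
- by rewrite (RintegralZl b measurableT (iY2 i)) EY2; ring.
rewrite EQ2 /heat_step_error lerD//.
  rewrite ler_wpM2l// lerD//.
    by rewrite ler_wpM2l ?(ltW sigma0)// ler_wpM2r// lerXn2r// nnegrE.
  by rewrite ler_wpM2r ?invr_ge0 ?(ltW sigma0)// ler_wpM2l// ler_wpM2r.
rewrite ler_wpM2l//.
  by rewrite addr_ge0// addr_ge0 ?sqr_ge0// mulr_ge0.
have bd : b * delta <= k * delta by rewrite ler_wpM2r.
by apply: lerXn2r => //; rewrite nnegrE mulr_ge0.
Qed.

Variables (s0 : 'cV[R]_p).
Hypothesis perp0 : perp s0.

Definition walk j w : 'cV[R]_p := s0 + \sum_(i < n | (i < j)%N) Y (X i w).

Lemma walkS (k : 'I_n) w : walk k.+1 w = walk k w + Y (X k w).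
Proof.
rewrite /walk (bigD1 k)//= addrCA addrC; congr (_ + _ + _).
by apply: eq_bigl => i; rewrite ltnS ltn_neqAle andbC.
Qed.

Lemma walk0 w : walk 0 w = s0.
Proof. by rewrite /walk big_pred0 ?addr0. Qed.

Lemma perp_walk j w : perp (walk j w).
Proof.
rewrite /walk; elim/big_rec: _ => [|i x _]; first by rewrite addr0.
by move=> /(perpD (X i w)); rewrite -addrA (addrC x).
Qed.

Let step (z : 'cV[R]_p * 'cV[R]_p) := z.1 + Y z.2.

Let mstep : measurable_fun setT step.
Proof.
apply: measurable_cVP => i; under eq_fun do rewrite mxE.
apply: measurable_funD.
  exact: measurableT_comp (measurable_coord i) _.
by apply: measurableT_comp (measurable_coord i) _; exact: measurableT_comp mY _.
Qed.

Let S0 : walk 0 = cst s0. Proof. by apply/funext => w; rewrite walk0. Qed.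

Let SS (k : 'I_n) : walk k.+1 = fun w => step (walk k w, X k w).
Proof. by apply/funext => w; rewrite walkS. Qed.

Lemma measurable_walk j : (j <= n)%N -> measurable_fun setT (walk j).
Proof. exact: (measurable_chain S0 mstep SS). Qed.

Lemma ge0_integral_walkS (k : 'I_n) (F : 'cV[R]_p -> \bar R) :
  measurable_fun setT F -> (forall s, 0 <= F s)%E ->
  (\int[P]_w F (walk k.+1 w) = \int[P]_w \int[nu k]_x F (walk k w + Y x)%R)%E.
Proof.
move=> mF F0.
have := @ge0_integral_chain _ _ _ _ _ _ _ _ _ indX _ _ _ S0 mstep SS k
  (fun z => F (step z)) (measurableT_comp mF mstep) (fun z => F0 _).
by rewrite /step /= => <-; apply: eq_integral => w _; rewrite walkS.
Qed.

(** Centred increments make the cross terms vanish. The increment map and the set [perp] of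
    positions are abstract because the identity serves twice: for the tangent walk, and for a scalar
    average placed along [theta]. *)
Lemma integral_walk_sqr j : (j <= n)%N ->
  (\int[P]_w (dot (walk j w) (walk j w))%:E = (dot s0 s0 + j%:R * (m * delta))%:E)%E.
Proof.
elim: j => [_|j IH jn].
  by under eq_integral do rewrite walk0; rewrite integral_probability_cst mul0r addr0.
have {}IH := IH (ltnW jn); pose k := Ordinal jn.
have md := @measurable_dotxx R p.
rewrite (ge0_integral_walkS k (F := fun s => (dot s s)%:E)); first last.
- by move=> s; rewrite lee_fin dotxx_ge0.
- exact/measurable_EFinP.
transitivity (\int[P]_w ((dot (walk j w) (walk j w))%:E + (m * delta)%:E))%E.
  apply: eq_integral => w _; have := perp_walk j w.
  move: (walk j w) => s pw.
  have E x : dot (s + Y x) (s + Y x) = dot s s + (2 * dot s (Y x) + Y2 x).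
    by rewrite !(dotDl, dotDr) (dotC (Y x) s); ring.
  have i1 : (nu k).-integrable setT (EFin \o (fun x => 2 * dot s (Y x))).
    by apply: integrable_EFinZ; exact: iY.
  have i2 : (nu k).-integrable setT (EFin \o (fun x => 2 * dot s (Y x) + Y2 x)).
    exact: integrable_EFinD i1 (iY2 k).
  have ic : (nu k).-integrable setT (EFin \o (fun=> dot s s)).
    by apply: (@integrable_bounded _ _ _ _ _ `|dot s s|).
  transitivity (\int[nu k]_x (dot s s + (2 * dot s (Y x) + Y2 x)))%:E.
    rewrite /Rintegral fineK; last first.
      apply: integrable_fin_num => //; exact: integrable_EFinD ic i2.
    by apply: eq_integral => x _; rewrite E.
  rewrite RintegralD// RintegralD//; last exact: iY2.
  rewrite Rintegral_probability_cst RintegralZl//; last exact: iY.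
  by rewrite EY// EY2 mulr0 add0r.
rewrite ge0_integralD//; first last.
- by move=> w _; rewrite lee_fin mulr_ge0.
- by apply/measurable_EFinP; apply: measurableT_comp md _; exact: measurable_walk (ltnW jn).
- by move=> w _; rewrite lee_fin dotxx_ge0.
rewrite IH integral_probability_cst -EFinD; congr _%:E.
by rewrite -natr1; ring.
Qed.

Lemma laplace_walk k sigma : 0 <= k -> 0 < sigma ->
  `|\int[P]_w expR (- (k * dot (walk n w) (walk n w))) -
    gauss_heat m (k * (n%:R * delta)) (k * dot s0 s0)| <=
  n%:R * heat_step_error k sigma.
Proof.
move=> k0 sigma0.
(* [F j] runs the heat flow for the time owed to the [n - j] summands not yet added: [a 0] is the
   Gaussian value, [a n] the Laplace transform of the walk, and the difference telescopes. *)
pose F j (s : 'cV[R]_p) := gauss_heat m (k * ((n - j)%:R * delta)) (k * dot s s).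
pose a j := \int[P]_w F j (walk j w).
have F0 j s : 0 <= F j s by exact: expR_ge0.
have F1 j s : F j s <= 1 by apply: gauss_heat_le1; rewrite ?mulr_ge0 ?dotxx_ge0.
have mF j : measurable_fun setT (F j).
  apply: measurableT_comp (measurable_gauss_heat _ _) _.
  by apply: measurable_funM => //; exact: measurable_dotxx.
have step_le j : (j < n)%N -> `|a j.+1 - a j| <= heat_step_error k sigma.
  move=> jn; pose i := Ordinal jn.
  pose I w := \int[nu i]_x F j.+1 (walk j w + Y x).
  have mFs s : measurable_fun setT (fun x => F j.+1 (s + Y x)).
    apply: measurableT_comp (mF j.+1) _.
    apply: measurable_cVP => l; under eq_fun do rewrite mxE.
    by apply: measurable_funD => //; exact: measurableT_comp (measurable_coord l) mY.
  have iFs s : (nu i).-integrable setT (EFin \o (fun x => F j.+1 (s + Y x))).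
    by apply: (@integrable_bounded _ _ _ _ _ 1) => // x; rewrite ger0_norm.
  have IE w : (I w)%:E = (\int[nu i]_x (F j.+1 (walk j w + Y x))%:E)%E.
    by rewrite /I /Rintegral fineK//; apply: integrable_fin_num => //; exact: iFs.
  have mI : measurable_fun setT I.
    apply/measurable_EFinP; rewrite (_ : _ \o _ =
      (fun s => \int[nu i]_x (F j.+1 (step (s, x)))%:E)%E \o walk j); last first.
      by apply/funext => w /=; rewrite IE.
    apply: measurableT_comp; last exact: measurable_walk (ltnW jn).
    apply: (measurable_fun_fubini_tonelli_F (fun z => (F j.+1 (step z))%:E)) => //.
      by apply/measurable_EFinP; exact: measurableT_comp (mF _) mstep.
    by move=> z; rewrite lee_fin.
  have I01 w : 0 <= I w <= 1.
    rewrite Rintegral_ge0//= -(Rintegral_probability_cst (nu i) 1).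
    apply: le_Rintegral => //; apply: (@integrable_bounded _ _ _ _ _ 1) => // x.
    by rewrite normr1.
  have iI : P.-integrable setT (EFin \o I).
    apply: (@integrable_bounded _ _ _ _ _ 1) => // w.
    by have /andP[I0 I1] := I01 w; rewrite ger0_norm.
  have mFw : measurable_fun setT (fun w => F j (walk j w)).
    by apply: measurableT_comp (mF j) _; exact: measurable_walk (ltnW jn).
  have iF : P.-integrable setT (EFin \o (fun w => F j (walk j w))).
    by apply: (@integrable_bounded _ _ _ _ _ 1) => // w; rewrite ger0_norm.
  have -> : a j.+1 = \int[P]_w I w.
    rewrite /a /Rintegral; congr fine.
    have := @ge0_integral_walkS i (fun s => (F j.+1 s)%:E) _ _.
    rewrite /= => ->; first by apply: eq_integral => w _; rewrite IE.
    - exact/measurable_EFinP.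
    - by move=> s; rewrite lee_fin.
  rewrite /a -RintegralB// (le_trans (le_normr_Rintegral _ _))//.
    exact: integrable_EFinB.
  rewrite -(Rintegral_probability_cst P (heat_step_error k sigma)).
  apply: le_Rintegral => //.
  - apply: integrable_norm; exact: integrable_EFinB.
  - by apply: (@integrable_bounded _ _ _ _ _ `|heat_step_error k sigma|).
  - move=> w _; have t0 : 0 <= (n - j.+1)%:R * delta by rewrite mulr_ge0.
    have := gauss_heat_step i k0 t0 sigma0 (perp_walk j w).
    have -> // : k * ((n - j.+1)%:R * delta) + k * delta = k * ((n - j)%:R * delta).
    by rewrite -(subnSK jn) -natr1; ring.
have tele j : (j <= n)%N -> `|a j - a 0%N| <= j%:R * heat_step_error k sigma.
  elim: j => [_|j IH jn]; first by rewrite subrr normr0 mul0r.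
  rewrite (le_trans (ler_distD (a j) _ _))// -natr1 mulrDl mul1r addrC lerD//.
    exact: IH (ltnW jn).
  exact: step_le.
have an : a n = \int[P]_w expR (- (k * dot (walk n w) (walk n w))).
  by apply: eq_Rintegral => w _; rewrite /F subnn mul0r mulr0 gauss_heat0.
have a0 : a 0%N = gauss_heat m (k * (n%:R * delta)) (k * dot s0 s0).
  rewrite /a; under eq_Rintegral do rewrite walk0.
  by rewrite Rintegral_probability_cst /F subn0.
by rewrite -an -a0; exact: tele.
Qed.

End heat_chain.

(** * Laplace transforms and convergence in law *)

Section gaussian_laplace.
Context {R : realType}.
Variable t : R.
Hypothesis t0 : 0 <= t.
Local Notation lm := (@lebesgue_measure R).

Lemma normal_prob_laplace (mu : R) :
  (\int[normal_prob mu 1]_x (expR (- (t * x ^+ 2)))%:E =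
   (gauss_heat 1 t (t * mu ^+ 2))%:E)%E.
Proof.
pose A : R := 1 + 2 * t.
have A0 : 0 < A by rewrite ltr_pwDl// mulr_ge0.
(* A square root of [1 + 2 t], in exponential form to match [gauss_heat]. Completing the square
   turns the integrand into a multiple of the normal density with mean [mu / A] and standard
   deviation [e^-1]. *)
pose e := expR (ln A / 2).
have e0 : 0 < e by exact: expR_gt0.
have eA : A = e ^+ 2 by rewrite /e expr2 -expRD -splitr lnK.
have mh : measurable_fun setT (fun x : R => (expR (- (t * x ^+ 2)))%:E).
  apply/measurable_EFinP; apply: measurableT_comp => //; apply: measurable_funN.
  by apply: measurable_funM => //; exact: measurable_funX.
have h0 (x : R) : (0 <= (expR (- (t * x ^+ 2)))%:E)%E by rewrite lee_fin expR_ge0.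
have nuE (V : set (measurableTypeR R)) : measurable V ->
    (normal_prob mu 1 V = \int[lm]_x (normal_pdf mu 1 x * \1_V (id x))%:E)%E.
  move=> mV; rewrite /normal_prob [LHS]integral_mkcond; apply: eq_integral => x _.
  by rewrite patchE indicE; case: ifPn => _; rewrite ?mulr1 ?mulr0.
have -> : (\int[normal_prob mu 1]_x (expR (- (t * x ^+ 2)))%:E =
    \int[lm]_x ((normal_pdf mu 1 x)%:E * (expR (- (t * x ^+ 2)))%:E))%E.
  apply: (@ge0_integral_density_map _ _ _ _ _ lm (normal_prob mu 1) id) => //.
  - exact: measurable_normal_pdf.
  - by move=> x; exact: normal_pdf_ge0.
have peakE : normal_peak 1 = e^-1 * normal_peak e^-1 :> R.
  rewrite /normal_peak expr1n mul1r -mulrnAr sqrtrM ?sqr_ge0// sqrtr_sqr.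
  rewrite ger0_norm ?invr_ge0 ?(ltW e0)// invfM invrK.
  by rewrite mulrA mulVf ?mul1r// gt_eqF.
have heatE : gauss_heat 1 t (t * mu ^+ 2) = e^-1 * expR (- (t * mu ^+ 2 / A)).
  by rewrite /gauss_heat -/A /e -expRN -expRD; congr expR; field; rewrite gt_eqF.
have funE x : normal_fun mu 1 x * expR (- (t * x ^+ 2)) =
    expR (- (t * mu ^+ 2 / A)) * normal_fun (mu / A) e^-1 x.
  rewrite /normal_fun -!expRD; congr expR; rewrite exprVn -eA expr1n mulr2n.
  by rewrite -mulr_natl; rewrite /A; field; rewrite gt_eqF.
have E x : normal_pdf mu 1 x * expR (- (t * x ^+ 2)) =
    gauss_heat 1 t (t * mu ^+ 2) * normal_pdf (mu / A) e^-1 x.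
  rewrite !normal_pdfE ?oner_eq0 ?invr_eq0 ?gt_eqF//.
  by rewrite -[LHS]mulrA funE peakE heatE; ring.
under eq_integral do rewrite -EFinM E EFinM.
rewrite ge0_integralZl_EFin ?expR_ge0// ?integral_normal_pdf ?mule1//.
- by move=> x _; rewrite lee_fin normal_pdf_ge0.
- by apply/measurable_EFinP; exact: measurable_normal_pdf.
Qed.

Lemma prod_normal_laplace n (mu : nat -> R) :
  (\int[prod_measure n (fun i => normal_prob (mu i) 1)]_z (expR (- (t * dot z z)))%:E =
   (gauss_heat n%:R t (t * \sum_(i < n) mu i ^+ 2))%:E)%E.
Proof.
have mh k : measurable_fun setT (fun z : 'cV[R]_k => (expR (- (t * dot z z)))%:E).
  apply/measurable_EFinP; apply: measurableT_comp => //; apply: measurable_funN.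
  by apply: measurable_funM => //; exact: measurable_dotxx.
have h0 k (z : 'cV[R]_k) : (0 <= (expR (- (t * dot z z)))%:E)%E by rewrite lee_fin expR_ge0.
elim: n mu => [|n IH] mu.
  rewrite ge0_integral_prod_measure0// dotE !big_ord0 !mulr0 oppr0 expR0.
  by rewrite /gauss_heat !(mul0r, oppr0, subr0) expR0.
rewrite ge0_integral_prod_measureS//.
transitivity (\int[prod_measure n (fun i => normal_prob (mu i.+1) 1)]_y
    ((gauss_heat 1 t (t * mu 0%N ^+ 2))%:E * (expR (- (t * dot y y)))%:E))%E.
  apply: eq_integral => y _.
  rewrite -normal_prob_laplace -ge0_integralZr//; first last.
  - apply/measurable_EFinP; apply: measurableT_comp => //; apply: measurable_funN.
    by apply: measurable_funM => //; exact: measurable_funX.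
  apply: eq_integral => x _.
  by rewrite dot_stack -EFinM -expRD -opprD -mulrDr -expr2.
rewrite ge0_integralZl_EFin ?expR_ge0//; last exact: mh.
rewrite (IH (fun i => mu i.+1)) -EFinM /gauss_heat -expRD.
congr (expR _)%:E.
have A0 : 1 + 2 * t != 0 by rewrite gt_eqF// ltr_pwDl// mulr_ge0.
by rewrite big_ord_recl /= -natr1; field.
Qed.

End gaussian_laplace.

(** * Bernstein polynomials *)

Section bernstein.
Context {R : realType}.
Implicit Types (psi : nat -> R) (u : R).

(* [(bernstein n psi).[u]] is the mean of [psi] under the binomial law [B(n, u)]. *)
Fixpoint bernstein n psi : {poly R} :=
  if n is n'.+1 then (1 - 'X) * bernstein n' psi + 'X * bernstein n' (psi \o S)
  else (psi 0%N)%:P.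

Lemma bernsteinS n psi u : (bernstein n.+1 psi).[u] =
  (1 - u) * (bernstein n psi).[u] + u * (bernstein n (psi \o S)).[u].
Proof. by rewrite /= !hornerE. Qed.

Lemma bernsteinD n psi phi u : (bernstein n (fun k => psi k + phi k)).[u] =
  (bernstein n psi).[u] + (bernstein n phi).[u].
Proof.
elim: n psi phi => [|n IH] psi phi; first by rewrite /= !hornerE.
rewrite !bernsteinS IH (IH (psi \o S) (phi \o S)); ring.
Qed.

Lemma bernsteinZ n (c : R) psi u : (bernstein n (fun k => c * psi k)).[u] =
  c * (bernstein n psi).[u].
Proof.
elim: n psi => [|n IH] psi; first by rewrite /= !hornerE.
rewrite !bernsteinS IH (IH (psi \o S)); ring.
Qed.

Lemma bernstein_cst n (c : R) u : (bernstein n (fun=> c)).[u] = c.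
Proof.
elim: n => [|n IH]; first by rewrite /= !hornerE.
by rewrite bernsteinS !IH; ring.
Qed.

Lemma bernstein_le n psi phi u : 0 <= u <= 1 -> (forall k, psi k <= phi k) ->
  (bernstein n psi).[u] <= (bernstein n phi).[u].
Proof.
move=> /andP[u0 u1]; elim: n psi phi => [|n IH] psi phi psiphi.
  by rewrite /= !hornerE.
by rewrite !bernsteinS lerD// ler_wpM2l ?subr_ge0//; apply: IH => k; exact: psiphi.
Qed.

(** Variance plus squared bias of the binomial law; the recursion on [n] moves the centre [a] by
    one. *)
Lemma bernstein_sqr n (a : R) u : (bernstein n (fun k => (k%:R - a) ^+ 2)).[u] =
  n%:R * u * (1 - u) + (n%:R * u - a) ^+ 2.
Proof.
elim: n a => [|n IH] a; first by rewrite /= !hornerE; ring.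
rewrite bernsteinS IH.
rewrite (_ : _ \o S = (fun k => (k%:R - (a - 1)) ^+ 2)); last first.
  by apply/funext => k /=; rewrite -natr1; ring.
by rewrite IH -natr1; ring.
Qed.

Lemma unif_continuous01 (phi : R -> R) (e : R) : continuous phi -> 0 < e ->
  exists2 delta, 0 < delta &
    forall x y, 0 <= x <= 1 -> `|x - y| < delta -> `|phi x - phi y| < e.
Proof.
move=> cphi e0.
have /compact_near_coveringP H := @segment_compact R 0 1.
pose Q (delta x : R) := forall y, `|x - y| < delta -> `|phi x - phi y| < e.
have : \forall delta \near (0 : R)^'+, `[0, 1]%classic `<=` Q delta.
  apply: H => x _.
  have : \forall t \near x, `|phi x - phi t| < e / 2.
    by move/cvgrPdist_lt : (cphi x); apply; rewrite divr_gt0.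
  move=> /nbhs_ballP[eta /= eta0 Heta].
  exists (ball x (eta / 2), [set d | d < eta / 2]) => /=.
    split; first by apply: nbhsx_ballx; rewrite divr_gt0.
    by apply: nbhs_right_lt; rewrite divr_gt0.
  move=> [x' i] /= [xx' ieta] y x'y.
  have h1 : `|phi x - phi x'| < e / 2.
    by apply: Heta; apply: le_ball xx'; rewrite ler_pdivrMr// ler_peMr ?ler1n// ltW.
  have h2 : `|phi x - phi y| < e / 2.
    apply: Heta; rewrite /ball/= [eta]splitr (le_lt_trans (ler_distD x' _ _))// ltrD//.
    exact: lt_trans x'y ieta.
  by rewrite (le_lt_trans (ler_distD (phi x) _ _))// [e]splitr ltrD// distrC.
move=> Hd.
have [delta [d0 dQ]] : exists delta : R, 0 < delta /\ `[0, 1]%classic `<=` Q delta.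
  apply: (@filter_ex _ (0 : R)^'+); near=> delta; split; last by near: delta.
  by near: delta; exact: nbhs_right_gt.
by exists delta => // x y x01; apply: dQ; rewrite /= in_itv.
Unshelve. all: by end_near. Qed.

(** Chebyshev's argument: [T k] dominates the oscillation pointwise, by uniform continuity near [u]
    and by the quadratic term elsewhere, and its binomial mean is computed exactly. [K] is the
    threshold from which that quadratic part costs at most [e / 2]. *)
Lemma bernstein_approx (phi : R -> R) (M e : R) : continuous phi ->
  (forall x, `|phi x| <= M) -> 0 < e ->
  exists n, forall u, 0 <= u <= 1 ->
    `|(bernstein n (fun k => phi (k%:R / n%:R))).[u] - phi u| <= e.
Proof.
move=> cphi phiM e0.
have [delta delta0 ud] := unif_continuous01 cphi (divr_gt0 e0 (ltr0Sn R 1)).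
have M0 : 0 <= M by exact: le_trans (phiM 0).
pose K := 4 * M / (e * delta ^+ 2).
have K0 : 0 <= K by rewrite divr_ge0 ?mulr_ge0 ?sqr_ge0// ltW.
pose n := (Num.truncn K).+1.
have nK : K < n%:R by exact: truncnS_gt.
have n0 : 0 < n%:R :> R by rewrite ltr0n.
exists n => u u01; have /andP[u0 u1] := u01.
pose T k := e / 2 + 2 * M / delta ^+ 2 / n%:R ^+ 2 * (k%:R - n%:R * u) ^+ 2.
have psi_le k : `|phi (k%:R / n%:R) - phi u| <= T k.
  have [ku|ku] := ltP `|u - k%:R / n%:R| delta.
    rewrite distrC (le_trans (ltW (ud _ _ u01 ku)))// lerDl.
    by apply: mulr_ge0; rewrite ?sqr_ge0// divr_ge0 ?sqr_ge0// divr_ge0 ?sqr_ge0// mulr_ge0.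
  rewrite (le_trans (ler_normB _ _))// (le_trans (lerD (phiM _) (phiM _)))//.
  have -> : T k = e / 2 + 2 * M * (`|u - k%:R / n%:R| ^+ 2 / delta ^+ 2).
    by rewrite /T real_normK ?num_real//; field; rewrite !gt_eqF.
  have d1 : 1 <= `|u - k%:R / n%:R| ^+ 2 / delta ^+ 2.
    by rewrite ler_pdivlMr ?exprn_gt0// mul1r lerXn2r// nnegrE ltW.
  have := ler_wpM2l (mulr_ge0 (ler0n _ 2) M0) d1; lra.
have TE : (bernstein n T).[u] <= e.
  rewrite bernsteinD bernstein_cst bernsteinZ bernstein_sqr subrr expr0n addr0.
  have -> : 2 * M / delta ^+ 2 / n%:R ^+ 2 * (n%:R * u * (1 - u)) =
      2 * M / (delta ^+ 2 * n%:R) * (u * (1 - u)) by field; rewrite !gt_eqF.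
  have KE : 2 * M / (delta ^+ 2 * n%:R) <= e / 2.
    rewrite ler_pdivrMr ?mulr_gt0 ?exprn_gt0//.
    have : K * (e * delta ^+ 2) = 4 * M by rewrite /K; field; rewrite !gt_eqF.
    have := ltW nK; rewrite -(ler_pM2r (_ : 0 < e * delta ^+ 2)) ?mulr_gt0 ?exprn_gt0//.
    lra.
  have uu : u * (1 - u) <= 1 by nra.
  have C0 : 0 <= 2 * M / (delta ^+ 2 * n%:R).
    by apply: divr_ge0; apply: mulr_ge0 => //; exact: sqr_ge0.
  have := ler_wpM2l C0 uu; lra.
have phiE : (bernstein n (fun k => phi (k%:R / n%:R))).[u] - phi u =
    (bernstein n (fun k => phi (k%:R / n%:R) + - phi u)).[u].
  by rewrite bernsteinD bernstein_cst.
rewrite phiE ler_norml; apply/andP; split.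
  rewrite (@le_trans _ _ (- 1 * (bernstein n T).[u]))//; first by rewrite mulN1r lerN2.
  rewrite -bernsteinZ; apply: bernstein_le => // k; rewrite mulN1r.
  by have := psi_le k; rewrite ler_norml => /andP[].
apply: le_trans TE; apply: bernstein_le => // k.
by have := psi_le k; rewrite ler_norml => /andP[].
Qed.

End bernstein.

(** * Convergence in law from Laplace transforms at the integers *)

Section laplace_cvg.
Context {R : realType} (d : nat -> measure_display)
  (Omega : forall n, measurableType (d n)) (P : forall n, probability (Omega n) R)
  (Y : forall n, Omega n -> R).
Context {d' : measure_display} {T : measurableType d'} (Q : probability T R) (Z : T -> R).
Hypotheses (mY : forall n, measurable_fun setT (@Y n)) (Y0 : forall n w, 0 <= @Y n w).
Hypotheses (mZ : measurable_fun setT Z) (Z0 : forall w, 0 <= Z w).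
Hypothesis laplace : forall k : nat,
  \int[P n]_w expR (- (k%:R * @Y n w)) @[n --> \oo] --> \int[Q]_w expR (- (k%:R * Z w)).

Let good (h : R -> R) := \int[P n]_w h (@Y n w) @[n --> \oo] --> \int[Q]_w h (Z w).

(** Boundedness is asked on the half-line where the variables live, since [exp (- k x)] is unbounded
    for negative [x]. *)
Let bnd (h : R -> R) := measurable_fun setT h /\ exists M, forall x, 0 <= x -> `|h x| <= M.

Let intY h n : bnd h -> (P n).-integrable setT (EFin \o (fun w => h (@Y n w))).
Proof.
move=> [mh [M hM]]; apply: (@integrable_bounded _ _ _ _ _ M); last by move=> w; exact: hM.
exact: measurableT_comp.
Qed.

Let intZ h : bnd h -> Q.-integrable setT (EFin \o (fun w => h (Z w))).
Proof.
move=> [mh [M hM]]; apply: (@integrable_bounded _ _ _ _ _ M); last by move=> w; exact: hM.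
exact: measurableT_comp.
Qed.

Let pexp (p : {poly R}) x := p.[expR (- x)].

Let bnd_good h := bnd h /\ good h.

Let bnd_goodD h k : bnd_good h -> bnd_good k -> bnd_good (fun x => h x + k x).
Proof.
move=> [bh gh] [bk gk]; split.
  case: bh bk => [mh [M hM]] [mk [N kN]]; split; first exact: measurable_funD.
  by exists (M + N) => x x0; rewrite (le_trans (ler_normD _ _))// lerD ?hM ?kN.
rewrite /good RintegralD//; [|exact: intZ|exact: intZ].
under eq_fun do rewrite (RintegralD measurableT (intY _ bh) (intY _ bk)).
exact: cvgD.
Qed.

Let bnd_goodZ c h : bnd_good h -> bnd_good (fun x => c * h x).
Proof.
move=> [bh gh]; split.
  case: bh => [mh [M hM]]; split; first exact: measurable_funM.
  by exists (`|c| * M) => x x0; rewrite normrM ler_wpM2l// hM.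
rewrite /good RintegralZl//; last exact: intZ.
under eq_fun do rewrite (RintegralZl c measurableT (intY _ bh)).
exact: cvgMr.
Qed.

Let bnd_good_expR (k : nat) : bnd_good (fun x => expR (- (k%:R * x))).
Proof.
split; last exact: laplace.
split; first by apply: measurableT_comp => //; apply: measurable_funN; exact: measurable_funM.
by exists 1 => x x0; rewrite ger0_norm ?expR_ge0// expR_le1 oppr_le0 mulr_ge0.
Qed.

Let bnd_good_pexp p : bnd_good (pexp p).
Proof.
have -> : pexp p = fun x => \sum_(i < size p) p`_i * expR (- (i%:R * x)).
  apply/funext => x; rewrite /pexp horner_coef; apply: eq_bigr => i _.
  by rewrite -mulrN expRM_natl.
elim: (size p) => [|n IH].
  rewrite (_ : (fun _ => _) = (fun x => 0 * expR (- (0%:R * x)))); first exact: bnd_goodZ.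
  by apply/funext => x; rewrite big_ord0 mul0r.
under eq_fun do rewrite big_ord_recr /=.
by apply: bnd_goodD => //; exact: bnd_goodZ.
Qed.

Let good_approx h : bnd h ->
  (forall e, 0 < e -> exists2 h', bnd h' /\ good h' & forall x, 0 <= x -> `|h x - h' x| <= e) ->
  good h.
Proof.
move=> bh appr; apply/cvgrPdist_le => e e0.
have [h' [bh' gh'] hh'] := appr (e / 3) (divr_gt0 e0 (ltr0Sn _ _)).
have /cvgrPdist_le/(_ (e / 3) (divr_gt0 e0 (ltr0Sn _ _))) := gh'.
apply: filterS => n close.
have b1 : `|\int[Q]_w h (Z w) - \int[Q]_w h' (Z w)| <= e / 3.
  rewrite -RintegralB//; [|exact: intZ|exact: intZ].
  rewrite (le_trans (le_normr_Rintegral _ _))//; first by apply: integrable_EFinB; exact: intZ.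
  rewrite -(Rintegral_probability_cst Q (e / 3)); apply: le_Rintegral => //.
  - by apply: integrable_norm; apply: integrable_EFinB; exact: intZ.
  - by apply: (@integrable_bounded _ _ _ _ _ `|e / 3|).
  - by move=> w _; exact: hh'.
have b2 : `|\int[P n]_w h' (@Y n w) - \int[P n]_w h (@Y n w)| <= e / 3.
  rewrite -RintegralB//; [|exact: intY|exact: intY].
  rewrite (le_trans (le_normr_Rintegral _ _))//; first by apply: integrable_EFinB; exact: intY.
  rewrite -(Rintegral_probability_cst (P n) (e / 3)); apply: le_Rintegral => //.
  - by apply: integrable_norm; apply: integrable_EFinB; exact: intY.
  - by apply: (@integrable_bounded _ _ _ _ _ `|e / 3|).
  - by move=> w _; rewrite distrC; exact: hh'.
rewrite (le_trans (ler_distD (\int[Q]_w h' (Z w)) _ _))//.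
rewrite (le_trans (lerD b1 (ler_distD (\int[P n]_w h' (@Y n w)) _ _)))//.
by move: close b2; lra.
Qed.

Let good_continuous01 (phi : R -> R) M : continuous phi -> (forall x, `|phi x| <= M) ->
  good (fun x => phi (expR (- x))).
Proof.
move=> cphi phiM.
have bphi : bnd (fun x => phi (expR (- x))).
  split; last by exists M => x _.
  apply: measurableT_comp; first exact: continuous_measurable_fun.
  exact: measurableT_comp.
apply: good_approx => // e e0.
have [n Hn] := bernstein_approx cphi phiM e0.
exists (pexp (bernstein n (fun k => phi (k%:R / n%:R)))).
  exact: bnd_good_pexp.
move=> x x0; rewrite distrC; apply: Hn.
by rewrite expR_ge0/= expR_le1 oppr_le0.
Qed.

(* [cutoff L x] is a continuous function of [expR (- x)] vanishing at 0, i.e. at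
   [x = +oo], and tends to 1 as [L] tends to infinity. *)
Let cutoff (L u : R) := Num.min 1 (L * u).

(** In the variable [u = exp (- x)], [g] may oscillate as [u] tends to 0; the cutoff kills this, and
    the extension by 0 gives a continuous function on the whole line, ready for Bernstein
    approximation. *)
Let cutoffed (g : R -> R) L u := if u <= 0 then 0 else g (- ln u) * cutoff L u.

Let cutoff01 L u : 0 <= L -> 0 < u -> 0 <= cutoff L u <= 1.
Proof.
by move=> L0 u0; rewrite /cutoff le_min ler01 ge_min lexx mulr_ge0// ltW.
Qed.

Let cutoffed_le g M L u : 0 <= L -> (forall x, `|g x| <= M) -> `|cutoffed g L u| <= M.
Proof.
move=> L0 gM; rewrite /cutoffed; case: (leP u 0) => u0.
  by rewrite normr0 (le_trans _ (gM 0)).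
have /andP[c0 c1] := cutoff01 L0 u0.
by rewrite normrM (le_trans _ (gM (- ln u)))// ler_piMr// ger0_norm.
Qed.

Let continuous_cutoffed (g : R -> R) M L : continuous g -> (forall x, `|g x| <= M) ->
  0 <= L -> continuous (cutoffed g L).
Proof.
move=> cg gM L0 u; have M0 : 0 <= M := le_trans (normr_ge0 _) (gM 0).
rewrite /continuous_at; have [u0|u0|->] := ltgtP u 0.
- have E : \forall v \near u, 0 = cutoffed g L v.
    near=> v; rewrite /cutoffed ifT// ltW//; near: v; exact: lt_nbhsl.
  have -> : cutoffed g L u = 0 by rewrite /cutoffed ltW.
  by apply: cvg_trans (near_eq_cvg E) _; exact: cvg_cst.
- have E : \forall v \near u, g (- ln v) * cutoff L v = cutoffed g L v.
    near=> v; rewrite /cutoffed ifF//; apply/negbTE; rewrite -ltNge; near: v.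
    exact: lt_nbhsr.
  have -> : cutoffed g L u = g (- ln u) * cutoff L u by rewrite /cutoffed leNgt u0.
  apply: cvg_trans (near_eq_cvg E) _; apply: cvgM.
    apply: (@continuous_comp _ _ _ (fun v => - ln v) g); last exact: cg.
    by apply: cvgN; exact: continuous_ln.
  apply: (@continuous_min _ _ (cst 1) ( *%R L)); first exact: cvg_cst.
  exact: mulrl_continuous.
have -> : cutoffed g L 0 = 0 by rewrite /cutoffed lexx.
apply/cvgrPdist_le => e e0.
have ML0 : 0 < M * L + 1 by rewrite ltr_wpDl// mulr_ge0.
have : \forall v \near (0 : R), `|v| < e / (M * L + 1).
  apply/nbhs_ballP; exists (e / (M * L + 1)) => /=; first by rewrite divr_gt0.
  by move=> v; rewrite /ball/= sub0r normrN.
apply: filterS => v ve; rewrite sub0r normrN /cutoffed; case: (leP v 0) => v0.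
  by rewrite normr0 ltW.
have /andP[c0 _] := cutoff01 L0 v0.
have cv : cutoff L v <= L * v by rewrite /cutoff ge_min lexx orbT.
rewrite normrM (ger0_norm c0) (le_trans (ler_pM _ _ (gM _) cv))//.
rewrite gtr0_norm// ltr_pdivlMr// in ve.
rewrite mulrA; move: (ltW ve); rewrite mulrDr mulr1 => h.
by rewrite (le_trans _ h)// mulrC lerDl ltW.
Unshelve. all: by end_near. Qed.

Let cut g L x := cutoffed g L (expR (- x)).

Let cutE g L x : cut g L x = g x * cutoff L (expR (- x)).
Proof. by rewrite /cut /cutoffed leNgt expR_gt0/= expRK opprK. Qed.

Let bnd_good_cut (g : R -> R) M L : continuous g -> (forall x, `|g x| <= M) ->
  0 <= L -> bnd_good (cut g L).
Proof.
move=> cg gM L0; split.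
  split; last by exists M => x _; exact: cutoffed_le.
  apply: measurableT_comp; first by apply: continuous_measurable_fun; exact: continuous_cutoffed cg gM L0.
  exact: measurableT_comp.
by apply: good_continuous01 (continuous_cutoffed cg gM L0) _ => x; exact: cutoffed_le.
Qed.

Let cut1_lim : \int[Q]_w cut (fun=> 1) k%:R (Z w) @[k --> \oo] --> (1 : R).
Proof.
have m1 k : measurable_fun setT (fun w => (cut (fun=> 1) k%:R (Z w))%:E).
  apply/measurable_EFinP; apply: measurableT_comp mZ.
  have c1 : continuous (fun _ : R => 1 : R) by exact: cst_continuous.
  have l1 (x : R) : `|1 : R| <= 1 by rewrite normr1.
  exact: (bnd_good_cut c1 l1 (ler0n R k)).1.1.
have [|||||_ _] := @dominated_convergence _ _ _ Q setT measurableT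
  (fun k w => (cut (fun=> 1) k%:R (Z w))%:E) (cst 1%E) (cst 1%E).
- exact: m1.
- exact: measurable_cst.
- apply: aeW => w _ /=; apply/fine_cvgP; split; first exact: nearW.
  have E : \forall k \near \oo, (1 : R) = fine (cut (fun=> 1) k%:R (Z w))%:E.
    near=> k; rewrite /= cutE mul1r /cutoff; apply/esym/min_idPl.
    rewrite expRN ler_pdivlMr ?expR_gt0// mul1r; near: k; exact: nbhs_infty_ger.
  by apply: cvg_trans (near_eq_cvg E) _; exact: cvg_cst.
- have := @integrable_bounded _ _ _ Q (fun=> 1 : R) 1 (measurable_cst _).
  by apply=> x; rewrite normr1.
- apply: aeW => w k _ /=; rewrite lee_fin cutE mul1r.
  by have /andP[c0 c1] := cutoff01 (ler0n R k) (expR_gt0 (- Z w)); rewrite ger0_norm.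
rewrite integral_probability_cst => /fine_cvg; apply.
Unshelve. all: by end_near. Qed.

(** Tightness is not assumed: the cutoff itself is a continuous function of [exp (- x)], so the mass
    it removes under [P n] converges to the mass it removes under [Q], which is small for large
    [k]. *)
Lemma laplace_cvg (g : R -> R) : continuous g -> bounded_fun g ->
  \int[P n]_w g (@Y n w) @[n --> \oo] --> \int[Q]_w g (Z w).
Proof.
move=> cg [M0 [_ gM0]].
pose M := `|M0| + 1.
have gM x : `|g x| <= M by apply: gM0 => //; rewrite (le_lt_trans (ler_norm _))// ltrDl.
have Mp : 0 < M by rewrite ltr_wpDl.
have bg : bnd g by split; [exact: continuous_measurable_fun|exists M].
apply/cvgrPdist_le => e e0.
have e4 : 0 < e / 4 by rewrite divr_gt0.
have e4M : 0 < e / 4 / M by rewrite divr_gt0.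
(* Four errors of [e / 4]: the cutoff under [Q], the comparison of the truncated integrals of [g],
   and two for the cutoff under [P n], whose removed mass is compared with that under [Q]. *)
have [k Hk] : exists k : nat, `|1 - \int[Q]_w cut (fun=> 1) k%:R (Z w)| <= e / 4 / M.
  by apply: (@filter_ex _ \oo); move/cvgrPdist_le : cut1_lim; exact.
have [bc gc] : bnd_good (cut (fun=> 1) k%:R).
  by apply: (@bnd_good_cut _ 1) => //; [move=> x; exact: cvg_cst|move=> x; rewrite normr1].
have [bh gh] := bnd_good_cut cg gM (ler0n R k).
have gcut x : `|g x - cut g k%:R x| <= M * (1 - cut (fun=> 1) k%:R x).
  rewrite !cutE mul1r -[X in `|X - _|]mulr1 -mulrBr normrM.
  have /andP[c0 c1] := cutoff01 (ler0n R k) (expR_gt0 (- x)).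
  by rewrite [X in _ * X <= _]ger0_norm ?subr_ge0// ler_wpM2r ?subr_ge0.
have bone : bnd (fun=> 1 : R) by split=> //; exists 1 => x _; rewrite normr1.
have bMc : bnd (fun x => M * (1 - cut (fun=> 1) k%:R x)).
  split; first by apply: measurable_funM => //; apply: measurable_funB => //; exact: bc.1.
  exists M => x _; rewrite cutE mul1r.
  have /andP[c0 c1] := cutoff01 (ler0n R k) (expR_gt0 (- x)).
  by rewrite normrM (gtr0_norm Mp) ler_piMr ?(ltW Mp)// ger0_norm ?subr_ge0// gerBl.
have E1 : `|\int[Q]_w g (Z w) - \int[Q]_w cut g k%:R (Z w)| <=
    M * (1 - \int[Q]_w cut (fun=> 1) k%:R (Z w)).
  rewrite -RintegralB//; [|exact: intZ|exact: intZ].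
  rewrite (le_trans (le_normr_Rintegral _ _))//; first by apply: integrable_EFinB; exact: intZ.
  rewrite -{2}(Rintegral_probability_cst Q 1) -RintegralB//; [|exact: (intZ bone)|exact: intZ].
  rewrite -RintegralZl//; last by apply: integrable_EFinB; [exact: (intZ bone)|exact: intZ].
  apply: le_Rintegral => //; last by exact: (intZ bMc).
  by apply: integrable_norm; apply: integrable_EFinB; exact: intZ.
near=> n.
have E2 : `|\int[P n]_w g (@Y n w) - \int[P n]_w cut g k%:R (@Y n w)| <=
    M * (1 - \int[P n]_w cut (fun=> 1) k%:R (@Y n w)).
  rewrite -RintegralB//; [|exact: intY|exact: intY].
  rewrite (le_trans (le_normr_Rintegral _ _))//; first by apply: integrable_EFinB; exact: intY.
  rewrite -{2}(Rintegral_probability_cst (P n) 1) -RintegralB//; [|exact: (intY _ bone)|exact: intY].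
  rewrite -RintegralZl//; last by apply: integrable_EFinB; [exact: (intY _ bone)|exact: intY].
  apply: le_Rintegral => //; last by exact: (intY _ bMc).
  by apply: integrable_norm; apply: integrable_EFinB; exact: intY.
have E3 : `|\int[Q]_w cut (fun=> 1) k%:R (Z w) - \int[P n]_w cut (fun=> 1) k%:R (@Y n w)| <= e / 4 / M.
  by near: n; move/cvgrPdist_le : gc; exact.
have E4 : `|\int[Q]_w cut g k%:R (Z w) - \int[P n]_w cut g k%:R (@Y n w)| <= e / 4.
  by near: n; move/cvgrPdist_le : gh; exact.
move: E1 E2 E3 E4 Hk.
set a := \int[Q]_w g (Z w); set b := \int[Q]_w cut g k%:R (Z w).
set a' := \int[P n]_w g (@Y n w); set b' := \int[P n]_w cut g k%:R (@Y n w).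
set c := \int[Q]_w cut (fun=> 1) k%:R (Z w); set c' := \int[P n]_w _.
move=> E1 E2 E3 E4 Hk.
have Mc : M * (1 - c) <= e / 4.
  by rewrite mulrC -ler_pdivlMr// (le_trans (ler_norm _)).
have Mc' : M * (c - c') <= e / 4.
  by rewrite mulrC -ler_pdivlMr// (le_trans (ler_norm _)).
rewrite (le_trans (ler_distD b _ _))// (le_trans (lerD E1 (ler_distD b' _ _)))//.
rewrite (distrC b' a') (le_trans (lerD (lexx _) (lerD E4 E2)))//.
move: Mc Mc'; rewrite !mulrBr; lra.
Unshelve. all: by end_near. Qed.

End laplace_cvg.

(** * Local asymptotics of the test statistics *)

Section in_probability.
Context {R : realType} (d : nat -> measure_display)
  (Omega : forall n, measurableType (d n)) (P : forall n, probability (Omega n) R).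

Lemma markov_ge0 n (D : Omega n -> R) (c eta : R) : measurable_fun setT D ->
  (forall w, 0 <= D w) -> 0 < eta -> (\int[P n]_w (D w)%:E <= c%:E)%E ->
  (P n [set w | (eta <= D w)%R] <= (c / eta)%:E)%E.
Proof.
move=> mD D0 eta0 Dc.
have := @le_integral_abse _ _ R (P n) setT measurableT (EFin \o D) eta.
rewrite setTI => H.
rewrite EFinM lee_pdivlMr// muleC; apply: le_trans Dc.
have -> : (\int[P n]_w (D w)%:E = \int[P n]_w `|(EFin \o D) w|)%E.
  by apply: eq_integral => w _; rewrite /= ger0_norm.
have -> : [set w | eta <= D w] = [set w | (eta%:E <= `|(EFin \o D) w|)%E].
  by apply/seteqP; split=> w /=; rewrite lee_fin ger0_norm.
apply: H => //; exact/measurable_EFinP.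
Qed.

(** Separates probability from geometry: a bound valid when [D] is small and [S] bounded becomes
    convergence in probability once [D] tends to 0 in mean and [S] is bounded in mean. Markov's
    inequality is the only probabilistic input. *)
Lemma oP1_small_tight (Y D S : forall n, Omega n -> R) (dn : nat -> R) (C : R) :
  (forall n, measurable_fun setT (@Y n)) ->
  (forall n, measurable_fun setT (@D n)) -> (forall n, measurable_fun setT (@S n)) ->
  (forall n w, 0 <= @D n w) -> (forall n w, 0 <= @S n w) ->
  (\forall n \near \oo, \int[P n]_w (@D n w)%:E <= (dn n)%:E)%E ->
  dn n @[n --> \oo] --> 0 ->
  (\forall n \near \oo, \int[P n]_w (@S n w)%:E <= C%:E)%E ->
  (forall M e, 0 < M -> 0 < e -> exists2 eta, 0 < eta & \forall n \near \oo,
    {ae P n, forall w, @D n w <= eta -> @S n w <= M -> `|@Y n w| <= e}) ->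
  oP1 P Y.
Proof.
move=> mY mD mS D0 S0 ED dn0 ES H e e0.
apply/fine_cvgP; split.
  apply: nearW => n; apply: fin_num_measure.
  rewrite -[X in measurable X]setTI; apply: measurable_fun_ltr => //.
  exact: measurableT_comp.
apply/cvgrPdist_le => om om0.
(* Half of the probability [om] is spent on large [S], the other half on large [D]. *)
pose M := 2 * (`|C| + 1) / om.
have M0 : 0 < M by rewrite divr_gt0// mulr_gt0// ltr_wpDl.
have [eta eta0 Hn] := H M e M0 e0.
have eo : 0 < eta * om / 2 by rewrite divr_gt0// mulr_gt0.
near=> n.
have mB : measurable [set w | e < `|@Y n w|].
  rewrite -[X in measurable X]setTI; apply: measurable_fun_ltr => //.
  exact: measurableT_comp.
have mB1 : measurable [set w | eta <= @D n w].
  by rewrite -[X in measurable X]setTI; apply: measurable_fun_ler.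
have mB2 : measurable [set w | M <= @S n w].
  by rewrite -[X in measurable X]setTI; apply: measurable_fun_ler.
have [N [mN N0 subN]] : {ae P n, forall w, @D n w <= eta -> @S n w <= M -> `|@Y n w| <= e}.
  by near: n.
have dneta : dn n <= eta * om / 2.
  near: n; move/cvgrPdist_le : dn0 => /(_ _ eo); apply: filterS => n.
  by rewrite sub0r normrN => /(le_trans (ler_norm _)).
have P1 : (P n [set w | (eta <= @D n w)%R] <= (dn n / eta)%:E)%E.
  by apply: markov_ge0 => //; near: n.
have P2 : (P n [set w | (M <= @S n w)%R] <= (C / M)%:E)%E.
  by apply: markov_ge0 => //; near: n.
have sub : [set w | e < `|@Y n w|] `<=`
    ([set w | eta <= @D n w] `|` [set w | M <= @S n w]) `|` N.
  move=> w /= eY; have [|Dw] := leP eta (@D n w); first by left; left.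
  have [|Sw] := leP M (@S n w); first by left; right.
  right; apply: subN => /= h; have := h (ltW Dw) (ltW Sw).
  by rewrite leNgt eY.
have le1 : (P n [set w | (e < `|@Y n w|)%R] <= (dn n / eta)%:E + (C / M)%:E)%E.
  apply: (@le_trans _ _ (P n (([set w | eta <= @D n w] `|` [set w | M <= @S n w]) `|` N))).
    by apply: le_measure; rewrite ?inE//; do 2 apply: measurableU => //.
  rewrite measureU0//; last exact: measurableU.
  apply: (@le_trans _ _ (P n [set w | (eta <= @D n w)%R] + P n [set w | (M <= @S n w)%R])%E).
    exact: measureU2.
  exact: leeD.
rewrite sub0r normrN ger0_norm ?fine_ge0// -lee_fin fineK ?fin_num_measure//.
rewrite (le_trans le1)// -EFinD lee_fin.
have h1 : dn n / eta <= om / 2 by rewrite ler_pdivrMr//; lra.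
have h2 : C / M <= om / 2.
  rewrite ler_pdivrMr// /M; apply: (@le_trans _ _ (`|C| + 1)).
    by rewrite (le_trans (ler_norm _))// lerDl.
  by rewrite le_eqVlt; apply/orP; left; apply/eqP; field; rewrite gt_eqF.
by rewrite [om]splitr lerD.
Unshelve. all: by end_near. Qed.

(** On the half-line [exp (- k x)] is Lipschitz with constant [k] and takes values in [[0, 1]]: the
    first handles the event where [Y] and [Z] are close, the second its complement. *)
Lemma laplace_oP1 (Y Z : forall n, Omega n -> R) (k l : R) :
  (forall n, measurable_fun setT (@Y n)) -> (forall n, measurable_fun setT (@Z n)) ->
  (forall n w, 0 <= @Y n w) -> (forall n w, 0 <= @Z n w) ->
  oP1 P (fun n w => @Y n w - @Z n w) -> 0 <= k ->
  \int[P n]_w expR (- (k * @Z n w)) @[n --> \oo] --> l ->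
  \int[P n]_w expR (- (k * @Y n w)) @[n --> \oo] --> l.
Proof.
move=> mY mZ Y0 Z0 YZ k0 Zl.
have mE (U : forall n, Omega n -> R) n : measurable_fun setT (@U n) ->
    measurable_fun setT (fun w => expR (- (k * @U n w))).
  move=> mU; apply: measurableT_comp => //; apply: measurable_funN.
  exact: measurable_funM.
have e01 (U : forall n, Omega n -> R) n w : (forall w, 0 <= @U n w) ->
    0 <= expR (- (k * @U n w)) <= 1.
  by move=> U0; rewrite expR_ge0 expR_le1 oppr_le0 mulr_ge0.
have iE (U : forall n, Omega n -> R) n : measurable_fun setT (@U n) -> (forall w, 0 <= @U n w) ->
    (P n).-integrable setT (EFin \o (fun w => expR (- (k * @U n w)))).
  move=> mU U0; apply: (@integrable_bounded _ _ _ _ _ 1); first exact: mE.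
  by move=> w; have /andP[h0 h1] := e01 U n w U0; rewrite ger0_norm.
have lip (x y : R) : 0 <= x -> 0 <= y ->
    expR (- (k * x)) - expR (- (k * y)) <= k * `|x - y|.
  move=> x0 y0; have [xy|xy] := leP x y; last first.
    rewrite (@le_trans _ _ 0) ?mulr_ge0// subr_le0 ler_expR lerN2 ler_wpM2l//.
    exact: ltW.
  rewrite distrC ger0_norm ?subr_ge0//.
  have -> : expR (- (k * x)) - expR (- (k * y)) =
      expR (- (k * x)) * (1 - expR (- (k * (y - x)))).
    by rewrite mulrBr mulr1 -expRD; congr (_ - expR _); ring.
  have h1 := expR_ge1Dx (- (k * (y - x))).
  have h2 : expR (- (k * x)) <= 1 by rewrite expR_le1 oppr_le0 mulr_ge0.
  have h3 : 0 <= 1 - expR (- (k * (y - x))).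
    by rewrite subr_ge0 expR_le1 oppr_le0 mulr_ge0// subr_ge0.
  by rewrite (le_trans (ler_piMl h3 h2))//; lra.
apply/cvgrPdist_le => e e0.
(* Dividing by [k + 1] rather than by [k] keeps [k = 0] admissible. *)
pose eta := e / 3 / (k + 1).
have k1 : 0 < k + 1 by rewrite ltr_wpDl.
have eta0 : 0 < eta by rewrite !divr_gt0.
have e3 : 0 < e / 3 by rewrite divr_gt0.
have YZ0 := YZ eta eta0.
have fYZ : \forall n \near \oo, fine (P n [set w | eta < `|@Y n w - @Z n w|]) <= e / 3.
  have /fine_cvgP[_ /cvgrPdist_le/(_ _ e3)] := YZ0; apply: filterS => n.
  by rewrite sub0r normrN /= => /(le_trans (ler_norm _)).
near=> n.
have mB : measurable [set w | eta < `|@Y n w - @Z n w|].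
  rewrite -[X in measurable X]setTI; apply: measurable_fun_ltr => //.
  by apply: measurableT_comp => //; exact: measurable_funB.
have close : `|\int[P n]_w expR (- (k * @Y n w)) - \int[P n]_w expR (- (k * @Z n w))| <= e / 3 + e / 3.
  rewrite -RintegralB//; [|exact: iE|exact: iE].
  rewrite (le_trans (le_normr_Rintegral _ _))//; first by apply: integrable_EFinB; exact: iE.
  have iI : (P n).-integrable setT (EFin \o \1_[set w | eta < `|@Y n w - @Z n w|]).
    apply: (@integrable_bounded _ _ _ _ _ 1); first exact: measurable_indic.
    by move=> w; rewrite indicE; case: (_ \in _); rewrite ?normr1 ?normr0.
  apply: (@le_trans _ _ (\int[P n]_w (e / 3 + \1_[set w | eta < `|@Y n w - @Z n w|] w))).
    apply: le_Rintegral => //.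
    - by apply: integrable_norm; apply: integrable_EFinB; exact: iE.
    - apply: integrable_EFinD => //.
      by apply: (@integrable_bounded _ _ _ _ _ `|e / 3|).
    move=> w _; rewrite indicE; have [w1|w1] := boolP (_ \in _).
      rewrite (@le_trans _ _ 1) ?lerDr ?(ltW e3)// ler_norml.
      have /andP[a0 a1] := e01 Y n w (@Y0 n); have /andP[b0 b1] := e01 Z n w (@Z0 n).
      by apply/andP; split; lra.
    have {}w1 : `|@Y n w - @Z n w| <= eta.
      by rewrite leNgt; apply/negP => h; move/negP : w1; apply; rewrite inE.
    rewrite addr0; have ke : k * `|@Y n w - @Z n w| <= e / 3.
      apply: (@le_trans _ _ ((k + 1) * eta)).
        by rewrite ler_pM// lerDl.
      by rewrite /eta mulrC divfK// gt_eqF.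
    apply: le_trans ke; rewrite ler_norml; apply/andP; split.
      by rewrite lerNl opprB distrC lip.
    exact: lip.
  rewrite RintegralD//; last by apply: (@integrable_bounded _ _ _ _ _ `|e / 3|).
  rewrite Rintegral_probability_cst lerD2l.
  rewrite /Rintegral integral_indic// setIT; near: n.
  exact: fYZ.
have lZ : `|l - \int[P n]_w expR (- (k * @Z n w))| <= e / 3.
  by near: n; move/cvgrPdist_le : Zl => /(_ _ e3).
rewrite (le_trans (ler_distD (\int[P n]_w expR (- (k * @Z n w))) _ _))//.
rewrite distrC in close; rewrite (le_trans (lerD lZ close))// le_eqVlt.
by apply/orP; left; apply/eqP; field.
Unshelve. all: by end_near. Qed.

End in_probability.

(** * Moments and Laplace transform for one sample *)

Section sample.
Context {R : realType} {q n : nat} {d : measure_display} {Omega : measurableType d}.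
Variables (P : probability Omega R) (X : 'I_n -> {RV P >-> 'cV[R]_q.+1}).
Variables (theta : 'cV[R]_q.+1) (kappa : R) (f : R -> R).
Hypotheses (q0 : (0 < q)%N) (n0 : (0 < n)%N) (theta1 : sphere theta) (k0 : 0 < kappa)
  (Ff : classF f) (mX : model X theta kappa f) (r0 : 0 < rate f kappa).
Local Notation r := (rate f kappa).
Local Notation a := ((q.+1%:R - 3) / 2 : R).
Local Notation nu i := (distribution P (X i)).
Local Notation T := (tangent theta).

Definition mean_moment j := angular_moment a f kappa j / angular_moment a f kappa 0.
Local Notation m1 := (mean_moment 1).
Local Notation m2 := (mean_moment 2).

Definition mean_defect := angular_defect a f kappa / angular_moment a f kappa 0.

Let nuE i := mX.2 i.

Definition scaled_tangent (x : 'cV[R]_q.+1) : 'cV[R]_q.+1 := Num.sqrt (r / n%:R) *: T x.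
Local Notation Y := scaled_tangent.

Let nn0 : 0 < n%:R :> R. Proof. by rewrite ltr0n. Qed.
Let qq0 : 0 < q%:R :> R. Proof. by rewrite ltr0n. Qed.
Let rn0 : 0 <= r / n%:R. Proof. by rewrite divr_ge0 ?ltW. Qed.
Let c2 : Num.sqrt (r / n%:R) ^+ 2 = r / n%:R. Proof. exact: sqr_sqrtr. Qed.

Let mT : measurable_fun setT T. Proof. exact: measurable_tangent. Qed.

Let mT2 : measurable_fun setT (fun x => dot (T x) (T x)).
Proof. exact: measurableT_comp (@measurable_dotxx R q.+1) mT. Qed.

Let mY : measurable_fun setT Y.
Proof.
apply: measurable_cVP => i; rewrite /Y; under eq_fun do rewrite mxE.
by apply: measurable_funM => //; exact: measurableT_comp (measurable_coord i) mT.
Qed.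

Let dotY s x : dot s (Y x) = Num.sqrt (r / n%:R) * dot (T x) s.
Proof. by rewrite dotC /Y dotZl. Qed.

Let Y2E x : dot (Y x) (Y x) = r / n%:R * dot (T x) (T x).
Proof. by rewrite /Y dotZl dotZr mulrA -expr2 c2. Qed.

Let T2_le1 x : sphere x -> dot (T x) (T x) <= 1.
Proof. by move=> sx; rewrite (dot_tangentxx theta1) (spherexx sx) gerBl sqr_ge0. Qed.

Let iTj i j : (nu i).-integrable setT (EFin \o (fun x => dot (T x) (T x) ^+ j)).
Proof.
apply: (observation_integrable (M := 1) Ff (nuE i)); first exact: measurable_funX.
move=> x sx; rewrite ger0_norm ?exprn_ge0 ?dotxx_ge0//.
by rewrite exprn_ile1 ?dotxx_ge0 ?T2_le1.
Qed.

Let ETj i j : \int[nu i]_x (dot (T x) (T x) ^+ j) = mean_moment j.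
Proof. by rewrite /Rintegral (observation_angular_moment q0 theta1 k0 Ff (nuE i)). Qed.

(** The variance of one scaled increment along each tangent direction. The total time
    [n delta = r m1 / q] of the flow will tend to 1. *)
Let delta := r / n%:R * m1 / q%:R.

Lemma mean_moment_ge0 j : 0 <= mean_moment j.
Proof.
rewrite -(ETj (Ordinal n0)); apply: Rintegral_ge0 => x _.
by rewrite exprn_ge0// dotxx_ge0.
Qed.

Let delta0 : 0 <= delta.
Proof. by apply: divr_ge0; [exact: mulr_ge0 rn0 (mean_moment_ge0 1)|exact: ltW]. Qed.

Let qdelta : q%:R * delta = r / n%:R * m1.
Proof. by rewrite /delta mulrC divfK// gt_eqF. Qed.

Let perp (s : 'cV[R]_q.+1) := dot s theta = 0.

Let perpD s x : perp s -> perp (s + Y x).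
Proof. by rewrite /perp dotDl => ->; rewrite dotZl dot_tangent_theta// mulr0 addr0. Qed.

Let iY i s : perp s -> (nu i).-integrable setT (EFin \o (fun x => dot s (Y x))).
Proof.
move=> _; under eq_fun do rewrite dotY.
exact/integrable_EFinZ/(observation_tangent_integrable theta1 Ff (nuE i)).
Qed.

Let iYs i s : perp s ->
  (nu i).-integrable setT (EFin \o (fun x => dot s (Y x) ^+ 2)).
Proof.
move=> _; under eq_fun do rewrite dotY exprMn.
exact/integrable_EFinZ/(observation_tangent_sqr_integrable theta1 Ff (nuE i)).
Qed.

Let iY2 i : (nu i).-integrable setT (EFin \o (fun x => dot (Y x) (Y x))).
Proof.
under eq_fun do rewrite Y2E -[dot (T _) _]expr1.
exact/integrable_EFinZ/iTj.
Qed.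

Let iY4 i : (nu i).-integrable setT (EFin \o (fun x => dot (Y x) (Y x) ^+ 2)).
Proof. by under eq_fun do rewrite Y2E exprMn; exact/integrable_EFinZ/iTj. Qed.

Let EY i s : perp s -> \int[nu i]_x dot s (Y x) = 0.
Proof.
move=> _; under eq_Rintegral do rewrite dotY.
rewrite RintegralZl//; last exact: (observation_tangent_integrable theta1 Ff (nuE i)).
by rewrite (observation_tangent_mean theta1 Ff (nuE i)) mulr0.
Qed.

Let ET1 i : \int[nu i]_x dot (T x) (T x) = m1.
Proof. by rewrite -(ETj i); apply: eq_Rintegral => x _; rewrite expr1. Qed.

Let EYs i s : perp s -> \int[nu i]_x (dot s (Y x) ^+ 2) = delta * dot s s.
Proof.
move=> ps; under eq_Rintegral do rewrite dotY exprMn c2.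
rewrite RintegralZl//; last exact: (observation_tangent_sqr_integrable theta1 Ff (nuE i)).
rewrite (observation_tangent_variance q0 theta1 Ff (nuE i) ps) ET1 /delta.
by field; rewrite !gt_eqF.
Qed.

Let EY2 i : \int[nu i]_x dot (Y x) (Y x) = q%:R * delta.
Proof.
under eq_Rintegral do rewrite Y2E -[dot (T _) _]expr1.
by rewrite RintegralZl//; [rewrite ETj qdelta|exact: iTj].
Qed.

Let EY4 i : \int[nu i]_x (dot (Y x) (Y x) ^+ 2) = (r / n%:R) ^+ 2 * m2.
Proof.
under eq_Rintegral do rewrite Y2E exprMn.
by rewrite RintegralZl//; [rewrite ETj|exact: iTj].
Qed.

Variable s0 : 'cV[R]_q.+1.
Hypothesis perp0 : dot s0 theta = 0.

Definition sample_walk w := walk X Y s0 n w.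

Lemma measurable_sample_walk : measurable_fun setT sample_walk.
Proof. exact: measurable_walk. Qed.

Lemma integral_sample_walk_sqr :
  (\int[P]_w (dot (sample_walk w) (sample_walk w))%:E = (dot s0 s0 + r * m1)%:E)%E.
Proof.
rewrite /sample_walk (@integral_walk_sqr _ _ _ _ _ P X mX.1 perp Y mY perpD q%:R delta)//.
by congr (_ + _)%:E; rewrite qdelta; field; rewrite gt_eqF.
Qed.

(** The free parameter of the third order bound is taken as [sqrt n]: the fourth moment of an
    increment is of order [n^-2] and its second of order [n^-1], so both terms, summed over [n]
    steps, are of order [n^(-1/2)]. *)
Lemma laplace_sample_walk k : 0 <= k ->
  `|\int[P]_w expR (- (k * dot (sample_walk w) (sample_walk w))) -
    gauss_heat q%:R (k * (r * m1 / q%:R)) (k * dot s0 s0)| <=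
  19 * (k ^+ 2 * (r ^+ 2 * m2) + k * (r * m1)) / Num.sqrt n%:R +
  (q%:R ^+ 2 + 6 * q%:R + 16) * (k * (r * m1 / q%:R)) ^+ 2 / n%:R.
Proof.
move=> kge0; have sn0 : 0 < Num.sqrt n%:R :> R by rewrite sqrtr_gt0.
have := @laplace_walk _ _ _ _ _ P X mX.1 perp Y mY perpD q%:R delta _ _ delta0
  iY iYs iY2 iY4 EY EYs EY2 EY4 s0 perp0 k (Num.sqrt n%:R) kge0 sn0.
rewrite -/(sample_walk _) => /(_ (ler0n _ _)).
have -> : k * (n%:R * delta) = k * (r * m1 / q%:R).
  by rewrite /delta; field; rewrite !gt_eqF.
move=> /le_trans; apply.
rewrite /heat_step_error le_eqVlt; apply/orP; left; apply/eqP.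
have nS : n%:R = Num.sqrt n%:R ^+ 2 :> R by rewrite sqr_sqrtr.
rewrite /delta; move: (Num.sqrt n%:R) sn0 nS => S S0 ->.
by field; rewrite !gt_eqF.
Qed.

(** The weak law in mean square comes from [integral_walk_sqr] again: the centred scalar
    [|T x|^2 - m1] is placed along the unit vector [theta], with the trivial [perp], starting point
    0 and dimension 1. *)
Lemma integral_mean_tangent_sqr :
  (\int[P]_w ((r * (n%:R^-1 * \sum_(i < n) dot (T (X i w)) (T (X i w))) - r * m1) ^+ 2)%:E <=
   (r ^+ 2 * m2 / n%:R)%:E)%E.
Proof.
pose g x := dot (T x) (T x) - m1.
pose Yg x : 'cV[R]_q.+1 := g x *: theta.
have mg : measurable_fun setT g by exact: measurable_funB.
have Yg2 x : dot (Yg x) (Yg x) = g x ^+ 2.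
  by rewrite /Yg dotZl dotZr (spherexx theta1) mulr1 expr2.
have ig i : (nu i).-integrable setT (EFin \o g).
  apply: integrable_EFinB; last by apply: (@integrable_bounded _ _ _ _ _ `|m1|).
  by have := iTj i 1; under eq_fun do rewrite expr1.
have iT1 i : (nu i).-integrable setT (EFin \o (fun x => dot (T x) (T x))).
  by have := iTj i 1; under eq_fun do rewrite expr1.
have ic i (c : R) : (nu i).-integrable setT (EFin \o (fun=> c)).
  by apply: (@integrable_bounded _ _ _ _ _ `|c|).
have g2E x : g x ^+ 2 = dot (T x) (T x) ^+ 2 + (- (2 * m1) * dot (T x) (T x) + m1 ^+ 2).
  by rewrite /g; ring.
have iT2 i := iTj i 2.
have ig2 i : (nu i).-integrable setT (EFin \o (fun x => g x ^+ 2)).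
  under eq_fun do rewrite g2E.
  exact: (integrable_EFinD (iT2 i) (integrable_EFinD (integrable_EFinZ (- (2 * m1)) (iT1 i))
    (ic i (m1 ^+ 2)))).
have Eg i : \int[nu i]_x g x = 0.
  by rewrite /g (RintegralB measurableT (iT1 i) (ic i m1)) ET1 Rintegral_probability_cst subrr.
have Eg2 i : \int[nu i]_x (g x ^+ 2) = 1 * (m2 - m1 ^+ 2).
  under eq_Rintegral do rewrite g2E.
  rewrite (RintegralD measurableT (iT2 i)); last exact: (integrable_EFinD (integrable_EFinZ (- (2 * m1)) (iT1 i)) (ic i (m1 ^+ 2))).
  rewrite (RintegralD measurableT (integrable_EFinZ (- (2 * m1)) (iT1 i)) (ic i (m1 ^+ 2))).
  by rewrite (RintegralZl _ measurableT (iT1 i)) ET1 ETj Rintegral_probability_cst; ring.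
have V0 : 0 <= m2 - m1 ^+ 2.
  by rewrite -[X in 0 <= X]mul1r -(Eg2 (Ordinal n0)); apply: Rintegral_ge0 => x _; rewrite sqr_ge0.
have walkE w : walk X Yg 0 n w = (\sum_(i < n) g (X i w)) *: theta.
  rewrite /walk add0r scaler_suml; apply: eq_bigl => i.
  exact: ltn_ord.
have E := @integral_walk_sqr _ _ _ _ _ P X mX.1 (fun=> True) Yg _ (fun _ _ _ => I) 1
  (m2 - m1 ^+ 2) ler01 V0 _ _ _ _ 0 I n (leqnn n).
have {}E : (\int[P]_w ((\sum_(i < n) g (X i w)) ^+ 2)%:E = (n%:R * (m2 - m1 ^+ 2))%:E)%E.
  rewrite -[_ * _]add0r -[X in (X + _)%:E](dot0r (0 : 'cV[R]_q.+1)) -[m2 - _]mul1r -E.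
  - by apply: eq_integral => w _; rewrite walkE dotZl dotZr (spherexx theta1) mulr1 expr2.
  - apply: measurable_cVP => i; rewrite /Yg; under eq_fun do rewrite mxE.
    exact: measurable_funM.
  - move=> i s _; rewrite /Yg; under eq_fun do rewrite dotZr mulrC.
    exact: (integrable_EFinZ (dot s theta) (ig i)).
  - by move=> i; under eq_fun do rewrite Yg2; exact: ig2.
  - move=> i s _; rewrite /Yg; under eq_Rintegral do rewrite dotZr mulrC.
    by rewrite (RintegralZl _ measurableT (ig i)) Eg mulr0.
  - by move=> i; under eq_Rintegral do rewrite Yg2; exact: Eg2.
rewrite (eq_integral (fun w => ((r / n%:R) ^+ 2)%:E *
    ((\sum_(i < n) g (X i w)) ^+ 2)%:E)%E); last first.
  move=> w _; rewrite -EFinM -exprMn; congr (_ ^+ 2)%:E.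
  rewrite /g sumrB sumr_const card_ord -mulr_natl; field.
  by rewrite gt_eqF.
rewrite ge0_integralZl_EFin ?sqr_ge0//; first last.
- apply/measurable_EFinP/measurable_funX; apply: measurable_sum => i.
  exact: measurableT_comp mg _.
- by move=> w _; rewrite lee_fin sqr_ge0.
rewrite E -EFinM lee_fin.
have -> : (r / n%:R) ^+ 2 * (n%:R * (m2 - m1 ^+ 2)) = r ^+ 2 / n%:R * (m2 - m1 ^+ 2).
  by field; rewrite gt_eqF.
rewrite -[leRHS]mulrA [X in _ <= _ * X]mulrC [leRHS]mulrA.
rewrite ler_wpM2l ?divr_ge0 ?sqr_ge0 ?(ltW nn0)//.
by rewrite gerBl sqr_ge0.
Qed.

Lemma integral_mean_defect :
  (\int[P]_w `|1 - n%:R^-1 * \sum_(i < n) dot (X i w) theta|%:E <= mean_defect%:E)%E.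
Proof.
have mU i : measurable_fun setT (fun w => `|1 - dot (X i w) theta|).
  apply: measurableT_comp => //; apply: measurable_funB => //.
  by apply: measurableT_comp (measurable_dotr theta) _.
apply: (@le_trans _ _ (\int[P]_w (\sum_(i < n) (n%:R^-1 * `|1 - dot (X i w) theta|)%:E))%E).
  apply: ge0_le_integral => //.
  - apply/measurable_EFinP; apply: measurableT_comp => //; apply: measurable_funB => //.
    apply: measurable_funM => //; apply: measurable_sum => i.
    by apply: measurableT_comp (measurable_dotr theta) _.
  - apply: emeasurable_sum => i; apply/measurable_EFinP; exact: measurable_funM.
  - move=> w _; rewrite sumEFin lee_fin -mulr_sumr.
    have -> : 1 - n%:R^-1 * \sum_(i < n) dot (X i w) theta =
        n%:R^-1 * \sum_(i < n) (1 - dot (X i w) theta).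
      by rewrite sumrB sumr_const card_ord; field; rewrite gt_eqF.
    by rewrite normrM ger0_norm ?invr_ge0 ?(ltW nn0)// ler_wpM2l ?invr_ge0 ?(ltW nn0) ?ler_norm_sum.
rewrite ge0_integral_sum//; first last.
- by move=> i; apply/measurable_EFinP; exact: measurable_funM.
rewrite (eq_bigr (fun=> (n%:R^-1 * mean_defect)%:E)) => [|i _].
  rewrite sumEFin sumr_const card_ord lee_fin -[_ *+ n]mulr_natl.
  by rewrite le_eqVlt; apply/orP; left; apply/eqP; field; rewrite gt_eqF.
under eq_integral do rewrite EFinM.
rewrite ge0_integralZl_EFin ?invr_ge0 ?(ltW nn0)//; last exact/measurable_EFinP.
rewrite EFinM; congr (_ * _)%E.
rewrite /mean_defect -(observation_angular_defect q0 theta1 k0 Ff (nuE i)).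
rewrite ge0_integral_distribution//; apply/measurable_EFinP.
by apply: measurableT_comp => //; apply: measurable_funB => //; exact: measurable_dotr.
Qed.

End sample.

Lemma dot_suml (R : realType) (p : nat) (I : Type) (l : seq I) (Q : pred I)
    (v : I -> 'cV[R]_p) (w : 'cV[R]_p) :
  dot (\sum_(i <- l | Q i) v i) w = \sum_(i <- l | Q i) dot (v i) w.
Proof.
elim/big_rec2: _ => [|i y z _ <-]; first by rewrite dotC dot0r.
by rewrite dotDl.
Qed.

Lemma dot_sqrD (R : realType) (p : nat) (x y : 'cV[R]_p) :
  dot (x + y) (x + y) = dot x x + 2 * dot x y + dot y y.
Proof. by rewrite dotDl !dotDr (dotC y x); ring. Qed.

Lemma dot_sqrB (R : realType) (p : nat) (x y : 'cV[R]_p) :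
  dot (x - y) (x - y) = dot x x - 2 * dot x y + dot y y.
Proof. by rewrite dot_sqrD dotNr dotNN; ring. Qed.

Section quad.
Context {R : realType} {p : nat}.
Implicit Types v theta : 'cV[R]_p.

Lemma quadE theta v : quad theta v = dot v v - dot v theta ^+ 2.
Proof.
rewrite /quad mulmxBr mulmx1 mulmxBl mulmxA -mulmxA mxE [X in _ + X]mxE.
congr (_ - _); rewrite [LHS]mxE big_ord1 expr2 -/(dot v theta) -/(dot theta v).
by rewrite [dot theta v]dotC.
Qed.

Lemma quadZ theta c v : quad theta (c *: v) = c ^+ 2 * quad theta v.
Proof. by rewrite !quadE !dotZl !dotZr; ring. Qed.

End quad.

(** * Deterministic comparison of the statistics with the squared walk *)

Section close_scalar.
Context {R : realType}.

(** Here [b = |tau|^2], [G = Z . tau], [z = |Z|^2], [v = nu^2] and [u] is the cosine component of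
    the sample mean. At [u = 1] and [v = 0] both expressions reduce to [b + 2 G + z], and each term
    of their difference carries a factor [u - 1] or [v]. *)
Lemma walk_close (B M eta b G u v z S2 V2 : R) : 0 <= eta <= 1 -> 0 <= b <= B -> 0 <= M ->
  0 <= v <= eta -> `|1 - u| <= eta -> 0 <= S2 <= M -> G ^+ 2 <= b * (2 * S2 + 2 * b) ->
  S2 = b - v * b ^+ 2 / 4 + 2 * G + z ->
  V2 = z + u ^+ 2 * b + 2 * u * G - v * (u * b / 2 + G) ^+ 2 ->
  `|V2 - S2| <= eta * (3 * B + 2 * (B * (2 * M + 2 * B) + 1) + B ^+ 2 +
    2 * (B ^+ 2 + B * (2 * M + 2 * B))).
Proof.
move=> /andP[e0 e1] /andP[b0 bB] M0 /andP[v0 ve] ue /andP[S0 SM] Gb S2E V2E.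
pose L := B * (2 * M + 2 * B).
have B0 : 0 <= B by exact: le_trans bB.
have GL : G ^+ 2 <= L.
  by rewrite (le_trans Gb)// /L ler_pM//; lra.
(* From [G^2 <= L], using [2 |G| <= 1 + G^2] instead of a square root. *)
have G1 : `|G| <= L + 1.
  by rewrite ler_norml; apply/andP; split; nra.
have u02 : 0 <= u <= 2 by move: ue; rewrite ler_norml => /andP[h1 h2]; apply/andP; split; lra.
have /andP[u0 u2] := u02.
have -> : V2 - S2 = (u - 1) * ((u + 1) * b) + 2 * ((u - 1) * G) + v * (b ^+ 2 / 4) -
    v * (u * b / 2 + G) ^+ 2 by rewrite V2E S2E; ring.
have h1 : `|(u - 1) * ((u + 1) * b)| <= eta * (3 * B).
  rewrite normrM distrC ler_pM// normrM ger0_norm; last by lra.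
  by rewrite (ger0_norm b0) ler_pM//; lra.
have h2 : `|2 * ((u - 1) * G)| <= eta * (2 * (L + 1)).
  rewrite normrM (ger0_norm (ler0n _ 2)) mulrCA ler_wpM2l// normrM distrC.
  by rewrite ler_pM.
have h3 : `|v * (b ^+ 2 / 4)| <= eta * B ^+ 2.
  rewrite ger0_norm ?mulr_ge0 ?divr_ge0 ?sqr_ge0// ler_pM ?divr_ge0 ?sqr_ge0//.
  have : b ^+ 2 <= B ^+ 2 by rewrite lerXn2r// nnegrE.
  by have := sqr_ge0 b; lra.
have h4 : `|v * (u * b / 2 + G) ^+ 2| <= eta * (2 * (B ^+ 2 + L)).
  rewrite normrM (ger0_norm v0) (ger0_norm (sqr_ge0 _)) ler_pM ?sqr_ge0//.
  have ub : (u * b / 2) ^+ 2 <= B ^+ 2.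
    by rewrite lerXn2r// ?nnegrE ?mulr_ge0//; nra.
  have := sqr_ge0 (u * b / 2 - G); move: ub GL; move: (u * b / 2) => t ub GL; nra.
rewrite (le_trans (ler_normB _ _))// (le_trans (lerD (ler_normD _ _) (lexx _)))//.
rewrite (le_trans (lerD (lerD (ler_normD _ _) (lexx _)) (lexx _)))//.
by rewrite (le_trans (lerD (lerD (lerD h1 h2) h3) h4))// -/L; lra.
Qed.

(** [Q >= 1] and [eta * C0 <= 1/2] keep the denominator [K] above [1/2], which is where the factor 2
    comes from. *)
Lemma watson_close_scalar (Q M eta C0 C1 S2 V2 K W : R) : 1 <= Q -> 0 <= S2 <= M ->
  0 <= eta -> 0 <= C0 -> eta * C0 <= 2^-1 -> `|K - Q| <= eta * C0 ->
  `|V2 - S2| <= eta * C1 -> W = Q * V2 / K -> `|W - S2| <= eta * (2 * (Q * C1 + C0 * M)).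
Proof.
move=> Q1 /andP[S0 SM] e0 C00 eC K1 V1 WE.
have K2 : 2^-1 <= K by move: K1; rewrite ler_norml => /andP[h1 h2]; lra.
have K0 : 0 < K by lra.
have -> : W - S2 = (Q * (V2 - S2) + (Q - K) * S2) / K by rewrite WE; field; rewrite gt_eqF.
rewrite normrM [X in _ * X]ger0_norm ?invr_ge0 ?(ltW K0)// ler_pdivrMr//.
have h : `|Q * (V2 - S2) + (Q - K) * S2| <= Q * (eta * C1) + eta * C0 * M.
  rewrite (le_trans (ler_normD _ _))// lerD// normrM.
    by rewrite ger0_norm ?ler_wpM2l//; lra.
  by rewrite distrC (ger0_norm S0) ler_pM.
rewrite (le_trans h)//.
have C10 : 0 <= eta * C1 by exact: le_trans V1.
have : 0 <= Q * (eta * C1) + eta * C0 * M.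
  by apply: addr_ge0; apply: mulr_ge0 => //; [lra|exact: mulr_ge0|exact: le_trans SM].
nra.
Qed.

End close_scalar.

Section close.
Context {R : realType} {q n : nat}.
Variables (theta0 theta tau : 'cV[R]_q.+1) (nu r : R) (x : 'I_n -> 'cV[R]_q.+1).
Hypotheses (n0 : (0 < n)%N) (theta01 : sphere theta0) (theta1 : sphere theta)
  (thetaE : theta = theta0 + nu *: tau) (r0 : 0 < r) (nu0 : 0 < nu)
  (nu2 : nu ^+ 2 * (n%:R * r) = 1) (sx : forall i, sphere (x i)).
Local Notation T := (tangent theta).
Local Notation b := (dot tau tau).
Local Notation u := (dot (sample_mean x) theta).
Let Z := Num.sqrt (r / n%:R) *: \sum_i T (x i).
Let S := T tau + Z.
Local Notation kbar := (r * (n%:R^-1 * \sum_i dot (T (x i)) (T (x i)))).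
Local Notation den := (1 - n%:R^-1 * \sum_i dot (x i) theta0 ^+ 2).

Let nn0 : 0 < n%:R :> R. Proof. by rewrite ltr0n. Qed.

(** Expand [|theta - nu tau|^2 = 1] with [|theta| = 1], then divide by [nu]. *)
Lemma tau_theta : dot tau theta = nu * b / 2.
Proof.
have := spherexx theta1; have := spherexx theta01.
have -> : theta0 = theta - nu *: tau by rewrite thetaE addrK.
rewrite !(dotDl, dotDr, dotNl, dotNr, dotZl, dotZr) (dotC theta tau) => + tt; rewrite tt => h.
apply: (mulfI (lt0r_neq0 nu0)); lra.
Qed.

Let theta0E : theta0 = theta - nu *: tau. Proof. by rewrite thetaE addrK. Qed.

Let Ztheta : dot Z theta = 0.
Proof.
by rewrite /Z dotZl dot_suml big1 ?mulr0// => i _; exact: dot_tangent_theta.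
Qed.

Let nrE : n%:R * r = (nu ^+ 2)^-1.
Proof.
have nn2 : nu ^+ 2 != 0 by rewrite lt0r_neq0 ?exprn_gt0.
by apply: (mulfI nn2); rewrite nu2 mulfV.
Qed.

Let nuE : Num.sqrt (r / n%:R) * nu = n%:R^-1.
Proof.
have rE : r = (nu ^+ 2 * n%:R)^-1.
  by rewrite invfM -nrE mulrC mulrA mulVf ?mul1r// gt_eqF.
have e : (Num.sqrt (r / n%:R) * nu) ^+ 2 = n%:R^-1 ^+ 2.
  rewrite exprMn sqr_sqrtr ?divr_ge0 ?(ltW r0) ?(ltW nn0)// {1}rE; field.
  by rewrite !gt_eqF.
by apply/eqP; rewrite -(@eqrXn2 _ 2) ?mulr_ge0 ?sqrtr_ge0 ?invr_ge0 ?(ltW nu0) ?(ltW nn0)// e.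
Qed.

Let meanE : sample_mean x = u *: theta + nu *: Z.
Proof.
have -> : nu *: Z = n%:R^-1 *: \sum_i T (x i) by rewrite /Z scalerA [nu * _]mulrC nuE.
rewrite /sample_mean (dotZl n%:R^-1) dot_suml -scalerA -scalerDr.
congr (_ *: _); rewrite scaler_suml -big_split/=; apply: eq_bigr => i _.
by rewrite addrC subrK.
Qed.

Let G := dot Z tau.

Let Z2 := dot Z Z.

Let S2E : dot S S = b - nu ^+ 2 * b ^+ 2 / 4 + 2 * G + Z2.
Proof.
have TZ : dot (T tau) Z = G by rewrite dot_tangent// dotC.
by rewrite /S dot_sqrD TZ (dot_tangentxx theta1) tau_theta -/Z2; field.
Qed.

(** Insert [mean = u theta + nu Z] and [theta0 = theta - nu tau] into
    [|mean|^2 - (mean . theta0)^2]; the normalization [n r nu^2 = 1] leaves terms of order one and a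
    remainder in [nu^2]. *)
Let V2E : n%:R * r * quad theta0 (sample_mean x) =
  Z2 + u ^+ 2 * b + 2 * u * G - nu ^+ 2 * (u * b / 2 + G) ^+ 2.
Proof.
have gen (z : 'cV[R]_q.+1) c : dot z theta = 0 ->
    dot (c *: theta + nu *: z) theta0 = c * (1 - nu ^+ 2 * b / 2) - nu ^+ 2 * dot z tau.
  move=> zt; rewrite dotDl !dotZl theta0E !dotDr !dotNr !dotZr (spherexx theta1) zt.
  by rewrite (dotC theta tau) tau_theta; field.
have gen2 (z : 'cV[R]_q.+1) c : dot z theta = 0 ->
    dot (c *: theta + nu *: z) (c *: theta + nu *: z) = c ^+ 2 + nu ^+ 2 * dot z z.
  move=> zt; rewrite dot_sqrD !dotZl !dotZr (dotC theta z) zt (spherexx theta1).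
  by ring.
have m0 := gen Z u Ztheta; have mm := gen2 Z u Ztheta; rewrite -meanE in m0 mm.
rewrite quadE m0 mm nrE -/G -/Z2; field.
by rewrite gt_eqF.
Qed.

Let G2_le : G ^+ 2 <= b * (2 * dot S S + 2 * b).
Proof.
rewrite /G mulrC (le_trans (cauchy_schwarz _ _))// ler_wpM2r ?dotxx_ge0//.
have -> : Z = S - T tau by rewrite /S addrAC subrr add0r.
have h : dot (T tau) (T tau) <= b by rewrite (dot_tangentxx theta1) gerBl sqr_ge0.
have := dotxx_ge0 (S + T tau).
by rewrite dot_sqrD dot_sqrB; lra.
Qed.

Let sum_affine (A B C : R) (Q : 'I_n -> R) :
  \sum_i (A + B * Q i + C) = n%:R * A + B * \sum_i Q i + n%:R * C.
Proof. by rewrite !big_split/= -mulr_sumr !sumr_const card_ord !mulr_natl. Qed.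

(** Changing [theta] into [theta0] produces a cross term [2 nu U t], where [t] is only of size
    [|T x|]. The arithmetic-geometric inequality with weight [eta] splits it into a small multiple
    of [|T x|^2] and [nu^2 / eta]. *)
Let term_close eta i : 0 < eta ->
  `|1 - dot (x i) theta0 ^+ 2 - dot (T (x i)) (T (x i))| <=
  nu ^+ 2 * (2 * b) + eta * b * dot (T (x i)) (T (x i)) + nu ^+ 2 / eta.
Proof.
move=> eta0; pose U := dot (x i) theta; pose t := dot (T (x i)) tau.
pose H := dot (x i) tau.
have xx := spherexx (sx i).
have Q0 := dotxx_ge0 (T (x i)).
have QE : dot (T (x i)) (T (x i)) = 1 - U ^+ 2 by rewrite (dot_tangentxx theta1) xx.
have U1 : `|U| <= 1.
  by rewrite -(expr_le1 (n := 2))// real_normK ?num_real// -subr_ge0 -QE.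
have H2 : H ^+ 2 <= b by rewrite (le_trans (cauchy_schwarz _ _))// xx mul1r.
have t2 : t ^+ 2 <= b * dot (T (x i)) (T (x i)) by rewrite mulrC; exact: cauchy_schwarz.
have HE : H = U * (nu * b / 2) + t.
  by rewrite /t /tangent dotDl dotNl dotZl (dotC theta tau) tau_theta -/H -/U; ring.
have x0E : dot (x i) theta0 = U - nu * H by rewrite theta0E dotDr dotNr dotZr.
have -> : 1 - dot (x i) theta0 ^+ 2 - dot (T (x i)) (T (x i)) =
    nu ^+ 2 * b * U ^+ 2 + U * (2 * nu * t) - nu ^+ 2 * H ^+ 2.
  have UH : 2 * nu * (U * H) = nu ^+ 2 * b * U ^+ 2 + U * (2 * nu * t) by rewrite HE; field.
  by rewrite QE x0E -UH; ring.
have b0 := dotxx_ge0 tau.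
have U2 : U ^+ 2 <= 1 by rewrite -subr_ge0 -QE.
have nn2 : 0 <= nu ^+ 2 by exact: sqr_ge0.
have h1 : `|nu ^+ 2 * b * U ^+ 2| <= nu ^+ 2 * b.
  by rewrite normrM (ger0_norm (mulr_ge0 nn2 b0)) (ger0_norm (sqr_ge0 U)) ler_piMr// mulr_ge0.
have h2 : `|nu ^+ 2 * H ^+ 2| <= nu ^+ 2 * b.
  by rewrite normrM (ger0_norm nn2) (ger0_norm (sqr_ge0 H)) ler_wpM2l.
have h3 : `|U * (2 * nu * t)| <= eta * b * dot (T (x i)) (T (x i)) + nu ^+ 2 / eta.
  rewrite normrM (le_trans (ler_piMl (normr_ge0 _) U1))//.
  have am : `|2 * nu * t| <= eta * t ^+ 2 + nu ^+ 2 / eta.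
    rewrite -[t ^+ 2]real_normK ?num_real// normrM gtr0_norm ?mulr_gt0//.
    rewrite -subr_ge0 (_ : _ - _ = eta * (`|t| - nu / eta) ^+ 2); last first.
      by field; rewrite gt_eqF.
    by rewrite mulr_ge0 ?sqr_ge0// ltW.
  by rewrite (le_trans am)// lerD2r -mulrA ler_wpM2l// ltW.
rewrite (le_trans (ler_normB _ _))// (le_trans (lerD (ler_normD _ _) (lexx _)))//.
by rewrite (le_trans (lerD (lerD h1 h3) h2))//; lra.
Qed.

Let den_close eta : 0 < eta ->
  `|r * den - kbar| <= 2 * b / n%:R + eta * b * kbar + (n%:R * eta)^-1.
Proof.
move=> eta0.
have -> : r * den - kbar = r / n%:R * \sum_i (1 - dot (x i) theta0 ^+ 2 - dot (T (x i)) (T (x i))).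
  by rewrite !sumrB sumr_const card_ord; field; rewrite gt_eqF.
rewrite normrM ger0_norm ?divr_ge0 ?(ltW r0) ?(ltW nn0)//.
have rn0 : 0 <= r / n%:R by rewrite divr_ge0 ?(ltW r0) ?(ltW nn0).
apply: (le_trans (ler_wpM2l rn0 (ler_norm_sum _ _ _))).
apply: (le_trans (ler_wpM2l rn0 (ler_sum _ (fun i _ => term_close i eta0)))).
rewrite sum_affine.
have nuE2 : nu ^+ 2 = (n%:R * r)^-1 by rewrite nrE invrK.
rewrite nuE2 le_eqVlt; apply/orP; left; apply/eqP; field.
by rewrite !gt_eqF.
Qed.

Let watsonE : watson theta0 x = q%:R * (n%:R * r * quad theta0 (sample_mean x)) / (r * den).
Proof.
rewrite /watson -natr1 addrK invfM; move: ((den)^-1) => D.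
by field; rewrite gt_eqF.
Qed.

(** The Wald statistic is the Watson statistic times the squared cosine of the angle between the
    sample mean and [theta0], so the difference carries the squared sine, [quad / |mean|^2]. *)
Let waldE : sample_mean x != 0 -> watson theta0 x - wald theta0 x =
  watson theta0 x * (nu ^+ 2 * (n%:R * r * quad theta0 (sample_mean x))) /
    dot (sample_mean x) (sample_mean x).
Proof.
move=> m0; rewrite /wald /watson /theta_hat; move: (sample_mean x) m0 => v v0.
have mm0 : dot v v != 0 by rewrite dotxx_eq0.
rewrite quadZ exprVn sqr_enorm [nu ^+ 2 * _]mulrA nu2 mul1r.
move: ((den)^-1) => D; have -> : dot v theta0 ^+ 2 = dot v v - quad theta0 v.
  by rewrite quadE; ring.
by field.
Qed.

Lemma watson_wald_close (B M eta m : R) : 0 < eta <= 2^-1 -> b <= B -> 0 <= M ->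
  nu ^+ 2 <= eta -> 2 * B / n%:R <= eta -> (n%:R * eta)^-1 <= eta -> `|m - q%:R| <= eta ->
  (0 < q)%N ->
  let C0 := 4 + B * (q%:R + 1) in
  let C1 := 3 * B + 2 * (B * (2 * M + 2 * B) + 1) + B ^+ 2 +
    2 * (B ^+ 2 + B * (2 * M + 2 * B)) in
  eta * C0 <= 2^-1 -> `|1 - u| + (kbar - m) ^+ 2 <= eta ^+ 2 -> dot S S <= M ->
  `|watson theta0 x - dot S S| <= eta * (2 * (q%:R * C1 + C0 * M)) /\
  `|watson theta0 x - wald theta0 x| <= eta * (8 * q%:R * (M + C1) ^+ 2).
Proof.
move=> /andP[e0 e2] bB M0 nue Bn ne mq q0 C0 C1 eC0 small SM.
have b0 := dotxx_ge0 tau.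
have B0 : 0 <= B := le_trans b0 bB.
have e1 : eta <= 1 by lra.
have ee : eta ^+ 2 <= eta by rewrite expr2 ler_piMl// ltW.
have q1 : 1 <= q%:R :> R by rewrite ler1n.
have u1 : `|1 - u| <= eta.
  by have := sqr_ge0 (kbar - m); move: small; lra.
(* The smallness hypothesis is stated with [eta ^+ 2] because the deviation of [kbar] is controlled
   through its square. *)
have km : `|kbar - m| <= eta.
  rewrite -(@ler_pXn2r _ 2)// ?nnegrE ?normr_ge0 ?(ltW e0)// real_normK ?num_real//.
  by have := normr_ge0 (1 - u); move: small; lra.
(* The 4 in [C0] counts one [eta] for each of [2 b / n] and [(n eta)^-1], and two for the distance
   from [kbar] to [q]; the other part bounds [b * kbar]. *)
have K1 : `|r * den - q%:R| <= eta * C0.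
  have kq : `|kbar - q%:R| <= 2 * eta.
    by rewrite (le_trans (ler_distD m _ _))//; lra.
  have k1 : kbar <= q%:R + 1 by move: kq; rewrite ler_norml => /andP[_ h]; lra.
  have k0 : 0 <= kbar.
    rewrite !mulr_ge0 ?invr_ge0 ?(ltW r0) ?(ltW nn0)// sumr_ge0// => i _.
    exact: dotxx_ge0.
  have h := den_close e0.
  have h1 : 2 * b / n%:R <= eta.
    by apply: le_trans Bn; rewrite ler_wpM2r ?invr_ge0 ?(ltW nn0)// ler_wpM2l.
  have h2 : eta * b * kbar <= eta * (B * (q%:R + 1)).
    by rewrite -mulrA ler_wpM2l ?(ltW e0)// ler_pM.
  rewrite (le_trans (ler_distD kbar _ _))// (le_trans (lerD h kq))// /C0.
  by rewrite mulrDr; lra.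
have S0 := dotxx_ge0 S.
have V1 : `|n%:R * r * quad theta0 (sample_mean x) - dot S S| <= eta * C1.
  apply: (@walk_close _ B M eta b G u (nu ^+ 2) Z2 _ _ _ _ M0 _ u1 _ G2_le S2E V2E).
  - by rewrite (ltW e0).
  - by rewrite b0.
  - by rewrite sqr_ge0.
  - by rewrite S0.
have C00 : 0 <= C0 by rewrite addr_ge0 ?mulr_ge0 ?addr_ge0.
have W1 : `|watson theta0 x - dot S S| <= eta * (2 * (q%:R * C1 + C0 * M)).
  by apply: (@watson_close_scalar _ q%:R M eta C0 C1 _ _ (r * den) _ q1 _ (ltW e0) C00 eC0 K1 V1 watsonE); rewrite S0 SM.
split=> //.
have C10 : 0 <= C1 by rewrite !addr_ge0 ?mulr_ge0 ?addr_ge0 ?mulr_ge0 ?sqr_ge0 ?addr_ge0 ?mulr_ge0.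
set V2 := n%:R * r * quad theta0 (sample_mean x) in V1.
have V2M : `|V2| <= M + C1.
  have : eta * C1 <= C1 by rewrite ler_piMl.
  have := ler_distD (dot S S) V2 0; rewrite !subr0 (ger0_norm S0); lra.
have K2 : 2^-1 <= r * den by move: K1; rewrite ler_norml => /andP[h1 h2]; lra.
have WV : `|watson theta0 x| <= 2 * q%:R * (M + C1).
  rewrite watsonE -/V2 normrM normrM (ger0_norm (ler0n _ q)).
  rewrite [X in _ * X]ger0_norm ?invr_ge0; last by lra.
  rewrite ler_pdivrMr; last by lra.
  rewrite (le_trans (ler_wpM2l (ler0n _ q) V2M))//.
  have : 0 <= q%:R * (M + C1) by rewrite mulr_ge0// addr_ge0.
  by nra.
(* As [eta <= 1/2], the component of the mean along [theta] is at least [1/2]. The mean is then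
   nonzero, so [theta_hat] is a genuine unit vector, and dividing by its squared length costs a
   factor 4. *)
have mm : 4^-1 <= dot (sample_mean x) (sample_mean x).
  have := cauchy_schwarz (sample_mean x) theta; rewrite (spherexx theta1) mulr1.
  apply: le_trans; move: u1; rewrite ler_norml => /andP[h1 h2]; nra.
have m0 : sample_mean x != 0 by rewrite -dotxx_eq0 gt_eqF//; lra.
rewrite (waldE m0) -/V2 normrM [X in _ * X]ger0_norm ?invr_ge0 ?dotxx_ge0//.
rewrite ler_pdivrMr; last by lra.
rewrite normrM [X in _ * X]normrM (ger0_norm (sqr_ge0 nu)).
apply: (@le_trans _ _ (2 * q%:R * (M + C1) * (eta * (M + C1)))).
  have nV : nu ^+ 2 * `|V2| <= eta * (M + C1) by rewrite ler_pM ?sqr_ge0.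
  by apply: ler_pM WV nV => //; rewrite mulr_ge0 ?sqr_ge0.
have : 0 <= q%:R * (M + C1) ^+ 2 by rewrite mulr_ge0 ?sqr_ge0.
move=> h; have := ler_wpM2l (mulr_ge0 (ltW e0) h) mm; lra.
Qed.

End close.

(** * Laplace transform of the limit law *)

Section noncentral_chisq_laplace.
Context {R : realType} (k : nat) (c : R).
Local Notation mu := (fun i : nat => if i == 0%N then Num.sqrt c else 0 : R).

(** The Gaussian vector whose squared norm has law [noncentral_chisq], named so that it can carry a
    probability structure. *)
Definition shifted_normal : set 'cV[R]_k -> \bar R :=
  prod_measure k (fun i => normal_prob (mu i) 1).

HB.instance Definition _ := Measure.on shifted_normal.

(** The total mass is the Laplace transform at 0. *)
Let shifted_normal_setT : shifted_normal setT = 1%E.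
Proof.
have := prod_normal_laplace (lexx (0 : R)) k mu.
rewrite (eq_integral (cst 1%E)); last by move=> z _; rewrite mul0r oppr0 expR0.
rewrite integral_cst// mul1e mul0r gauss_heat0 oppr0 expR0; exact.
Qed.

HB.instance Definition _ :=
  @Measure_isProbability.Build _ _ R shifted_normal shifted_normal_setT.

Lemma laplace_shifted_normal (t : R) : 0 <= t -> (0 < k)%N -> 0 <= c ->
  \int[shifted_normal]_z expR (- (t * dot z z)) = gauss_heat k%:R t (t * c).
Proof.
move=> t0 k0 c0; rewrite /Rintegral; have := prod_normal_laplace t0 k mu.
move=> E; rewrite [X in fine X]E/=; congr (gauss_heat _ _ (_ * _)).
case: k k0 => // j _; rewrite big_ord_recl/= sqr_sqrtr// big1 ?addr0// => i _.
by rewrite expr0n.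
Qed.

Lemma integral_noncentral_chisq (g : R -> R) (M : R) : measurable_fun setT g ->
  (forall x, `|g x| <= M) ->
  (\int[noncentral_chisq k c]_x (g x)%:E = (\int[shifted_normal]_z g (dot z z))%:E)%E.
Proof.
move=> mg gM.
have ig : shifted_normal.-integrable setT (EFin \o (fun z => g (dot z z))).
  apply: (@integrable_bounded _ _ _ _ _ M) => //.
  exact: measurableT_comp mg (@measurable_dotxx R k).
rewrite /Rintegral fineK; last exact: integrable_fin_num.
rewrite /noncentral_chisq integral_pushforward//; first exact: measurable_dotxx.
exact/measurable_EFinP.
Qed.

End noncentral_chisq_laplace.

Lemma cvg_dot {R : realType} {q : nat} (x : nat -> 'cV[R]_q.+1) (l : 'cV[R]_q.+1) :
  x n @[n --> \oo] --> l -> dot (x n) (x n) @[n --> \oo] --> dot l l.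
Proof.
move=> xl; rewrite dotE (_ : (fun n => _) = fun n => \sum_i x n i 0 * x n i 0); last first.
  by apply/funext => n; rewrite dotE.
apply: (@cvg_big _ _ +%R 0 _ add_continuous _ _ _ (fun i n => x n i 0 * x n i 0)) => i _.
have xi : x n i 0 @[n --> \oo] --> l i 0.
  by apply: (@cvg_comp _ _ _ x (fun v : 'cV[R]_q.+1 => v i 0) _ (nbhs l)) => //; exact: coord_continuous.
exact: cvgM.
Qed.

Section sample_sphere.
Context {R : realType} {q n : nat} {d : measure_display} {Omega : measurableType d}.
Variables (P : probability Omega R) (X : 'I_n -> {RV P >-> 'cV[R]_q.+1}).
Variables (theta : 'cV[R]_q.+1) (kappa : R) (f : R -> R).
Hypotheses (Ff : classF f) (mX : model X theta kappa f).

Lemma sample_sphere_ae (Q : Omega -> Prop) :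
  (forall w, (forall i, sphere (X i w)) -> Q w) -> {ae P, forall w, Q w}.
Proof.
move=> HQ; have mS : measurable (~` @sphere R q.+1) by apply: measurableC; exact: measurable_sphere.
have mXS i : measurable (X i @^-1` (~` @sphere R q.+1)).
  by rewrite -[Y in measurable Y]setTI; exact: (measurable_funPT (X i)).
exists (\big[setU/set0]_(i < n) (X i @^-1` (~` @sphere R q.+1))); split.
- by apply: bigsetU_measurable => i _.
- apply: (@proj2 (measurable (\big[setU/set0]_(i < n) (X i @^-1` (~` @sphere R q.+1))))).
  apply: (big_ind (fun A => measurable A /\ P A = 0%E)) => [|A B [mA A0] [mB B0]|i _]; first by rewrite measure0.
    by split; [exact: measurableU|rewrite measureU0].
  by split=> //; exact: (observation_sphere Ff (mX.2 i)).
- move=> w /= nQ; apply: contrapT => nN; apply: nQ; apply: HQ => i.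
  apply: contrapT => si; apply: nN; rewrite -bigcup_seq; exists i => //=.
  by rewrite mem_index_enum.
Qed.

End sample_sphere.

Lemma cvg_gauss_heat {R : realType} (m : R) (u rho : nat -> R) (u0 rho0 : R) :
  0 <= u0 -> u n @[n --> \oo] --> u0 -> rho n @[n --> \oo] --> rho0 ->
  gauss_heat m (u n) (rho n) @[n --> \oo] --> gauss_heat m u0 rho0.
Proof.
move=> u00 cu cr; rewrite /gauss_heat.
have A0 : 0 < 1 + 2 * u0 by rewrite ltr_pwDl// mulr_ge0.
have cA : 1 + 2 * u n @[n --> \oo] --> 1 + 2 * u0.
  by apply: cvgD; [exact: cvg_cst|exact: cvgMr].
apply: (@cvg_comp _ _ _ _ (@expR R) _ _ _ _ (@continuous_expR R _)).
apply: cvgB.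
  apply: cvgMr; apply: (@cvg_comp _ _ _ _ (@ln R) _ _ _ cA); exact: continuous_ln.
by apply: cvgM => //; apply: cvgV => //; rewrite gt_eqF.
Qed.

Section measurable_statistics.
Context {R : realType} {q n : nat} {d : measure_display} {Omega : measurableType d}.
Variables (theta0 : 'cV[R]_q.+1) (x : 'I_n -> Omega -> 'cV[R]_q.+1).
Hypothesis mx : forall i, measurable_fun setT (x i).

Lemma measurable_scale_vec (g : Omega -> R) (v : Omega -> 'cV[R]_q.+1) :
  measurable_fun setT g -> measurable_fun setT v -> measurable_fun setT (fun w => g w *: v w).
Proof.
move=> mg mv; apply: measurable_cVP => i; under eq_fun do rewrite mxE.
by apply: measurable_funM => //; exact: measurableT_comp (measurable_coord i) mv.
Qed.

Lemma measurable_sample_mean : measurable_fun setT (fun w => sample_mean (fun i => x i w)).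
Proof.
apply: measurable_scale_vec => //; apply: measurable_cVP => i.
under eq_fun do rewrite summxE; apply: measurable_sum => j.
exact: measurableT_comp (measurable_coord i) (mx j).
Qed.

Let mquad (v : Omega -> 'cV[R]_q.+1) : measurable_fun setT v ->
  measurable_fun setT (fun w => quad theta0 (v w)).
Proof.
move=> mv; under eq_fun do rewrite quadE; apply: measurable_funB.
  exact: measurableT_comp (@measurable_dotxx R q.+1) mv.
by apply: measurable_funX; exact: measurableT_comp (measurable_dotr theta0) mv.
Qed.

Let mden : measurable_fun setT
  (fun w => (1 - n%:R^-1 * \sum_(i < n) dot (x i w) theta0 ^+ 2)^-1).
Proof.
apply: measurableT_comp (@measurable_invr R) _; apply: measurable_funB => //.
apply: measurable_funM => //; apply: measurable_sum => i; apply: measurable_funX.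
exact: measurableT_comp (measurable_dotr theta0) (mx i).
Qed.

Lemma measurable_watson : measurable_fun setT (fun w => watson theta0 (fun i => x i w)).
Proof.
apply: measurable_funM => //; apply: measurable_funM => //.
exact/mquad/measurable_sample_mean.
Qed.

Lemma measurable_wald : measurable_fun setT (fun w => wald theta0 (fun i => x i w)).
Proof.
apply: measurable_funM => //; apply: measurable_funM.
  apply: measurable_funM => //; apply: measurable_funX.
  exact: measurableT_comp (measurable_dotr theta0) measurable_sample_mean.
apply: mquad; exact: measurableT_comp (@measurable_normalize R q.+1) measurable_sample_mean.
Qed.

End measurable_statistics.

(** * Limits along the sequence of samples *)

Section local_asymptotics.
Context {R : realType} {q : nat}.
Variables (theta0 : 'cV[R]_q.+1) (f : R -> R) (kappa : nat -> R).
Variables (tau theta : nat -> 'cV[R]_q.+1) (tau_lim : 'cV[R]_q.+1).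
Hypotheses (q0 : (0 < q)%N) (theta01 : sphere theta0) (Ff : classF f)
  (kappa_gt0 : forall n, 0 < kappa n) (kappa_oo : kappa n @[n --> \oo] --> +oo)
  (cvg_tau : tau n @[n --> \oo] --> tau_lim) (theta1 : forall n, sphere (theta n))
  (thetaE : \forall n \near \oo, theta n = theta0 + nu_ f kappa n *: tau n).
Context {d : nat -> measure_display} {Omega : forall n, measurableType (d n)}.
Variables (P : forall n, probability (Omega n) R)
  (X : forall n, 'I_n -> {RV (P n) >-> 'cV[R]_q.+1}).
Hypothesis mX : forall n, model (@X n) (theta n) (kappa n) f.
Local Notation r n := (rate f (kappa n)).
Local Notation nu n := (nu_ f kappa n).
Local Notation a := ((q.+1%:R - 3) / 2 : R).
Local Notation m1 n := (@mean_moment R q (kappa n) f 1).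
Local Notation m2 n := (@mean_moment R q (kappa n) f 2).
Local Notation defect n := (@mean_defect R q (kappa n) f).
Local Notation b := (dot tau_lim tau_lim).

Let a1 : -1 < a.
Proof.
have : 1 <= q%:R :> R by rewrite ler1n.
by rewrite -natr1; lra.
Qed.

(** Integrability of the weight is drawn from the existence of an observation; the sample of size 1
    supplies one. *)
Let iw : (@lebesgue_measure R).-integrable `](-1)%R, 1%R[%classic
  (EFin \o (fun s : R => (1 - s ^+ 2) `^ a)).
Proof. exact: (integrable_beta_weight q0 (theta1 1) Ff ((mX 1).2 ord0)). Qed.

Let dimE : 2 * (a + 1) = q%:R. Proof. by rewrite -natr1; field. Qed.

Let rate_oo : r n @[n --> \oo] --> +oo.
Proof. exact: cvg_comp kappa_oo (classF_diverges Ff). Qed.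

Let rate_gt0 : \forall n \near \oo, 0 < r n.
Proof. exact: (cvgryPgt _).1 rate_oo 0. Qed.

Let near_n0 : \forall n \near \oo, (0 < n)%N.
Proof. by exists 1%N. Qed.

Let cvgVn : (n%:R^-1 : R) @[n --> \oo] --> (0 : R).
Proof. by apply/gtr0_cvgV0; [apply: filterS near_n0 => n; rewrite ltr0n|exact: cvgr_idn]. Qed.

Let cvgVr : (r n)^-1 @[n --> \oo] --> (0 : R).
Proof. exact/gtr0_cvgV0. Qed.

Let nu_sqr : \forall n \near \oo, 0 < nu n /\ nu n ^+ 2 * (n%:R * r n) = 1.
Proof.
near=> n; have n0 : (0 < n)%N by near: n. 
have r0 : 0 < r n by near: n.
have nr0 : 0 < n%:R * r n by rewrite mulr_gt0 ?ltr0n.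
rewrite /nu_ -/(r n) div1r invr_gt0 sqrtr_gt0 exprVn sqr_sqrtr ?(ltW nr0)//.
by rewrite mulVf// gt_eqF.
Unshelve. all: by end_near. Qed.

Let cvg_nu2 : nu n ^+ 2 @[n --> \oo] --> (0 : R).
Proof.
have h : n%:R^-1 * (r n)^-1 @[n --> \oo] --> (0 : R).
  by rewrite -[0 in X in _ --> X](mul0r 0); exact: cvgM.
apply: cvg_trans h; apply: near_eq_cvg; near=> n.
have [nu0 h] : 0 < nu n /\ nu n ^+ 2 * (n%:R * r n) = 1 by near: n.
have nr0 : n%:R * r n != 0 by apply: contra_eq_neq h => ->; rewrite mulr0 eq_sym oner_eq0.
by apply: (mulIf nr0); rewrite h -invfM mulVf.
Unshelve. all: by end_near. Qed.

Let moments : exists C, forall eps, 0 < eps -> \forall n \near \oo,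
  `|r n * m1 n - q%:R| <= eps /\ r n ^+ 2 * m2 n <= C.
Proof.
have [C H] := classF_angular_moments iw a1 Ff.
exists C => eps eps0; near=> n.
have [I0 h1 h2] : [/\ 0 < angular_moment a f (kappa n) 0,
   `|r n * angular_moment a f (kappa n) 1 - 2 * (a + 1) * angular_moment a f (kappa n) 0| <=
        eps * angular_moment a f (kappa n) 0 &
      r n ^+ 2 * angular_moment a f (kappa n) 2 <= C * angular_moment a f (kappa n) 0].
  by near: n; exact: (kappa_oo (H eps eps0)).
split; last by rewrite /mean_moment mulrA ler_pdivrMr.
have -> : r n * m1 n - q%:R = (r n * angular_moment a f (kappa n) 1 -
    2 * (a + 1) * angular_moment a f (kappa n) 0) / angular_moment a f (kappa n) 0.
  have I0' : angular_moment a f (kappa n) 0 != 0 by rewrite gt_eqF.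
  have gen (A B C0 I : R) : I != 0 -> A * (B / I) - C0 = (A * B - C0 * I) / I.
    by move=> I1; field.
  by rewrite dimE; exact: gen.
by rewrite normrM normfV (gtr0_norm I0) ler_pdivrMr.
Unshelve. all: by end_near. Qed.

Let cvg_m1 : r n * m1 n @[n --> \oo] --> (q%:R : R).
Proof.
have [C H] := moments.
by apply/cvgrPdistC_le => e e0; apply: filterS (H e e0) => n [].
Qed.

Let bound_m2 : exists C, \forall n \near \oo, r n ^+ 2 * m2 n <= C.
Proof. by have [C H] := moments; exists C; apply: filterS (H 1 ltr01) => n []. Qed.

Let nuX n (i : 'I_n) := (mX n).2 i.

Let cvg_defect : defect n @[n --> \oo] --> (0 : R).
Proof.
apply/cvgrPdist_le => e e0; near=> n.
have n0 : (0 < n)%N by near: n.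
have I0 : 0 < angular_moment a f (kappa n) 0.
  exact: (angular_moment0_gt0 q0 (theta1 n) (kappa_gt0 n) Ff (nuX (Ordinal n0))).
have h : angular_defect a f (kappa n) <= e * angular_moment a f (kappa n) 0.
  near: n; exact: (kappa_oo (classF_angular_defect iw a1 Ff e0)).
have h0 : 0 <= defect n.
  have := integral_mean_defect q0 n0 (theta1 n) (kappa_gt0 n) Ff (mX n).
  by rewrite -lee_fin; apply: le_trans; exact: integral_ge0.
by rewrite sub0r normrN ger0_norm// /mean_defect ler_pdivrMr.
Unshelve. all: by end_near. Qed.

Let s0 n := tangent (theta n) (tau n).
Let S2 n (w : Omega n) : R := dot (sample_walk (@X n) (theta n) (kappa n) f (s0 n) w)
  (sample_walk (@X n) (theta n) (kappa n) f (s0 n) w).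

Let perp n : dot (s0 n) (theta n) = 0. Proof. exact: dot_tangent_theta. Qed.

(** [tau n] is only asymptotically tangent: its component along [theta n] is [nu n |tau n|^2 / 2],
    which tends to 0. *)
Let cvg_s0 : dot (s0 n) (s0 n) @[n --> \oo] --> b.
Proof.
have ct := cvg_dot cvg_tau.
rewrite -[b]subr0 -[X in _ - X](mul0r (b ^+ 2 / 4)).
have h : dot (tau n) (tau n) - nu n ^+ 2 * (dot (tau n) (tau n) ^+ 2 / 4) @[n --> \oo] --> b - 0 * (b ^+ 2 / 4).
  by apply: cvgB => //; apply: cvgM => //; apply: cvgMl; rewrite expr2; exact: cvgM.
apply: cvg_trans h; apply: near_eq_cvg; near=> n.
have [nu0 h] : 0 < nu n /\ nu n ^+ 2 * (n%:R * r n) = 1 by near: n.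
have tE : theta n = theta0 + nu n *: tau n by near: n.
rewrite (dot_tangentxx (theta1 n)) (tau_theta theta01 (theta1 n) tE nu0).
by field.
Unshelve. all: by end_near. Qed.

Let mS2 n : measurable_fun setT (@S2 n).
Proof.
exact: measurableT_comp (@measurable_dotxx R q.+1) (measurable_sample_walk _ _ _ _ _).
Qed.

Let S20 n w : 0 <= @S2 n w. Proof. exact: dotxx_ge0. Qed.

Let ES2 : exists C, \forall n \near \oo, (\int[P n]_w (@S2 n w)%:E <= C%:E)%E.
Proof.
exists (b + q%:R + 1).
have : dot (s0 n) (s0 n) + r n * m1 n @[n --> \oo] --> b + q%:R by exact: cvgD.
move/cvgrPdist_le => /(_ 1 ltr01) h; near=> n.
have n0 : (0 < n)%N by near: n.
have r0 : 0 < r n by near: n.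
rewrite (integral_sample_walk_sqr q0 n0 (theta1 n) (kappa_gt0 n) Ff (mX n) r0 (perp n)) lee_fin.
have : `|b + q%:R - (dot (s0 n) (s0 n) + r n * m1 n)| <= 1 by near: n.
by rewrite ler_norml => /andP[+ _]; lra.
Unshelve. all: by end_near. Qed.

Let laplace_S2 k : 0 <= k ->
  \int[P n]_w expR (- (k * @S2 n w)) @[n --> \oo] --> gauss_heat q%:R k (k * b).
Proof.
move=> k0; have [C HC] := bound_m2.
have qn0 : q%:R != 0 :> R by rewrite gt_eqF ?ltr0n.
have h : gauss_heat q%:R (k * (r n * m1 n / q%:R)) (k * dot (s0 n) (s0 n)) @[n --> \oo] -->
    gauss_heat q%:R k (k * b).
  apply: cvg_gauss_heat => //; last exact: cvgMr.
  have h1 : r n * m1 n / q%:R @[n --> \oo] --> (1 : R).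
    rewrite -[X in _ --> X](mulfV qn0).
    by apply: cvgM; [exact: cvg_m1|exact: cvg_cst].
  by rewrite -[X in _ --> X]mulr1; apply: cvgM => //; exact: cvg_cst.
(* The bound of [laplace_sample_walk] with [r m1] replaced by its eventual bound [q + 1] and
   [r^2 m2] by [C]. *)
pose err n := 19 * (k ^+ 2 * C + k * (q%:R + 1)) * (Num.sqrt n%:R)^-1 +
  (q%:R ^+ 2 + 6 * q%:R + 16) * (k * ((q%:R + 1) / q%:R)) ^+ 2 * n%:R^-1 : R.
have err0 : err n @[n --> \oo] --> (0 : R).
  rewrite -[X in _ --> X]addr0 -[X in _ --> X + _](mulr0 (19 * (k ^+ 2 * C + k * (q%:R + 1)))).
  rewrite -[X in _ --> _ + X](mulr0 ((q%:R ^+ 2 + 6 * q%:R + 16) * (k * ((q%:R + 1) / q%:R)) ^+ 2)).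
  apply: cvgD; last exact: cvgMr.
  apply: cvgMr.
  have -> : (fun n : nat => (Num.sqrt n%:R)^-1 : R) = fun n => Num.sqrt (n%:R^-1).
    by apply/funext => n; rewrite sqrtrV.
  rewrite -[0](@sqrtr0 R).
  exact: (@cvg_comp _ _ _ (fun n : nat => n%:R^-1 : R) (@Num.sqrt R) _ (nbhs 0) _ cvgVn (@sqrt_continuous R 0)).
apply/cvgrPdist_le => e e0.
have e2 : 0 < e / 2 by rewrite divr_gt0.
move/cvgrPdist_le : h => /(_ _ e2) h.
move/cvgrPdist_le : err0 => /(_ _ e2) h'.
move/cvgrPdist_le : cvg_m1 => /(_ 1 ltr01) hm.
near=> n.
have n0 : (0 < n)%N by near: n.
have r0 : 0 < r n by near: n.
have H := laplace_sample_walk q0 n0 (theta1 n) (kappa_gt0 n) Ff (mX n) r0 (perp n) k0.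
have gh : `|gauss_heat q%:R k (k * b) -
   gauss_heat q%:R (k * (r n * m1 n / q%:R)) (k * dot (s0 n) (s0 n))| <= e / 2 by near: n.
have eh : `|0 - err n| <= e / 2 by near: n.
have mh : `|q%:R - r n * m1 n| <= 1 by near: n.
have Ch : r n ^+ 2 * m2 n <= C by near: n.
rewrite (le_trans (ler_distD (gauss_heat q%:R (k * (r n * m1 n / q%:R)) (k * dot (s0 n) (s0 n))) _ _))//.
rewrite [e]splitr lerD// distrC (le_trans H)//.
apply: le_trans eh; rewrite sub0r normrN; apply: le_trans (ler_norm _).
have m1q : r n * m1 n <= q%:R + 1 by move: mh; rewrite ler_norml => /andP[+ _]; lra.
have m10 : 0 <= r n * m1 n.
  by rewrite mulr_ge0 ?(ltW r0)// (mean_moment_ge0 q0 n0 (theta1 n) (kappa_gt0 n) Ff (mX n)).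
have nn0 : 0 <= n%:R^-1 :> R by rewrite invr_ge0.
rewrite /err lerD//.
  rewrite ler_wpM2r ?invr_ge0 ?sqrtr_ge0// ler_wpM2l// lerD//.
    by rewrite ler_wpM2l// sqr_ge0.
  by rewrite ler_wpM2l.
rewrite ler_wpM2r// ler_wpM2l// ?addr_ge0 ?mulr_ge0 ?sqr_ge0//.
move: (r n * m1 n) m10 m1q => z z0 zq.
apply: lerXn2r; rewrite ?nnegrE ?mulr_ge0 ?divr_ge0 ?addr_ge0//.
by apply: ler_wpM2l => //; rewrite ler_wpM2r ?invr_ge0.
Unshelve. all: by end_near. Qed.

Let kbar n (w : Omega n) : R :=
  r n * (n%:R^-1 * \sum_(i < n) dot (tangent (theta n) (X i w)) (tangent (theta n) (X i w))).
Let ubar n (w : Omega n) : R := n%:R^-1 * \sum_(i < n) dot (X i w) (theta n).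
(** The two sample averages on which the deterministic comparison depends. The first deviation is
    controlled in mean and the second in mean square, hence the square on one term only. *)
Let D n (w : Omega n) : R := `|1 - @ubar n w| + (@kbar n w - r n * m1 n) ^+ 2.

Let mubar n : measurable_fun setT (@ubar n).
Proof.
apply: measurable_funM => //; apply: measurable_sum => i.
exact: measurableT_comp (measurable_dotr (theta n)) _.
Qed.

Let mkbar n : measurable_fun setT (@kbar n).
Proof.
do 2 apply: measurable_funM => //; apply: measurable_sum => i.
apply: measurableT_comp (@measurable_dotxx R q.+1) _.
exact: measurableT_comp (measurable_tangent (theta n)) _.
Qed.

Let mD1 n : measurable_fun setT (fun w => `|1 - @ubar n w|).
Proof. by apply: measurableT_comp => //; exact: measurable_funB. Qed.

Let mD2 n : measurable_fun setT (fun w => (@kbar n w - r n * m1 n) ^+ 2).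
Proof. by apply: measurable_funX; exact: measurable_funB. Qed.

Let mD n : measurable_fun setT (@D n). Proof. exact: measurable_funD. Qed.

Let D0 n w : 0 <= @D n w. Proof. by rewrite addr_ge0 ?sqr_ge0. Qed.

Let ED : exists2 dn : nat -> R, dn n @[n --> \oo] --> (0 : R) &
  \forall n \near \oo, (\int[P n]_w (@D n w)%:E <= (dn n)%:E)%E.
Proof.
have [C HC] := bound_m2.
exists (fun n => defect n + C * n%:R^-1).
  rewrite -[X in _ --> X]addr0 -[X in _ --> _ + X](mulr0 C).
  by apply: cvgD => //; apply: cvgM => //; exact: cvg_cst.
near=> n.
have n0 : (0 < n)%N by near: n.
have Ch : r n ^+ 2 * m2 n <= C by near: n.
under eq_integral do rewrite EFinD.
rewrite ge0_integralD//; first last.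
- exact/measurable_EFinP.
- by move=> w _; rewrite lee_fin sqr_ge0.
- exact/measurable_EFinP.
rewrite EFinD leeD//; first exact: (integral_mean_defect q0 n0 (theta1 n) (kappa_gt0 n) Ff (mX n)).
apply: le_trans (integral_mean_tangent_sqr q0 n0 (theta1 n) (kappa_gt0 n) Ff (mX n)) _.
by rewrite lee_fin ler_wpM2r ?invr_ge0.
Unshelve. all: by end_near. Qed.

Let W n (w : Omega n) : R := watson theta0 (fun i => X i w).
Let V n (w : Omega n) : R := wald theta0 (fun i => X i w).

Let mW n : measurable_fun setT (@W n). Proof. exact: measurable_watson. Qed.
Let mV n : measurable_fun setT (@V n). Proof. exact: measurable_wald. Qed.

Let close M e : 0 < M -> 0 < e -> exists2 eta, 0 < eta & \forall n \near \oo,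
  {ae P n, forall w, @D n w <= eta -> @S2 n w <= M ->
    `|@W n w - @S2 n w| <= e /\ `|@W n w - @V n w| <= e}.
Proof.
move=> M0 e0.
have [B BE B0] : exists2 B, B = b + 1 & 0 <= B.
  by exists (b + 1) => //; rewrite addr_ge0 ?dotxx_ge0.
pose C0 := 4 + B * (q%:R + 1).
pose C1 := 3 * B + 2 * (B * (2 * M + 2 * B) + 1) + B ^+ 2 +
  2 * (B ^+ 2 + B * (2 * M + 2 * B)).
have Mge0 := ltW M0.
have C00 : 0 < C0 by rewrite /C0 ltr_pwDl// mulr_ge0// addr_ge0.
have C10 : 0 <= C1.
  by rewrite !addr_ge0 ?mulr_ge0 ?addr_ge0 ?mulr_ge0 ?sqr_ge0 ?addr_ge0 ?mulr_ge0.
pose K1 := 2 * (q%:R * C1 + C0 * M).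
pose K2 := 8 * q%:R * (M + C1) ^+ 2.
have K10 : 0 <= K1 by rewrite mulr_ge0// addr_ge0 ?mulr_ge0 ?(ltW C00).
have K20 : 0 <= K2 by apply: mulr_ge0; [exact: mulr_ge0|exact: sqr_ge0].
(* The sum serves both conclusions at once, and the 1 keeps it positive. *)
pose K := K1 + K2 + 1.
have K0 : 0 < K by rewrite ltr_wpDl ?addr_ge0.
pose eta := Num.min 2^-1 (Num.min (2^-1 / C0) (e / K)).
have eta0 : 0 < eta by rewrite /eta !lt_min; apply/and3P; split; rewrite ?divr_gt0 ?invr_gt0.
have [eta2 etaC etaK] : [/\ eta <= 2^-1, eta <= 2^-1 / C0 & eta <= e / K].
  by rewrite /eta; split; rewrite !ge_min lexx ?orbT.
have eK1 : eta * K1 <= e.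
  move: etaK; rewrite ler_pdivlMr// => h; apply: le_trans h.
  by rewrite ler_wpM2l ?(ltW eta0)// /K; lra.
have eK2 : eta * K2 <= e.
  move: etaK; rewrite ler_pdivlMr// => h; apply: le_trans h.
  by rewrite ler_wpM2l ?(ltW eta0)// /K; lra.
have etaC0 : eta * C0 <= 2^-1 by rewrite -ler_pdivlMr.
exists (eta ^+ 2); first exact: exprn_gt0.
have ct := cvg_dot cvg_tau.
have cBn : 2 * B * n%:R^-1 @[n --> \oo] --> (0 : R).
  by rewrite -[X in _ --> X](mulr0 (2 * B)); apply: cvgM => //; exact: cvg_cst.
have cne : n%:R^-1 * eta^-1 @[n --> \oo] --> (0 : R).
  by rewrite -[X in _ --> X](mul0r eta^-1); apply: cvgM => //; exact: cvg_cst.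
move/cvgrPdist_le : ct => /(_ 1 ltr01) ct.
move/cvgrPdist_le : cBn => /(_ _ eta0) cBn.
move/cvgrPdist_le : cne => /(_ _ eta0) cne.
move/cvgrPdist_le : cvg_nu2 => /(_ _ eta0) cnu.
move/cvgrPdistC_le : cvg_m1 => /(_ _ eta0) cm.
near=> n.
have n0 : (0 < n)%N by near: n.
have r0 : 0 < r n by near: n.
have [nu0 nu2] : 0 < nu n /\ nu n ^+ 2 * (n%:R * r n) = 1 by near: n.
have tE : theta n = theta0 + nu n *: tau n by near: n.
have tB : dot (tau n) (tau n) <= B.
  have : `|b - dot (tau n) (tau n)| <= 1 by near: n.
  by rewrite ler_norml => /andP[+ _]; rewrite BE; lra.
have Bn : 2 * B / n%:R <= eta.
  have : `|0 - 2 * B * n%:R^-1| <= eta by near: n.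
  by rewrite sub0r normrN; exact: le_trans (ler_norm _).
have ne : (n%:R * eta)^-1 <= eta.
  have : `|0 - n%:R^-1 * eta^-1| <= eta by near: n.
  by rewrite sub0r normrN invfM; exact: le_trans (ler_norm _).
have nB : nu n ^+ 2 <= eta.
  have : `|0 - nu n ^+ 2| <= eta by near: n.
  by rewrite sub0r normrN; exact: le_trans (ler_norm _).
have mq : `|r n * m1 n - q%:R| <= eta by near: n.
apply: (sample_sphere_ae Ff (mX n)) => w sw Dw Sw.
have SE : sample_walk (@X n) (theta n) (kappa n) f (s0 n) w = tangent (theta n) (tau n) +
    Num.sqrt (r n / n%:R) *: \sum_i tangent (theta n) (X i w).
  rewrite /sample_walk /walk scaler_sumr; congr (_ + _); apply: eq_bigl => i.
  by rewrite ltn_ord.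
have uE : @ubar n w = dot (sample_mean (fun i => X i w)) (theta n).
  by rewrite /ubar /sample_mean dotZl dot_suml.
rewrite /S2 SE in Sw *; rewrite /D uE in Dw.
have eta12 : 0 < eta <= 2^-1 by rewrite eta0 eta2.
have [h1 h2] := watson_wald_close n0 theta01 (theta1 n) tE r0 nu0 nu2 sw eta12 tB Mge0 nB Bn
  ne mq q0 etaC0 Dw Sw.
by split; [exact: le_trans h1 eK1|exact: le_trans h2 eK2].
Unshelve. all: by end_near. Qed.

Lemma watson_wald_oP1 : oP1 P (fun n w => @W n w - @V n w).
Proof.
have [dn dn0 HD] := ED; have [C HC] := ES2.
apply: (@oP1_small_tight _ _ _ _ _ D S2 dn C) => // [n|M e M0 e0].
  exact: measurable_funB.
have [eta eta0 H] := close M0 e0; exists eta => //.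
by apply: filterS H => n; apply: filterS => w h h1 h2; exact: (h h1 h2).2.
Qed.

(** Almost surely all observations lie on the sphere; there Cauchy-Schwarz makes both numerator and
    denominator nonnegative. *)
Let watson_ge0 : \forall n \near \oo, {ae P n, forall w, 0 <= @W n w}.
Proof.
near=> n; have n0 : (0 < n)%N by near: n.
have nn0 : 0 < n%:R :> R by rewrite ltr0n.
apply: (sample_sphere_ae Ff (mX n)) => w sw.
have cs (x : 'cV[R]_q.+1) : dot x theta0 ^+ 2 <= dot x x.
  by have := cauchy_schwarz x theta0; rewrite (spherexx theta01) mulr1.
rewrite /W /watson divr_ge0//.
  apply: mulr_ge0; last by rewrite quadE subr_ge0; exact: cs.
  by apply: mulr_ge0; [exact: ltW|rewrite subr_ge0 ler1n].
rewrite subr_ge0 mulrC ler_pdivrMr// mul1r.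
rewrite -[leRHS]/(n%:R) -[X in _ <= X%:R](card_ord n) -sum1_card natr_sum.
by apply: ler_sum => i _; rewrite (le_trans (cs _))// (spherexx (sw i)).
Unshelve. all: by end_near. Qed.

Lemma watson_cvg_in_law : cvg_in_law P W (noncentral_chisq q (enorm tau_lim ^+ 2)).
Proof.
move=> g cg bg.
have [dn dn0 HD] := ED; have [C HC] := ES2.
(* Laplace transforms require nonnegativity at every sample point, whereas [W] may be negative when
   an observation leaves the sphere. Its absolute value is used instead and agrees with it almost
   surely for [n > 0]. *)
pose Y n (w : Omega n) : R := `|@W n w|.
have mY n : measurable_fun setT (@Y n) by exact: measurableT_comp.
have Y0 n w : 0 <= @Y n w by exact: normr_ge0.
have YS : oP1 P (fun n w => @Y n w - @S2 n w).
  apply: (@oP1_small_tight _ _ _ _ _ D S2 dn C) => // [n|M e M0 e0].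
    exact: measurable_funB.
  have [eta eta0 H] := close M0 e0; exists eta => //.
  apply: filterS H => n; apply: filterS => w h h1 h2.
  apply: le_trans (h h1 h2).1; rewrite -{1}(ger0_norm (S20 w)); exact: ler_dist_dist.
have bb : 0 <= enorm tau_lim ^+ 2 by exact: sqr_ge0.
have lap (k : nat) : \int[P n]_w expR (- (k%:R * @Y n w)) @[n --> \oo] -->
    \int[@shifted_normal R q (enorm tau_lim ^+ 2)]_z expR (- (k%:R * dot z z)).
  rewrite laplace_shifted_normal// sqr_enorm.
  by apply: (laplace_oP1 mY mS2 Y0 S20 YS) => //; exact: laplace_S2.
have [M _ gM] : exists2 M, 0 <= M & forall x, `|g x| <= M.
  by have [M [Mr /(_ (`|M| + 1))]] := bg; rewrite (le_lt_trans (ler_norm _)) ?ltrDl// => /(_ isT) h; exists (`|M| + 1) => // x; exact: h.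
have mg : measurable_fun setT g by exact: continuous_measurable_fun.
have := laplace_cvg mY Y0 (@measurable_dotxx R q) (@dotxx_ge0 R q) lap cg bg.
move=> H; rewrite (integral_noncentral_chisq q _ mg gM).
apply/fine_cvgP; split.
  apply: nearW => n; rewrite unlock; apply: integrable_fin_num => //.
  have mgW : measurable_fun setT (g \o @W n) by exact: measurableT_comp.
  by apply: (@integrable_bounded _ _ _ _ _ M) mgW _ => w; exact: gM.
apply: cvg_trans H; apply: near_eq_cvg.
apply: filterS watson_ge0 => n h /=; rewrite unlock /Rintegral; congr fine.
apply: ae_eq_integral => //.
- by apply/measurable_EFinP; exact: measurableT_comp.
- by apply/measurable_EFinP; exact: measurableT_comp.
- by apply: filterS h => w h _; rewrite /Y ger0_norm.
Qed.

End local_asymptotics.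

Theorem theorem4p1 (R : realType) (p : nat) (theta0 : 'cV[R]_p) (f : R -> R)
    (kappa : nat -> R) (tau theta : nat -> 'cV[R]_p) (tau_lim : 'cV[R]_p) :
  (2 <= p)%N -> sphere theta0 -> classF f ->
  (forall n, 0 < kappa n) -> kappa n @[n --> \oo] --> +oo ->
  tau n @[n --> \oo] --> tau_lim ->
  (forall n, sphere (theta n)) ->
  (\forall n \near \oo, theta n = theta0 + nu_ f kappa n *: tau n) ->
  (forall (d : nat -> measure_display) (Omega : forall n, measurableType (d n))
      (P : forall n, probability (Omega n) R)
      (X : forall n, 'I_n -> {RV (P n) >-> 'cV[R]_p}),
    let W n (w : Omega n) := watson theta0 (fun i => X n i w) in
    let S n (w : Omega n) := wald theta0 (fun i => X n i w) in
    (forall n, model (X n) theta0 (kappa n) f) ->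
    oP1 P (fun n w => W n w - S n w) /\ cvg_in_law P W (chisq R p.-1)) /\
  (forall (d : nat -> measure_display) (Omega : forall n, measurableType (d n))
      (P : forall n, probability (Omega n) R)
      (X : forall n, 'I_n -> {RV (P n) >-> 'cV[R]_p}),
    let W n (w : Omega n) := watson theta0 (fun i => X n i w) in
    let S n (w : Omega n) := wald theta0 (fun i => X n i w) in
    (forall n, model (X n) (theta n) (kappa n) f) ->
    oP1 P (fun n w => W n w - S n w) /\
    cvg_in_law P W (noncentral_chisq p.-1 (enorm tau_lim ^+ 2))).
Proof.
(* With [p = q.+2] the ambient dimension has the form [q'.+1] with [0 < q'], as all the preceding
   results require, and [p.-1] computes to [q']. *)
case: p theta0 tau theta tau_lim => [|[|q]]// theta0 tau theta tau_lim _ th0 Ff k0 koo ct th1 thE.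
split=> d Omega P X W S mX; last first.
  split; first exact: (watson_wald_oP1 (ltn0Sn q) th0 Ff k0 koo ct th1 thE mX).
  exact: (watson_cvg_in_law (ltn0Sn q) th0 Ff k0 koo ct th1 thE mX).
have ct0 : (0 : 'cV[R]_q.+2) @[n --> \oo] --> (0 : 'cV[R]_q.+2) by exact: cvg_cst.
have thE0 : \forall n \near \oo, theta0 = theta0 + nu_ f kappa n *: (0 : 'cV[R]_q.+2).
  by apply: nearW => n; rewrite scaler0 addr0.
split; first exact: (watson_wald_oP1 (ltn0Sn q) th0 Ff k0 koo ct0 (fun=> th0) thE0 mX).
have := watson_cvg_in_law (ltn0Sn q) th0 Ff k0 koo ct0 (fun=> th0) thE0 mX.
by rewrite sqr_enorm dot0r.
Qed.
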